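(* Let $\mathfrak B(V)$ be a Nichols algebra of diagonal type with $\dim V\ge 2$. Let $D$ be its set of hard super-letters, with $|D|=s$, $D=\{[u_1],\dots,[u_s]\}$ where $u_s<u_{s-1}<\cdots<u_1$. Then the set $$\Big\{[u_1]^{k_1}[u_2]^{k_2}\cdots[u_s]^{k_s}\ \Big|\ [u_i]\in D,\ 0\le k_i<h_{u_i}\ (1\le i\le s),\ \mu([u_1]^{k_1}\cdots[u_s]^{k_s})\text{ is connected},\ \sum_{i=1}^s k_i>0\Big\}$$ is a basis of the Nichols braided Lie algebra $\mathfrak L(V)$.
   Context: $F$ is an algebraically closed field of characteristic zero. $V$ is a braided vector space of diagonal type over $F$: it has a basis $x_1,\dots,x_n$ and braiding $C(x_i\otimes x_j)=p_{ij}\,x_j\otimes x_i$ with $p_{ij}\in F\setminus\{0\}$. $\mathfrak B(V)$ is the Nichols algebra of $V$, which is $\mathbb Z^n$-graded with $\deg x_i=e_i$. Let $\chi$ be the bicharacter on $\mathbb Z^n$ with $\chi(e_i,e_j)=p_{ij}$; for homogeneous $u,v$ (or words $u,v$) put $p_{uv}=p_{u,v}:=\chi(\deg u,\deg v)$ and $\widetilde p_{uv}:=p_{uv}p_{vu}$. Nichols braided Lie algebra: $\mathfrak L(V)$ is the smallest linear subspace of $\mathfrak B(V)$ that contains $V$ and is closed under the bracket given on homogeneous elements by $[x,y]=yx-p_{yx}xy$. Super-letters: order words in $x_1<x_2<\cdots<x_n$ lexicographically (a proper prefix of a word is smaller than the word). For a Lyndon word $u$, the super-letter $[u]\in\mathfrak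 B(V)$ is defined by $[x_i]=x_i$ and $[u]=[[v],[w]]$ if $|u|>1$ and $u=vw$ is the Shirshov (standard) factorization into Lyndon words. $[u]$ is called hard if it is not a linear combination of products $[w_1][w_2]\cdots[w_r]$ of the same degree as $u$ with all $w_j$ Lyndon words satisfying $w_j>u$. $D$ is the set of hard super-letters. For $[u]\in D$, the height is $h_u:=\mathrm{ord}(p_{uu})$ if $p_{uu}\neq1$ is a root of unity, and $h_u:=\infty$ otherwise. The pure generalized Dynkin diagram $\Gamma(V)$ is the graph with vertices $x_1,\dots,x_n$ and an edge between $x_i,x_j$ ($i\neq j$) iff $\widetilde p_{x_i,x_j}\ne 1$. For a $\mathbb Z^n$-homogeneous element $u$, $\mu(u)$ is the set of those $x_i$ that occur in $u$ (i.e. with non-zero $i$-th coordinate of $\deg u$); $\mu(u)$ is called connected if the full subgraph of $\Gamma(V)$ on $\mu(u)$ is connected and $p_{x_i,x_i}\neq1$ for all $x_i\in\mu(u)$.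
   Formalization: The formal theorem adds the assumption p_ii ≠ 1 for all i; otherwise the claim always fails, since x_i is a nonzero element of L(V) but no element of the displayed set has degree e_i (e.g. n = 2, all p_ij = 1). *)

(* Defs.v *)
From HB Require Import structures.
From mathcomp Require Import all_boot all_order all_algebra.
From mathcomp Require Import finmap.
From mathcomp.multinomials Require Import monalg.

Set Implicit Arguments.
Unset Strict Implicit.
Unset Printing Implicit Defensive.

Import Order.TTheory GRing.Theory.
Local Open Scope ring_scope.

(* The tensor algebra T(V), i.e. the monoid algebra of the words in the basis
   x_0, ..., x_(n-1) of V.  Its operations are those of monalg, sealed because
   unification otherwise unfolds them at great cost. *)
Definition tens (F : fieldType) (n : nat) : Type := {malg F[{fmonom 'I_n}]}.

HB.instance Definition _ (F : fieldType) (n : nat) := Choice.on (tens F n).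

HB.lock Definition tzero (F : fieldType) (n : nat) : tens F n :=
  0 :> {malg F[{fmonom 'I_n}]}.
HB.lock Definition topp (F : fieldType) (n : nat) (f : tens F n) : tens F n :=
  - (f : {malg F[{fmonom 'I_n}]}).
HB.lock Definition tadd (F : fieldType) (n : nat) (f g : tens F n) : tens F n :=
  (f : {malg F[{fmonom 'I_n}]}) + g.
HB.lock Definition tone (F : fieldType) (n : nat) : tens F n :=
  1 :> {malg F[{fmonom 'I_n}]}.
HB.lock Definition tmul (F : fieldType) (n : nat) (f g : tens F n) : tens F n :=
  (f : {malg F[{fmonom 'I_n}]}) * g.
HB.lock Definition tscale (F : fieldType) (n : nat) (c : F) (f : tens F n) :
  tens F n := c *: (f : {malg F[{fmonom 'I_n}]}).
HB.lock Definition tword (F : fieldType) (n : nat) (w : seq 'I_n) : tens F n :=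
  << FMonom w >>.

Arguments tzero {F n} : rename.
Arguments topp {F n} f : rename.
Arguments tadd {F n} f g : rename.
Arguments tone {F n} : rename.
Arguments tmul {F n} f g : rename.
Arguments tscale {F n} c f : rename.
Arguments tword {F n} w : rename.

Section TensorAlgebra.
Variables (F : fieldType) (n : nat).
Local Notation M := {malg F[{fmonom 'I_n}]}.
Local Notation T := (tens F n).
Implicit Types (f g : T) (c d : F) (u v w : seq 'I_n).

Lemma malg_scalerAr (c : F) (f g : M) : c *: (f * g) = f * (c *: g).
Proof.
apply/malgP => k; rewrite [LHS]mcoeffZ [in LHS]mcoeffMl.
rewrite (mcoeffMlw _ (fsubset_refl _) (msuppZ_le c g)) mulr_sumr.
apply: eq_bigr => u _; rewrite mulr_sumr; apply: eq_bigr => v _.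
by rewrite mcoeffZ mulrnAr mulrCA.
Qed.

Lemma taddA : associative (@tadd F n).
Proof. by move=> f g h; rewrite !tadd.unlock (@addrA M). Qed.
Lemma taddC : commutative (@tadd F n).
Proof. by move=> f g; rewrite !tadd.unlock (@addrC M). Qed.
Lemma tadd0 : left_id (@tzero F n) tadd.
Proof. by move=> f; rewrite tadd.unlock tzero.unlock (@add0r M). Qed.
Lemma taddN : left_inverse (@tzero F n) topp tadd.
Proof.
by move=> f; rewrite tadd.unlock topp.unlock tzero.unlock (@addNr M).
Qed.
HB.instance Definition _ := GRing.isZmodule.Build T taddA taddC tadd0 taddN.

Lemma tmulA : associative (@tmul F n).
Proof. by move=> f g h; rewrite !tmul.unlock (@mulrA M). Qed.
Lemma tmul1 : left_id (@tone F n) tmul.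
Proof. by move=> f; rewrite tmul.unlock tone.unlock (@mul1r M). Qed.
Lemma tmulr1 : right_id (@tone F n) tmul.
Proof. by move=> f; rewrite tmul.unlock tone.unlock (@mulr1 M). Qed.
Lemma tmulDl : left_distributive (@tmul F n) tadd.
Proof. by move=> f g h; rewrite tadd.unlock tmul.unlock (@mulrDl M). Qed.
Lemma tmulDr : right_distributive (@tmul F n) tadd.
Proof. by move=> f g h; rewrite tadd.unlock tmul.unlock (@mulrDr M). Qed.
Lemma tone_neq0 : tone != tzero :> T.
Proof. rewrite tone.unlock tzero.unlock; exact: (@oner_neq0 M). Qed.
HB.instance Definition _ := GRing.Zmodule_isNzRing.Build T
  tmulA tmul1 tmulr1 tmulDl tmulDr tone_neq0.

Lemma tscaleA c d f : tscale c (tscale d f) = tscale (c * d) f.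
Proof. by rewrite !tscale.unlock (@scalerA F M). Qed.
Lemma tscale1 : left_id 1 (@tscale F n).
Proof. by move=> f; rewrite tscale.unlock (@scale1r F M). Qed.
Lemma tscaleDr : right_distributive (@tscale F n) tadd.
Proof.
by move=> c f g; rewrite tadd.unlock tscale.unlock (@scalerDr F M).
Qed.
Lemma tscaleDl f : {morph tscale^~ f : c d / c + d >-> tadd c d}.
Proof.
by move=> c d; rewrite tadd.unlock tscale.unlock (@scalerDl F M).
Qed.
HB.instance Definition _ := GRing.Zmodule_isLmodule.Build F T
  tscaleA tscale1 tscaleDr tscaleDl.

Lemma tscaleAl c f g : tscale c (tmul f g) = tmul (tscale c f) g.
Proof. by rewrite tscale.unlock tmul.unlock (@scalerAl F M). Qed.
HB.instance Definition _ := GRing.Lmodule_isLalgebra.Build F T tscaleAl.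

Lemma tscaleAr c f g : tscale c (tmul f g) = tmul f (tscale c g).
Proof.
by rewrite tscale.unlock tmul.unlock; exact: malg_scalerAr.
Qed.
HB.instance Definition _ := GRing.Lalgebra_isAlgebra.Build F T tscaleAr.

Lemma tcoef0 m : (0 : T)@_m = 0.
Proof.
have -> : (0 : T) = tzero by [].
by rewrite tzero.unlock (@mcoeff0 _ F).
Qed.

Lemma tcoefD f g m : (f + g)@_m = f@_m + g@_m.
Proof.
have -> : f + g = tadd f g by [].
by rewrite tadd.unlock (@mcoeffD _ F).
Qed.

Lemma tcoefZ c f m : (c *: f)@_m = c * f@_m.
Proof.
have -> : c *: f = tscale c f by [].
by rewrite tscale.unlock (@mcoeffZ _ F).
Qed.

Lemma tword1 : tword [::] = 1 :> T.
Proof.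
have -> : (1 : T) = tone by [].
rewrite tone.unlock tword.unlock.
by have -> : FMonom [::] = mone :> {fmonom 'I_n} by apply: val_inj; rewrite /= fm1.
Qed.

Lemma twordM u v : tword u * tword v = tword (u ++ v) :> T.
Proof.
have -> : tword u * tword v = tmul (tword u) (tword v) by [].
rewrite tmul.unlock tword.unlock malgME !msuppU1 !big_seq_fset1.
rewrite !mcoeffUU mulr1; congr << _ >>; apply: val_inj => /=.
by rewrite /mmul /= /fmmul fmE.
Qed.

Lemma tcoef_sum (I : Type) (r : seq I) (E : I -> T) m :
  (\sum_(i <- r) E i)@_m = \sum_(i <- r) (E i)@_m.
Proof. by elim/big_ind2: _ => [|? ? ? ? <- <-|]; rewrite ?tcoef0 ?tcoefD. Qed.

Lemma tcoef_word w (m : {fmonom 'I_n}) :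
  (tword w : T)@_m = (w == m :> seq 'I_n)%:R.
Proof. by rewrite tword.unlock mcoeffU1 fmP. Qed.

Lemma tensE f : f = \sum_(m <- msupp f) f@_m *: tword m.
Proof.
apply/(@malgP _ F) => k; rewrite tcoef_sum.
rewrite {1}[f](@monalgE _ F) raddf_sum /=; apply: eq_bigr => m _.
by rewrite tcoefZ tcoef_word mcoeffU mulr_natr fmP.
Qed.

Lemma tens_ind (P : T -> Prop) : P 0 ->
  (forall c f g, P f -> P g -> P (c *: f + g)) ->
  (forall w, P (tword w)) -> forall f, P f.
Proof.
move=> P0 PD Pw f; rewrite [f]tensE.
by elim/big_ind: _ => // [g h Pg Ph | m _];
  [rewrite -[g]scale1r; apply: PD | rewrite -[_ *: _]addr0; apply: PD].
Qed.

(* The linear endomorphism of T(V) that sends each word w to e w. *)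
Definition lin (e : seq 'I_n -> T) (f : T) : T :=
  \sum_(m <- msupp f) f@_m *: e m.

Lemma linEw e (d : {fset {fmonom 'I_n}}) f : (msupp f `<=` d)%fset ->
  lin e f = \sum_(m <- d) f@_m *: e m.
Proof.
move=> le_fd; rewrite /lin (big_fset_incl _ le_fd) // => m _ /mcoeff_outdom ->.
by rewrite scale0r.
Qed.

Lemma lin_linear e : linear (lin e).
Proof.
move=> c f g; pose d := (msupp f `|` msupp g `|` msupp (c *: f + g))%fset.
rewrite !(@linEw e d); first last.
- by rewrite fsubsetU // fsubset_refl orbT.
- by rewrite /d -fsetUA fsubsetUl.
- by rewrite /d fsetUAC fsubsetUr.
rewrite scaler_sumr -big_split; apply: eq_bigr => m _ /=.
by rewrite tcoefD tcoefZ scalerDl scalerA.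
Qed.

HB.instance Definition _ e :=
  GRing.isLinear.Build F T T *:%R (lin e) (lin_linear e).

Lemma lin_tword e w : lin e (tword w) = e w.
Proof.
by rewrite /lin {1}tword.unlock msuppU1 big_seq_fset1 tcoef_word eqxx scale1r.
Qed.

End TensorAlgebra.

Section QuantumSymmetrizer.
Variables (F : fieldType) (n : nat) (p : 'I_n -> 'I_n -> F).
Local Notation T := (tens F n).
Implicit Types (f : T) (x y a : 'I_n) (w : seq 'I_n).

(* For a word w of length m, ins x w is
     (1 + C_1 + C_2 C_1 + ... + C_m ... C_2 C_1) (x (x) w),
   where C_k is the braiding C acting on the tensor factors k and k+1. *)
Fixpoint ins x w : T :=
  if w is y :: w' then
    tword (x :: w) + p x y *: (tword [:: y] * ins x w')
  else tword [:: x].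

(* The quantum symmetrizer: on the m-th tensor power of V it is S_m, where
   S_(m+1) = (1 + C_1 + C_2 C_1 + ... + C_m ... C_2 C_1) (id (x) S_m). *)
Definition qsym_word w : T := foldr (fun x => lin (ins x)) 1 w.

Definition qsym f : T := lin qsym_word f.

HB.instance Definition _ :=
  GRing.isLinear.Build F T T *:%R qsym (lin_linear qsym_word).

(* The mirror image of ins, and the degree-preserving map that scales w by the
   cost of moving y across it: they serve to show that ker qsym is two-sided. *)
Fixpoint rins y w : T :=
  if w is a :: w' then
    tword [:: a] * rins y w' + (\prod_(b <- w) p b y) *: tword (y :: w)
  else tword [:: y].

Definition twist y w : T := (\prod_(b <- w) p b y) *: tword w.

Lemma lin_insM x a f : lin (ins x) (tword [:: a] * f) =
  tword [:: x; a] * f + p x a *: (tword [:: a] * lin (ins x) f).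
Proof.
elim/tens_ind: f => [|c u v IHu IHv|w].
- by rewrite mulr0 !linear0 !mulr0 scaler0 addr0.
- rewrite mulrDr -scalerAr !linearD !linearZ /= IHu IHv.
  rewrite mulrDr -scalerAr mulrDr -scalerAr !scalerDr !scalerA.
  by rewrite [c * p _ _]mulrC addrACA.
by rewrite twordM !lin_tword /= twordM.
Qed.

Lemma lin_twistM y a f : lin (twist y) (tword [:: a] * f) =
  p a y *: (tword [:: a] * lin (twist y) f).
Proof.
elim/tens_ind: f => [|c u v IHu IHv|w].
- by rewrite mulr0 !linear0 !mulr0 scaler0.
- rewrite mulrDr -scalerAr !linearD !linearZ /= IHu IHv.
  rewrite mulrDr -scalerAr !scalerDr !scalerA.
  by rewrite [c * p _ _]mulrC.
rewrite twordM !lin_tword /twist /= big_cons.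
by rewrite -scalerAr twordM scalerA.
Qed.

Lemma lin_twist_ins y x w : lin (twist y) (ins x w) =
  (p x y * \prod_(b <- w) p b y) *: ins x w.
Proof.
elim: w => [|a w IH] /=.
  by rewrite lin_tword /twist big_cons.
rewrite linearD linearZ /= lin_tword lin_twistM IH /twist !big_cons.
rewrite scalerDr -scalerAr !scalerA; congr (_ *: _ + _ *: _).
by rewrite -mulrA mulrC; congr (_ * _); rewrite mulrCA.
Qed.

Lemma lin_rinsM y a f : lin (rins y) (tword [:: a] * f) =
  tword [:: a] * lin (rins y) f + p a y *: (tword [:: y; a] * lin (twist y) f).
Proof.
elim/tens_ind: f => [|c u v IHu IHv|w].
- by rewrite mulr0 !linear0 !mulr0 scaler0 addr0.
- rewrite mulrDr -scalerAr !linearD !linearZ /= IHu IHv.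
  rewrite mulrDr -scalerAr mulrDr -scalerAr !scalerDr !scalerA.
  by rewrite [c * p _ _]mulrC addrACA.
rewrite twordM !lin_tword /= /twist big_cons.
by rewrite -scalerAr twordM scalerA.
Qed.

Lemma ins_rins x y w : lin (ins x) (rins y w) = lin (rins y) (ins x w).
Proof.
elim: w => [|a w IH] /=.
  rewrite !lin_tword /= !twordM big_cons big_nil mulr1 /=.
  by rewrite addrC.
rewrite !linearD !linearZ /= !lin_tword lin_insM IH lin_rinsM lin_twist_ins.
rewrite /= !big_cons.
set c := \prod_(j <- w) _; set R := lin (rins y) _; set I := ins x w.
have tword2 b d : tword [:: b; d] = tword [:: b] * tword [:: d] :> T.
  by rewrite twordM.
rewrite !tword2 !mulrDr !scalerDr -!scalerAr !scalerA !mulrA !twordM -!addrA /=.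
congr (_ + _).
have -> : p a y * c * p x y = p x y * p a y * c by rewrite mulrC mulrA.
have -> : p x y * p a y * c * p x a = p x a * p a y * p x y * c.
  by rewrite mulrC !mulrA; congr (_ * _); rewrite mulrAC.
by rewrite [LHS]addrCA; congr (_ + _); rewrite [RHS]addrCA.
Qed.

Lemma qsym_cons x f : qsym (tword [:: x] * f) = lin (ins x) (qsym f).
Proof.
elim/tens_ind: f => [|c u v IHu IHv|w].
- by rewrite mulr0 !linear0.
- by rewrite mulrDr -scalerAr !linearD !linearZ /= IHu IHv.
by rewrite twordM /qsym !lin_tword.
Qed.

Lemma lin_ins_rins x y f : lin (ins x) (lin (rins y) f) = lin (rins y) (lin (ins x) f).
Proof.
elim/tens_ind: f => [|c u v IHu IHv|w].
- by rewrite !linear0.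
- by rewrite !linearD !linearZ /= IHu IHv.
by rewrite !lin_tword ins_rins.
Qed.

Lemma qsym_rcons y f : qsym (f * tword [:: y]) = lin (rins y) (qsym f).
Proof.
elim/tens_ind: f => [|c u v IHu IHv|w].
- by rewrite mul0r !linear0.
- by rewrite mulrDl -scalerAl !linearD !linearZ /= IHu IHv.
elim: w => [|a w IH].
  by rewrite twordM /qsym !lin_tword /= -tword1 !lin_tword.
have -> : tword (a :: w) = tword [:: a] * tword w :> T by rewrite twordM.
by rewrite -mulrA !qsym_cons IH lin_ins_rins.
Qed.

Definition qker : {pred T} := fun f => qsym f == 0.

Lemma qkerE f : (f \in qker) = (qsym f == 0). Proof. by []. Qed.

Lemma qker_zmod : zmod_closed qker.
Proof.
split=> [|f g]; first by rewrite qkerE linear0.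
by rewrite !qkerE => /eqP qf /eqP qg; rewrite linearB /= qf qg subrr.
Qed.

HB.instance Definition _ := GRing.isZmodClosed.Build T qker qker_zmod.

Lemma qkerZ c f : f \in qker -> c *: f \in qker.
Proof. by rewrite !qkerE linearZ /= => /eqP ->; rewrite scaler0. Qed.

Lemma qkerMl f g : g \in qker -> f * g \in qker.
Proof.
move=> qg; elim/tens_ind: f => [|c u v IHu IHv|w].
- by rewrite mul0r rpred0.
- by rewrite mulrDl -scalerAl rpredD // qkerZ.
elim: w => [|a w IH]; first by rewrite tword1 mul1r.
have -> : tword (a :: w) = tword [:: a] * tword w :> T by rewrite twordM.
move: IH; rewrite -mulrA !qkerE qsym_cons => /eqP ->.
by rewrite linear0.
Qed.

Lemma qkerMr f g : f \in qker -> f * g \in qker.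
Proof.
move=> qf; elim/tens_ind: g => [|c u v IHu IHv|w].
- by rewrite mulr0 rpred0.
- by rewrite mulrDr -scalerAr rpredD // qkerZ.
elim/last_ind: w => [|w a IH]; first by rewrite tword1 mulr1.
have -> : tword (rcons w a) = tword w * tword [:: a] :> T by rewrite twordM cats1.
move: IH; rewrite mulrA !qkerE qsym_rcons => /eqP ->.
by rewrite linear0.
Qed.

Lemma qker1 : 1 \notin qker.
Proof. by rewrite qkerE -tword1 /qsym lin_tword oner_eq0. Qed.

End QuantumSymmetrizer.

(* B(V) = T(V) / ker qsym; qsym preserves the length of words, so ker qsym is
   the direct sum of the ker S_m. *)
Definition nichols (F : fieldType) (n : nat) (p : 'I_n -> 'I_n -> F) : Type :=
  Quotient.quot (qker p).

HB.instance Definition _ (F : fieldType) (n : nat) (p : 'I_n -> 'I_n -> F) :=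
  GRing.Zmodule.on (nichols p).

Definition npi (F : fieldType) (n : nat) (p : 'I_n -> 'I_n -> F) (f : tens F n) :
  nichols p := (\pi_(Quotient.quot (qker p)) f)%qT.

Definition nrep (F : fieldType) (n : nat) (p : 'I_n -> 'I_n -> F)
  (a : nichols p) : tens F n := repr (a : Quotient.quot (qker p)).

HB.lock Definition nmul (F : fieldType) (n : nat) (p : 'I_n -> 'I_n -> F)
  (a b : nichols p) : nichols p := npi p (nrep a * nrep b).

HB.lock Definition nscale (F : fieldType) (n : nat) (p : 'I_n -> 'I_n -> F)
  (c : F) (a : nichols p) : nichols p := npi p (c *: nrep a).

Section NicholsAlgebra.
Variables (F : fieldType) (n : nat) (p : 'I_n -> 'I_n -> F).
Local Notation T := (tens F n).
Local Notation B := (nichols p).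
Local Notation npi := (npi p).
Local Notation nmul := (@nmul F n p).
Local Notation nscale := (@nscale F n p).
Implicit Types (f g : T) (a b : B) (c d : F).

Lemma npi_eq f g : (npi f == npi g) = (f - g \in qker p).
Proof. by rewrite Quotient.idealrBE. Qed.

Lemma nrepK : cancel (@nrep F n p) npi.
Proof. exact: reprK. Qed.

Lemma npi_rep f : nrep (npi f) - f \in qker p.
Proof. by rewrite -npi_eq nrepK. Qed.

Lemma npi_is_zmod_morphism : zmod_morphism npi.
Proof. by move=> f g; rewrite /npi raddfB. Qed.

HB.instance Definition _ :=
  GRing.isZmodMorphism.Build T B npi npi_is_zmod_morphism.

Lemma npi_mul f g : npi (f * g) = nmul (npi f) (npi g).
Proof.
apply/eqP; rewrite nmul.unlock eq_sym npi_eq.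
have -> : nrep (npi f) * nrep (npi g) - f * g =
    nrep (npi f) * (nrep (npi g) - g) + (nrep (npi f) - f) * g.
  by rewrite mulrBr mulrBl addrA subrK.
by apply: rpredD; [apply: qkerMl | apply: qkerMr]; apply: npi_rep.
Qed.

Lemma npi_scale c f : npi (c *: f) = nscale c (npi f).
Proof.
apply/eqP; rewrite nscale.unlock eq_sym npi_eq -scalerBr.
by apply: qkerZ; apply: npi_rep.
Qed.

Lemma nmulA : associative nmul.
Proof.
move=> a b c; rewrite -[a]nrepK -[b]nrepK -[c]nrepK.
by rewrite -!npi_mul mulrA.
Qed.
Lemma nmul1 : left_id (npi 1) nmul.
Proof. by move=> a; rewrite -[a]nrepK -npi_mul mul1r. Qed.
Lemma nmulr1 : right_id (npi 1) nmul.
Proof. by move=> a; rewrite -[a]nrepK -npi_mul mulr1. Qed.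
Lemma nmulDl : left_distributive nmul +%R.
Proof.
move=> a b c; rewrite -[a]nrepK -[b]nrepK -[c]nrepK.
by rewrite -raddfD -!npi_mul -raddfD mulrDl.
Qed.
Lemma nmulDr : right_distributive nmul +%R.
Proof.
move=> a b c; rewrite -[a]nrepK -[b]nrepK -[c]nrepK.
by rewrite -raddfD -!npi_mul -raddfD mulrDr.
Qed.
Lemma none_neq0 : npi 1 != 0.
Proof. by rewrite -(raddf0 npi) npi_eq subr0 qker1. Qed.
HB.instance Definition _ := GRing.Zmodule_isNzRing.Build B
  nmulA nmul1 nmulr1 nmulDl nmulDr none_neq0.

Lemma nscaleA c d a : nscale c (nscale d a) = nscale (c * d) a.
Proof. by rewrite -[a]nrepK -!npi_scale scalerA. Qed.
Lemma nscale1 : left_id 1 nscale.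
Proof. by move=> a; rewrite -[a]nrepK -npi_scale scale1r. Qed.
Lemma nscaleDr : right_distributive nscale +%R.
Proof.
move=> c a b; rewrite -[a]nrepK -[b]nrepK.
by rewrite -raddfD -!npi_scale -raddfD scalerDr.
Qed.
Lemma nscaleDl a : {morph nscale^~ a : c d / c + d}.
Proof.
by move=> c d; rewrite -[a]nrepK -!npi_scale -raddfD scalerDl.
Qed.
HB.instance Definition _ := GRing.Zmodule_isLmodule.Build F B
  nscaleA nscale1 nscaleDr nscaleDl.

Lemma nscaleAl c a b : nscale c (nmul a b) = nmul (nscale c a) b.
Proof.
by rewrite -[a]nrepK -[b]nrepK -!(npi_scale, npi_mul) scalerAl.
Qed.
HB.instance Definition _ := GRing.Lmodule_isLalgebra.Build F B nscaleAl.

Lemma nscaleAr c a b : nscale c (nmul a b) = nmul a (nscale c b).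
Proof.
by rewrite -[a]nrepK -[b]nrepK -!(npi_scale, npi_mul) scalerAr.
Qed.
HB.instance Definition _ := GRing.Lalgebra_isAlgebra.Build F B nscaleAr.

Lemma npi_is_monoid_morphism : monoid_morphism npi.
Proof. by split=> [|f g]; rewrite ?npi_mul. Qed.

HB.instance Definition _ :=
  GRing.isMonoidMorphism.Build T B npi npi_is_monoid_morphism.

Lemma npi_is_scalable : scalable npi.
Proof. by move=> c f; rewrite npi_scale. Qed.

HB.instance Definition _ :=
  GRing.isScalable.Build F T B *:%R npi npi_is_scalable.

Lemma npi_surj a : exists f, npi f = a.
Proof. by exists (nrep a); apply: nrepK. Qed.

Lemma npi_eq0 f : (npi f == 0) = (qsym p f == 0).
Proof. by rewrite -(raddf0 npi) npi_eq subr0. Qed.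

End NicholsAlgebra.

Section Words.
Variable n : nat.
Implicit Types (u v w : seq 'I_n).

(* Lexicographic order; a proper prefix of a word is smaller than the word. *)
Definition wlt u v : bool := ((u : seqlexi 'I_n) < (v : seqlexi 'I_n))%O.

(* A nonempty word smaller than all its proper rotations: u < w v whenever
   u = v w with v and w nonempty. *)
Definition lyndon u : bool :=
  (u != [::]) && [forall k : 'I_(size u), (0 < k)%N ==> wlt u (rot k u)].

(* The length of v in the Shirshov factorization u = v w of a Lyndon word with
   at least two letters: v and w are Lyndon and v is as short as possible. *)
Definition shirshov u : nat :=
  find (fun k => lyndon (take k u) && lyndon (drop k u)) (iota 0 (size u)).

Definition wdeg w : 'rV[int]_n := \sum_(i <- w) delta_mx 0 i.

Definition mu (alpha : 'rV[int]_n) : {set 'I_n} := [set i | alpha 0 i != 0].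

End Words.

Section NicholsLie.
Variables (F : fieldType) (n : nat) (p : 'I_n -> 'I_n -> F).
Local Notation B := (nichols p).
Implicit Types (alpha beta : 'rV[int]_n) (u v w : seq 'I_n) (x y : B).

Definition chi alpha beta : F :=
  \prod_(i < n) \prod_(j < n) p i j ^ (alpha 0 i * beta 0 j).

Definition nx (i : 'I_n) : B := npi p (tword [:: i]).

Definition homogeneous alpha x : Prop :=
  exists2 f : tens F n, npi p f = x & forall m, m \in msupp f -> wdeg m = alpha.

(* [x, y] for x of degree alpha and y of degree beta. *)
Definition nbracket alpha beta x y : B := y * x - chi beta alpha *: (x * y).

(* L(V): the smallest subspace of B(V) containing V and closed under the bracket
   of homogeneous elements. *)
Inductive nlie : B -> Prop :=
| nlie_gen i : nlie (nx i)
| nlie_zero : nlie 0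
| nlie_lin (c : F) x y : nlie x -> nlie y -> nlie (c *: x + y)
| nlie_bracket alpha beta x y :
    homogeneous alpha x -> homogeneous beta y -> nlie x -> nlie y ->
    nlie (nbracket alpha beta x y).

(* Fuel m >= size u suffices for the recursion. *)
Fixpoint superletter_rec (m : nat) u : B :=
  match m, u with
  | _, [:: i] => nx i
  | m'.+1, _ =>
      let v := take (shirshov u) u in
      let w := drop (shirshov u) u in
      nbracket (wdeg v) (wdeg w) (superletter_rec m' v) (superletter_rec m' w)
  | 0, _ => 0
  end.

Definition superletter u : B := superletter_rec (size u) u.

Definition hard u : Prop :=
  lyndon u /\
  ~ exists r : seq (F * seq (seq 'I_n)),
      (forall t, t \in r ->
         wdeg (flatten t.2) = wdeg u /\
         forall w, w \in t.2 -> lyndon w && wlt u w) /\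
      superletter u = \sum_(t <- r) t.1 *: \prod_(w <- t.2) superletter w.

(* k < h_u: the height h_u is the order of p_uu if p_uu <> 1 is a root of unity,
   and is infinite otherwise. *)
Definition below_height (k : nat) u : Prop :=
  forall h : nat, chi (wdeg u) (wdeg u) != 1 ->
    h.-primitive_root (chi (wdeg u) (wdeg u)) -> (k < h)%N.

(* Adjacency in the pure generalized Dynkin diagram. *)
Definition dynkin_edge (i j : 'I_n) : bool := (i != j) && (p i j * p j i != 1).

Definition dconnected (A : {set 'I_n}) : bool :=
  [forall i in A, p i i != 1] &&
  [forall i in A, forall j in A,
     connect (fun a b => [&& a \in A, b \in A & dynkin_edge a b]) i j].

End NicholsLie.

(* The family (b k), k ranging over the indices satisfying K, is a basis of the
   subspace L. *)
Definition is_basis (F : fieldType) (A : lmodType F) (I : eqType)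
    (K : I -> Prop) (b : I -> A) (L : A -> Prop) : Prop :=
  [/\ forall k, K k -> L (b k),
      forall (r : seq I) (c : I -> F), uniq r -> (forall k, k \in r -> K k) ->
        \sum_(k <- r) c k *: b k = 0 -> forall k, k \in r -> c k = 0
    & forall x, L x -> exists (r : seq I) (c : I -> F),
        (forall k, k \in r -> K k) /\ x = \sum_(k <- r) c k *: b k].

(* Main.v *)
(* The Nichols algebra carries two families of skew derivations that jointly
   detect zero in nonzero degrees.  They show that the hard super-letters give a
   PBW basis, in which the exponent of [u] is bounded by the least m such that
   [u]^m is a combination of larger monomials; comparing leading coefficients,
   this m is a zero of 1 + q + ... + q^(m-1) for q = p_uu.

   That m is exactly the order of q is where the finiteness of D enters.  Fix a
   vertex i.  The algebra is K (x) F[x_i], where K is generated by the iterated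
   skew commutators of x_i with the other x_j, and reflecting p at i gives a
   Nichols algebra whose K has the same dimension in reflected degrees.  So the
   reflected algebra has the reflected root multiset, and as the number of roots
   is finite, every root becomes simple after finitely many reflections; there
   its height is that of x_i, namely the order of p_ii.

   L(V) is the sum of the homogeneous components of nonzero connected degree.
   Elements whose supports are not linked q-commute, so their bracket vanishes.
   Conversely, modulo L(V) a connected prefix of a connected word can be moved to
   the end up to an explicit scalar; moving a linked pair x_i x_j at once or
   letter by letter gives scalars that differ by the factor p_ij p_ji <> 1, so
   words with linked neighbours lie in L(V), and the others are brought to this
   form by swapping commuting neighbours. *)

From HB Require Import structures.
From Stdlib Require Import Classical_Prop Classical_Pred_Type ClassicalEpsilon FunctionalExtensionality.
Require Import Defs.
From mathcomp Require Import all_boot all_order all_algebra.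
From mathcomp Require Import finmap ring zify.
From mathcomp.multinomials Require Import monalg.

Set Implicit Arguments.
Unset Strict Implicit.
Unset Printing Implicit Defensive.

Import Order.TTheory GRing.Theory Num.Theory.
Local Open Scope ring_scope.

(** * Degrees and skew derivations *)

(** Comparing leading coefficients yields only some zero of the q-integer of p_uu, a priori a proper
    multiple of the order. For a single letter the skew derivations decide which powers vanish, but
    for a longer word no such direct computation is at hand, so minimality has to be carried over
    from letters. Reflections do not respect super-letters; what is carried over is therefore purely
    numerical, a multiset of degrees and heights with the right Hilbert series. The factor belonging
    to x_i cancels from that series and leaves the series of K. K comes without a presentation, so
    the comparison of K with its reflected counterpart starts as a linear relation rather than a
    map. Skew derivations show that it is single-valued; being onto, it gives one inequality of
    dimensions, and the reflected relation gives the other. Characteristic zero enters where p_uu =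
    1: the q-integer of m is then m itself, hence nonzero, and the height is infinite. *)

Section Bicharacter.
Variables (F : fieldType) (n : nat) (p : 'I_n -> 'I_n -> F).
Implicit Types (a b c : 'rV[int]_n).

Definition ek (k : 'I_n) : 'rV[int]_n := delta_mx 0 k.

Definition tot a : int := \sum_i a 0 i.

Lemma totD a b : tot (a + b) = tot a + tot b.
Proof. by rewrite /tot -big_split; apply: eq_bigr => i _; rewrite mxE. Qed.

Lemma totN a : tot (- a) = - tot a.
Proof. by rewrite /tot -sumrN; apply: eq_bigr => i _; rewrite mxE. Qed.

Lemma totB a b : tot (a - b) = tot a - tot b.
Proof. by rewrite totD totN. Qed.

Lemma tot0 : tot 0 = 0.
Proof. by rewrite /tot big1 // => i _; rewrite mxE. Qed.

Lemma totMn a m : tot (a *+ m) = tot a *+ m.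
Proof. by elim: m => [|m IH]; rewrite ?tot0 // !mulrS totD IH. Qed.

Lemma tot_ek k : tot (ek k) = 1.
Proof.
rewrite /tot (bigD1 k) //= big1 => [|i ik]; first by rewrite mxE !eqxx addr0.
by rewrite mxE (negbTE ik) andbF.
Qed.

Lemma wdeg_nil : wdeg [::] = 0 :> 'rV[int]_n.
Proof. by rewrite /wdeg big_nil. Qed.

Lemma wdeg_cons i (w : seq 'I_n) : wdeg (i :: w) = ek i + wdeg w.
Proof. by rewrite /wdeg big_cons. Qed.

Lemma wdeg_cat (u v : seq 'I_n) : wdeg (u ++ v) = wdeg u + wdeg v.
Proof. by rewrite /wdeg big_cat. Qed.

Lemma wdeg1 (i : 'I_n) : wdeg [:: i] = ek i.
Proof. by rewrite wdeg_cons wdeg_nil addr0. Qed.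

Lemma tot_wdeg (w : seq 'I_n) : tot (wdeg w) = (size w)%:Z.
Proof.
elim: w => [|i w IH]; first by rewrite wdeg_nil tot0.
by rewrite wdeg_cons totD tot_ek IH /= intS.
Qed.

Lemma wdeg_entry (w : seq 'I_n) i : wdeg w 0 i = (count_mem i w)%:Z.
Proof.
elim: w => [|j w IH]; first by rewrite wdeg_nil mxE.
by rewrite wdeg_cons mxE IH /= mxE eqxx eq_sym PoszD; case: (j == i).
Qed.

Lemma wdeg_eq0 (w : seq 'I_n) : (wdeg w == 0) = (w == [::]).
Proof.
apply/eqP/eqP => [/(congr1 tot)|->]; last exact: wdeg_nil.
by rewrite tot_wdeg tot0; case: w.
Qed.

Lemma row_ek a : a = \sum_i ek i *~ a 0 i.
Proof.
apply/rowP => j; rewrite summxE (bigD1 j) //= big1 => [|i ij].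
  by rewrite addr0 -scaler_int !mxE !eqxx mulr1 intz.
by rewrite -scaler_int !mxE eq_sym (negbTE ij) andbF mulr0.
Qed.

Hypothesis hp : forall i j, p i j != 0.

Local Notation chi := (chi p).

Lemma chiDl a b c : chi (a + b) c = chi a c * chi b c.
Proof.
rewrite /chi -big_split; apply: eq_bigr => i _.
rewrite -big_split; apply: eq_bigr => j _ /=.
by rewrite mxE mulrDl expfzDr.
Qed.

Lemma chiDr a b c : chi a (b + c) = chi a b * chi a c.
Proof.
rewrite /chi -big_split; apply: eq_bigr => i _.
rewrite -big_split; apply: eq_bigr => j _ /=.
by rewrite mxE mulrDr expfzDr.
Qed.

Lemma chi0l a : chi 0 a = 1.
Proof. by rewrite /chi big1 // => i _; rewrite big1 // => j _; rewrite mxE mul0r. Qed.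

Lemma chi0r a : chi a 0 = 1.
Proof. by rewrite /chi big1 // => i _; rewrite big1 // => j _; rewrite mxE mulr0. Qed.

Lemma chi_neq0 a b : chi a b != 0.
Proof.
apply/prodf_neq0 => i _; apply/prodf_neq0 => j _.
exact: expfz_neq0.
Qed.

Lemma chiNl a b : chi (- a) b = (chi a b)^-1.
Proof. by apply: (mulfI (chi_neq0 a b)); rewrite -chiDl subrr chi0l divff ?chi_neq0. Qed.

Lemma chiNr a b : chi a (- b) = (chi a b)^-1.
Proof. by apply: (mulfI (chi_neq0 a b)); rewrite -chiDr subrr chi0r divff ?chi_neq0. Qed.

Lemma chiBl a b c : chi (a - b) c = chi a c / chi b c.
Proof. by rewrite chiDl chiNl. Qed.

Lemma chiMnl a b m : chi (a *+ m) b = chi a b ^+ m.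
Proof. by elim: m => [|m IH]; rewrite ?chi0l // mulrS chiDl IH exprS. Qed.

Lemma chiMnr a b m : chi a (b *+ m) = chi a b ^+ m.
Proof. by elim: m => [|m IH]; rewrite ?chi0r // mulrS chiDr IH exprS. Qed.

Lemma chi_ek i j : chi (ek i) (ek j) = p i j.
Proof.
rewrite /chi (bigD1 i) //= [X in _ * X]big1 => [|i' ii'].
  rewrite mulr1 (bigD1 j) //= big1 => [|j' jj'].
    by rewrite !mxE !eqxx /= expr1z; apply: mulr1.
  by rewrite !mxE (negbTE jj') !eqxx /= expr0z.
by rewrite big1 // => j' _; rewrite mxE (negbTE ii') andbF mul0r expr0z.
Qed.

Lemma chi_ek_wdeg k (w : seq 'I_n) : chi (ek k) (wdeg w) = \prod_(b <- w) p k b.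
Proof.
elim: w => [|i w IH]; first by rewrite wdeg_nil chi0r big_nil.
by rewrite wdeg_cons chiDr chi_ek IH big_cons.
Qed.

End Bicharacter.

Section TensorOperators.
Variables (F : fieldType) (n : nat) (p : 'I_n -> 'I_n -> F).
Local Notation T := (tens F n).
Implicit Types (f g : T) (k x y a b : 'I_n) (u v w : seq 'I_n).

Definition tproj_word (al : 'rV[int]_n) w : T := if wdeg w == al then tword w else 0.
Definition tproj al : T -> T := lin (tproj_word al).
HB.instance Definition _ al :=
  GRing.isLinear.Build F T T *:%R (tproj al) (lin_linear (tproj_word al)).

Definition first_word k w : T :=
  if w is a :: w' then (a == k)%:R *: tword w' else 0.
Definition last_word k w : T :=
  if w is a :: w' then (last a w' == k)%:R *: tword (belast a w') else 0.
Definition tfirst k : T -> T := lin (first_word k).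
Definition tlast k : T -> T := lin (last_word k).
HB.instance Definition _ k :=
  GRing.isLinear.Build F T T *:%R (tfirst k) (lin_linear (first_word k)).
HB.instance Definition _ k :=
  GRing.isLinear.Build F T T *:%R (tlast k) (lin_linear (last_word k)).

(** Each occurrence of [k] is braided to the front and removed, at the cost [p a k] for every letter
    [a] that it crosses; [tdR_word] moves it to the end instead, at the cost [p k b]. *)
Fixpoint tdL_word k w : T :=
  if w is a :: w' then
    (a == k)%:R *: tword w' + p a k *: (tword [:: a] * tdL_word k w')
  else 0.
Fixpoint tdR_word k w : T :=
  if w is a :: w' then
    tword [:: a] * tdR_word k w' + ((a == k)%:R * \prod_(b <- w') p k b) *: tword w'
  else 0.
Definition tdL k : T -> T := lin (tdL_word k).
Definition tdR k : T -> T := lin (tdR_word k).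
HB.instance Definition _ k :=
  GRing.isLinear.Build F T T *:%R (tdL k) (lin_linear (tdL_word k)).
HB.instance Definition _ k :=
  GRing.isLinear.Build F T T *:%R (tdR k) (lin_linear (tdR_word k)).

Lemma tproj_tword al w : tproj al (tword w) = if wdeg w == al then tword w else 0.
Proof. by rewrite /tproj lin_tword. Qed.

Lemma tcoef_tproj al f (m : {fmonom 'I_n}) :
  (tproj al f)@_m = if wdeg m == al then f@_m else 0.
Proof.
elim/tens_ind: f => [|c u v IHu IHv|w].
- by rewrite linear0 !tcoef0 if_same.
- by rewrite linearP /= !tcoefD !tcoefZ IHu IHv; case: ifP => // _; rewrite mulr0 addr0.
rewrite tproj_tword !tcoef_word; case: (eqVneq w (m : seq _)) => [->|wm].
  by case: ifP => _; rewrite ?tcoef0 // tcoef_word eqxx.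
by case: ifP => _; rewrite ?tcoef0 ?tcoef_word ?(negbTE wm) if_same.
Qed.

Lemma tprojM_tword al a f :
  tproj al (tword [:: a] * f) = tword [:: a] * tproj (al - ek a) f.
Proof.
elim/tens_ind: f => [|c u v IHu IHv|w].
- by rewrite mulr0 !linear0 mulr0.
- by rewrite mulrDr -scalerAr !linearP /= IHu IHv mulrDr -scalerAr.
rewrite twordM !tproj_tword /= wdeg_cons addrC -subr_eq opprK.
by rewrite -[X in X == al]addrC addrC eq_sym -subr_eq eq_sym; case: ifP => _; rewrite ?mulr0 // twordM.
Qed.

Lemma tproj_ins al x f : tproj al (lin (ins p x) f) = lin (ins p x) (tproj (al - ek x) f).
Proof.
have key w : tproj al (ins p x w) = if wdeg w == al - ek x then ins p x w else 0.
  elim: w al => [|y w IH] al /=.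
    by rewrite tproj_tword wdeg_cons wdeg_nil addr0 eq_sym -[RHS]if_neg [0 == _]eq_sym subr_eq0 if_neg eq_sym.
  rewrite linearD linearZ /= tproj_tword tprojM_tword IH.
  rewrite !wdeg_cons.
  have -> : (ek x + (ek y + wdeg w) == al) = (ek y + wdeg w == al - ek x).
    by rewrite [RHS]eq_sym subr_eq eq_sym addrC.
  have -> : (wdeg w == al - ek y - ek x) = (ek y + wdeg w == al - ek x).
    by apply/eqP/eqP => [->|h]; [rewrite [LHS]addrC addrAC subrK | rewrite addrAC -h addrC addKr].
  by case: ifP => _ //; rewrite mulr0 scaler0 addr0.
elim/tens_ind: f => [|c u v IHu IHv|w].
- by rewrite !linear0.
- by rewrite !linearP /= IHu IHv.
by rewrite lin_tword key tproj_tword; case: ifP; rewrite ?lin_tword ?linear0.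
Qed.

Lemma tproj_qsym al f : tproj al (qsym p f) = qsym p (tproj al f).
Proof.
elim/tens_ind: f al => [|c u v IHu IHv|w] al.
- by rewrite !linear0.
- by rewrite !linearP /= IHu IHv.
elim: w al => [|a w IH] al.
  rewrite tproj_tword wdeg_nil {1}/qsym lin_tword /= -tword1 tproj_tword wdeg_nil.
  by case: ifP; rewrite ?linear0 // /qsym lin_tword /= tword1.
have -> : tword (a :: w) = tword [:: a] * tword w :> T by rewrite twordM.
by rewrite qsym_cons tproj_ins IH tprojM_tword qsym_cons.
Qed.

Lemma tfirstM k a f : tfirst k (tword [:: a] * f) = (a == k)%:R *: f.
Proof.
elim/tens_ind: f => [|c u v IHu IHv|w].
- by rewrite mulr0 linear0 scaler0.
- by rewrite mulrDr -scalerAr !linearP /= IHu IHv.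
by rewrite twordM /tfirst lin_tword.
Qed.

Lemma tlastM k a f : tlast k (f * tword [:: a]) = (a == k)%:R *: f.
Proof.
elim/tens_ind: f => [|c u v IHu IHv|w].
- by rewrite mul0r linear0 scaler0.
- by rewrite mulrDl -scalerAl !linearP /= IHu IHv.
rewrite twordM /tlast lin_tword cats1; case: w => [|b w] //=.
by rewrite last_rcons belast_rcons.
Qed.

Lemma tfirst_ins k x f : tfirst k (lin (ins p x) f) =
  (x == k)%:R *: f + p x k *: lin (ins p x) (tfirst k f).
Proof.
elim/tens_ind: f => [|c u v IHu IHv|w].
- by rewrite !(linear0, scaler0, addr0).
- by rewrite !linearP /= IHu IHv scalerDr addrACA.
rewrite lin_tword; case: w => [|y w] /=.
  by rewrite -[tword [:: x]]mulr1 tfirstM /tfirst -tword1 lin_tword /= linear0 scaler0 addr0.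
rewrite linearD linearZ /= tfirstM.
have -> : tword [:: x, y & w] = tword [:: x] * tword (y :: w) :> T by rewrite twordM.
have -> : tfirst k (tword (y :: w)) = (y == k)%:R *: tword w :> T by rewrite /tfirst lin_tword.
rewrite tfirstM [lin (ins p x) _]linearZ /= lin_tword; congr (_ + _); rewrite !scalerA.
by case: eqP => [->|]; rewrite ?mulr0 ?scale0r.
Qed.

Lemma tdL_cons k a f : tdL k (tword [:: a] * f) = (a == k)%:R *: f + p a k *: (tword [:: a] * tdL k f).
Proof.
elim/tens_ind: f => [|c u v IHu IHv|w].
- by rewrite mulr0 !(linear0, mulr0, scaler0, addr0).
- rewrite mulrDr -scalerAr !linearP /= IHu IHv mulrDr -scalerAr !scalerDr.
  by rewrite [p _ _ *: (c *: _)]scalerA [p _ _ * c]mulrC -scalerA addrACA.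
by rewrite twordM /tdL !lin_tword.
Qed.

(** Since symmetrization turns the derivation into deletion of the first letter, the derivation
    preserves [ker qsym] and descends to B(V). There it detects zero, because a tensor without
    constant term is determined by its deletions. *)
Lemma qsym_tdL k f : qsym p (tdL k f) = tfirst k (qsym p f).
Proof.
elim/tens_ind: f => [|c u v IHu IHv|w].
- by rewrite !linear0.
- by rewrite !linearP /= IHu IHv.
elim: w => [|a w IH].
  rewrite {1}/tdL lin_tword linear0 /qsym lin_tword /= -tword1.
  by rewrite /tfirst lin_tword.
have -> : tword (a :: w) = tword [:: a] * tword w :> T by rewrite twordM.
by rewrite tdL_cons linearD !linearZ /= !qsym_cons IH tfirst_ins.
Qed.

(** [rins] recurses at the front of the word, while deletion of the last letter needs a recursion at
    the end. *)
Lemma rins_rcons y w a : rins p y (rcons w a) =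
  p a y *: (rins p y w * tword [:: a]) + tword (rcons (rcons w a) y) :> T.
Proof.
elim: w => [|b w IH] /=.
  by rewrite twordM big_cons big_nil mulr1 addrC twordM.
rewrite IH mulrDr -scalerAr mulrDl -[in RHS]mulrA scalerDr -!addrA twordM; congr (_ + _).
rewrite addrC; congr (_ + _); rewrite -scalerAl twordM scalerA /= cats1; congr (_ *: _).
by rewrite !big_cons -cats1 big_cat big_seq1 /=; ring.
Qed.

Lemma tlast_rins k y f : tlast k (lin (rins p y) f) =
  (y == k)%:R *: f + p k y *: lin (rins p y) (tlast k f).
Proof.
elim/tens_ind: f => [|c u v IHu IHv|w].
- by rewrite !(linear0, scaler0, addr0).
- by rewrite !linearP /= IHu IHv scalerDr addrACA.
rewrite lin_tword; case/lastP: w => [|w a] /=.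
  by rewrite -[tword [:: y]]mul1r tlastM /tlast -tword1 lin_tword /= linear0 scaler0 addr0.
rewrite rins_rcons linearD linearZ /= tlastM.
have E b w' : tword (rcons w' b) = tword w' * tword [:: b] :> T by rewrite twordM cats1.
rewrite [tword (rcons (rcons _ _) _)]E tlastM [tword (rcons w a)]E tlastM [lin (rins p y) (_ *: _)]linearZ /= lin_tword.
rewrite addrC; congr (_ + _); rewrite !scalerA.
by case: eqP => [->|]; rewrite ?mulr0 ?scale0r.
Qed.

Lemma tdR_word_rcons k w a : tdR_word k (rcons w a) =
  (a == k)%:R *: tword w + p k a *: (tdR_word k w * tword [:: a]).
Proof.
elim: w => [|b w IH] /=.
  by rewrite mulr0 add0r big_nil mulr1 mul0r scaler0 addr0.
rewrite IH mulrDr -!scalerAr twordM mulrDl scalerDr -!addrA mulrA; congr (_ + (_ + _)).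
by rewrite -scalerAl twordM scalerA cats1 -cats1 big_cat big_seq1 /=; congr (_ *: _); ring.
Qed.

Lemma tdR_rcons k a f : tdR k (f * tword [:: a]) = (a == k)%:R *: f + p k a *: (tdR k f * tword [:: a]).
Proof.
elim/tens_ind: f => [|c u v IHu IHv|w].
- by rewrite mul0r !(linear0, mul0r, scaler0, addr0).
- rewrite mulrDl -scalerAl !linearP /= IHu IHv mulrDl -scalerAl !scalerDr.
  by rewrite [p _ _ *: (c *: _)]scalerA [p _ _ * c]mulrC -scalerA addrACA.
by rewrite twordM /tdR !lin_tword cats1 tdR_word_rcons.
Qed.

Lemma qsym_tdR k f : qsym p (tdR k f) = tlast k (qsym p f).
Proof.
elim/tens_ind: f => [|c u v IHu IHv|w].
- by rewrite !linear0.
- by rewrite !linearP /= IHu IHv.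
elim/last_ind: w => [|w a IH].
  rewrite {1}/tdR lin_tword linear0 /qsym lin_tword /= -tword1.
  by rewrite /tlast lin_tword.
have -> : tword (rcons w a) = tword w * tword [:: a] :> T by rewrite twordM cats1.
by rewrite tdR_rcons linearD !linearZ /= !qsym_rcons IH tlast_rins.
Qed.

(** Here [h k] deletes the letter [k] at one end and [m k] puts it back, so that a nonempty word is
    recovered from its deletions. Both ends are instances. *)
Lemma tproj_eq_sum (h : 'I_n -> T -> T) (m : 'I_n -> T -> T) al f :
  (forall k, linear (h k)) -> (forall k, linear (m k)) ->
  (forall w, w != [::] -> tword w = \sum_k m k (h k (tword w))) ->
  al != 0 -> (forall k, h k (tproj al f) = 0) -> tproj al f = 0.
Proof.
move=> lh lm hw al0 h0.
have lin0 (g : T -> T) : linear g -> g 0 = 0.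
  by move=> hh; have := hh (-1) 0 0; rewrite scaleN1r oppr0 addr0 scaleN1r addNr.
have : tproj al f = \sum_k m k (h k (tproj al f)).
  elim/tens_ind: f {h0} => [|c u v IHu IHv|w].
  - by rewrite linear0 big1 // => k _; rewrite !lin0.
  - rewrite linearP /= {1}IHu {1}IHv scaler_sumr -big_split; apply: eq_bigr => k _.
    by rewrite lh lm.
  rewrite tproj_tword; case: ifP => [/eqP wa|_].
    by apply: hw; rewrite -wdeg_eq0 wa.
  by rewrite big1 // => k _; rewrite !lin0.
by move=> ->; rewrite big1 // => k _; rewrite h0 lin0.
Qed.

Lemma tfirst_eq0 al f : al != 0 -> (forall k, tfirst k (tproj al f) = 0) -> tproj al f = 0.
Proof.
apply: (@tproj_eq_sum tfirst (fun k g => tword [:: k] * g)) => [k|k c u v|w w0].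
- exact: linearP.
- by rewrite mulrDr scalerAr.
case: w w0 => // a w _; rewrite (bigD1 a) //= big1 => [|k ka].
  by rewrite /tfirst lin_tword /= eqxx scale1r twordM addr0.
by rewrite /tfirst lin_tword /= eq_sym (negbTE ka) scale0r mulr0.
Qed.

Lemma tlast_eq0 al f : al != 0 -> (forall k, tlast k (tproj al f) = 0) -> tproj al f = 0.
Proof.
apply: (@tproj_eq_sum tlast (fun k g => g * tword [:: k])) => [k|k c u v|w w0].
- exact: linearP.
- by rewrite mulrDl scalerAl.
case/lastP: w w0 => // w a _.
have -> : tword (rcons w a) = tword w * tword [:: a] :> T by rewrite twordM cats1.
rewrite (bigD1 a) //= big1 => [|k ka].
  by rewrite tlastM eqxx scale1r addr0.
by rewrite tlastM eq_sym (negbTE ka) scale0r mul0r.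
Qed.

End TensorOperators.

Section NicholsOperators.
Variables (F : fieldType) (n : nat) (p : 'I_n -> 'I_n -> F).
Local Notation T := (tens F n).
Local Notation B := (nichols p).
Local Notation npi := (npi p).
Local Notation chi := (chi p).
Implicit Types (f g : T) (x y z : B) (k : 'I_n) (w : seq 'I_n) (a b : 'rV[int]_n).

Definition hproj a x : B := npi (tproj a (nrep x)).
Definition dL k x : B := npi (tdL p k (nrep x)).
Definition dR k x : B := npi (tdR p k (nrep x)).

(** The operators on B(V) are computed on a chosen representative; stability of [ker qsym] makes the
    choice irrelevant. *)
Lemma npi_lift (l : {linear T -> T}) f :
  (forall g, qsym p g = 0 -> qsym p (l g) = 0) -> npi (l (nrep (npi f))) = npi (l f).
Proof.
move=> hl; apply/eqP; rewrite npi_eq -linearB qkerE; apply/eqP/hl.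
by apply/eqP; rewrite -qkerE npi_rep.
Qed.

Lemma hproj_npi a f : hproj a (npi f) = npi (tproj a f).
Proof. by apply: npi_lift => g qg; rewrite -tproj_qsym qg linear0. Qed.

Lemma dL_npi k f : dL k (npi f) = npi (tdL p k f).
Proof. by apply: npi_lift => g qg; rewrite qsym_tdL qg linear0. Qed.

Lemma dR_npi k f : dR k (npi f) = npi (tdR p k f).
Proof. by apply: npi_lift => g qg; rewrite qsym_tdR qg linear0. Qed.

Lemma hproj_linear a : linear (hproj a).
Proof.
move=> c x y; rewrite -(nrepK x) -(nrepK y) -[c *: _ + _]linearP !hproj_npi.
by rewrite [X in npi X]linearP linearP.
Qed.
Lemma dL_linear k : linear (dL k).
Proof.
move=> c x y; rewrite -(nrepK x) -(nrepK y) -[c *: _ + _]linearP !dL_npi.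
by rewrite [X in npi X]linearP linearP.
Qed.
Lemma dR_linear k : linear (dR k).
Proof.
move=> c x y; rewrite -(nrepK x) -(nrepK y) -[c *: _ + _]linearP !dR_npi.
by rewrite [X in npi X]linearP linearP.
Qed.
HB.instance Definition _ a := GRing.isLinear.Build F B B *:%R (hproj a) (hproj_linear a).
HB.instance Definition _ k := GRing.isLinear.Build F B B *:%R (dL k) (dL_linear k).
HB.instance Definition _ k := GRing.isLinear.Build F B B *:%R (dR k) (dR_linear k).

Definition nw w : B := npi (tword w).

Lemma nw_nil : nw [::] = 1.
Proof. by rewrite /nw tword1. Qed.

Lemma nw_cat w w' : nw (w ++ w') = nw w * nw w'.
Proof. by rewrite /nw -twordM rmorphM. Qed.

Lemma nw_cons k w : nw (k :: w) = nx p k * nw w.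
Proof. by rewrite -cat1s nw_cat. Qed.

Lemma nich_ind (P : B -> Prop) : P 0 -> (forall c x y, P x -> P y -> P (c *: x + y)) ->
  (forall w, P (nw w)) -> forall x, P x.
Proof.
move=> P0 Pl Pw x; rewrite -(nrepK x); elim/tens_ind: (nrep x) => [|c u v|w] //.
- by rewrite linear0.
- by rewrite linearP; apply: Pl.
exact: Pw.
Qed.

Lemma hproj_nw a w : hproj a (nw w) = if wdeg w == a then nw w else 0.
Proof. by rewrite hproj_npi tproj_tword; case: ifP => // _; rewrite linear0. Qed.

Lemma homogP a x : homogeneous a x <-> hproj a x = x.
Proof.
split=> [[f <- fa]|<-].
  rewrite hproj_npi; congr (npi _); rewrite [RHS]tensE {1}[f]tensE linear_sum.
  rewrite !big_seq; apply: eq_bigr => m mf.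
  by rewrite linearZ /= tproj_tword fa ?eqxx.
exists (tproj a (nrep x)) => // m; rewrite -mcoeff_neq0 => m0; apply/eqP.
by move: m0; rewrite tcoef_tproj; case: ifP => //; rewrite eqxx.
Qed.

Lemma hprojK a b x : hproj a (hproj b x) = if a == b then hproj b x else 0.
Proof.
elim/nich_ind: x => [|c u v IHu IHv|w].
- by rewrite !linear0 if_same.
- by rewrite !linearP /= IHu IHv; case: ifP => // _; rewrite scaler0 addr0.
rewrite [hproj b (nw w)]hproj_nw; case: ifP => [/eqP <-|_].
  by rewrite hproj_nw eq_sym.
by rewrite linear0 if_same.
Qed.

Lemma homog_hproj a x : homogeneous a (hproj a x).
Proof. by apply/homogP; rewrite hprojK eqxx. Qed.

Lemma homog_ind a (P : B -> Prop) : P 0 -> (forall c x y, P x -> P y -> P (c *: x + y)) ->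
  (forall w, wdeg w = a -> P (nw w)) -> forall x, homogeneous a x -> P x.
Proof.
move=> P0 Pl Pw x /homogP <-; elim/nich_ind: x => [|c u v IHu IHv|w].
- by rewrite linear0.
- by rewrite linearP; apply: Pl.
by rewrite hproj_nw; case: ifP => // /eqP; apply: Pw.
Qed.

Lemma homog_nw w : homogeneous (wdeg w) (nw w).
Proof. by apply/homogP; rewrite hproj_nw eqxx. Qed.

Lemma homog0 a : homogeneous a (0 : B).
Proof. by apply/homogP; rewrite linear0. Qed.

Lemma homog_lin a c x y : homogeneous a x -> homogeneous a y -> homogeneous a (c *: x + y).
Proof. by move=> /homogP hx /homogP hy; apply/homogP; rewrite linearP /= hx hy. Qed.

Lemma homogD a x y : homogeneous a x -> homogeneous a y -> homogeneous a (x + y).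
Proof. by move=> hx hy; rewrite -[x]scale1r; apply: homog_lin. Qed.

Lemma homogZ a c x : homogeneous a x -> homogeneous a (c *: x).
Proof. by move=> hx; rewrite -[_ *: _]addr0; apply: homog_lin => //; apply: homog0. Qed.

Lemma homogB a x y : homogeneous a x -> homogeneous a y -> homogeneous a (x - y).
Proof. by move=> hx hy; apply: homogD => //; rewrite -scaleN1r; apply: homogZ. Qed.

Lemma homog1 : homogeneous 0 (1 : B).
Proof. by rewrite -nw_nil -wdeg_nil; apply: homog_nw. Qed.

Lemma homog_nx k : homogeneous (ek k) (nx p k).
Proof. by rewrite -wdeg1; apply: homog_nw. Qed.

Lemma homogM a b x y : homogeneous a x -> homogeneous b y -> homogeneous (a + b) (x * y).
Proof.
move=> hx hy; elim/homog_ind: x / hx => [|c u v hu hv|w <-].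
- by rewrite mul0r; apply: homog0.
- by rewrite mulrDl -scalerAl; apply: homog_lin.
elim/homog_ind: y / hy => [|c u v hu hv|v <-].
- by rewrite mulr0; apply: homog0.
- by rewrite mulrDr -scalerAr; apply: homog_lin.
by rewrite -nw_cat -wdeg_cat; apply: homog_nw.
Qed.

Lemma homogX a x m : homogeneous a x -> homogeneous (a *+ m) (x ^+ m).
Proof.
by move=> hx; elim: m => [|m IH]; [apply: homog1 | rewrite exprS mulrS; apply: homogM].
Qed.

Lemma homog_word a x : homogeneous a x -> x != 0 -> exists w, wdeg w = a.
Proof.
move=> ha; suff [->|//] : x = 0 \/ exists w, wdeg w = a by rewrite eqxx.
elim/homog_ind: x / ha => [|c u v [->|?] [->|?]|w wa]; try by right.
- by left.
- by left; rewrite scaler0 addr0.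
by right; exists w.
Qed.

Lemma homog_deg0 x : homogeneous 0 x -> exists c : F, x = c *: 1.
Proof.
move=> hx; elim/homog_ind: x / hx => [|c u v [d ->] [e ->]|w /eqP].
- by exists 0; rewrite scale0r.
- by exists (c * d + e); rewrite scalerDl scalerA.
by rewrite wdeg_eq0 => /eqP ->; exists 1; rewrite scale1r nw_nil.
Qed.

Lemma hdecomp x : exists2 s : seq 'rV[int]_n, uniq s & x = \sum_(a <- s) hproj a x.
Proof.
suff [s hs] : exists s : seq 'rV[int]_n, forall s', uniq s' -> {subset s <= s'} ->
    x = \sum_(a <- s') hproj a x.
  exists (undup s); first exact: undup_uniq.
  by apply: hs => [|a]; rewrite ?undup_uniq ?mem_undup.
elim/nich_ind: x => [|c u v [s1 h1] [s2 h2]|w].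
- by exists [::] => s' _ _; rewrite big1 // => a _; rewrite linear0.
- exists (s1 ++ s2) => s' us ss.
  have {}h1 : u = \sum_(a <- s') hproj a u.
    by apply: h1 => // a as1; rewrite ss // mem_cat as1.
  have {}h2 : v = \sum_(a <- s') hproj a v.
    by apply: h2 => // a as1; rewrite ss // mem_cat as1 orbT.
  rewrite {1}h1 {1}h2 scaler_sumr -big_split; apply: eq_bigr => a _.
  by rewrite linearP.
exists [:: wdeg w] => s' us ss; rewrite (bigD1_seq (wdeg w)) ?ss ?inE //=.
rewrite hproj_nw eqxx big1 ?addr0 // => a aw.
by rewrite hproj_nw eq_sym (negbTE aw).
Qed.

Lemma dL1 k : dL k 1 = 0.
Proof. by rewrite -nw_nil dL_npi /tdL lin_tword linear0. Qed.

Lemma dR1 k : dR k 1 = 0.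
Proof. by rewrite -nw_nil dR_npi /tdR lin_tword linear0. Qed.

Lemma dL_nx k j : dL k (nx p j) = (j == k)%:R.
Proof.
rewrite dL_npi /tdL lin_tword /= mulr0 scaler0 addr0 tword1 linearZ /= rmorph1.
by case: eqP => _; rewrite ?scale1r ?scale0r.
Qed.

Lemma dR_nx k j : dR k (nx p j) = (j == k)%:R.
Proof.
rewrite dR_npi /tdR lin_tword /= mulr0 big_nil mulr1 add0r tword1 linearZ /= rmorph1.
by case: eqP => _; rewrite ?scale1r ?scale0r.
Qed.

Hypothesis hp : forall i j, p i j != 0.

Lemma dL_nxM k j y : dL k (nx p j * y) = (j == k)%:R *: y + p j k *: (nx p j * dL k y).
Proof.
elim/nich_ind: y => [|c u v IHu IHv|w].
- by rewrite mulr0 !(linear0, mulr0, scaler0, addr0).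
- rewrite mulrDr -scalerAr !linearP /= IHu IHv mulrDr -scalerAr !scalerDr.
  by rewrite [p _ _ *: (c *: _)]scalerA [p _ _ * c]mulrC -scalerA addrACA.
rewrite -nw_cons !dL_npi /tdL !lin_tword /= linearD !linearZ /=.
by rewrite rmorphM.
Qed.

Lemma dLM k a x y : homogeneous a x ->
  dL k (x * y) = dL k x * y + chi a (ek k) *: (x * dL k y).
Proof.
move=> hx; elim/homog_ind: x / hx => [|c u v hu hv|w <-].
- by rewrite !(mul0r, linear0, scaler0, addr0).
- rewrite mulrDl -scalerAl !linearP /= hu hv !mulrDl -!scalerAl !scalerDr !addrA.
  rewrite !scalerA [c * _]mulrC; congr (_ + _).
  by rewrite -!addrA; congr (_ + _); rewrite addrC.
elim: w => [|j w IH].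
  by rewrite nw_nil wdeg_nil chi0l !mul1r dL1 mul0r add0r scale1r.
rewrite nw_cons wdeg_cons chiDl // chi_ek // -mulrA !dL_nxM IH.
rewrite mulrDl -!scalerAl mulrDr scalerDr -!scalerAr !scalerA !addrA.
by rewrite !mulrA.
Qed.

Lemma dRM k b x y : homogeneous b y ->
  dR k (x * y) = x * dR k y + chi (ek k) b *: (dR k x * y).
Proof.
move=> hy; elim/homog_ind: y / hy => [|c u v hu hv|v <-].
- by rewrite !(mulr0, linear0, scaler0, addr0).
- rewrite mulrDr -scalerAr !linearP /= hu hv !mulrDr -!scalerAr !scalerDr !scalerA.
  by rewrite [c * _]mulrC addrACA.
elim/nich_ind: x => [|c u w hu hv|w].
- by rewrite !(mul0r, linear0, scaler0, addr0).
- rewrite mulrDl -scalerAl !linearP /= hu hv !mulrDl -!scalerAl !scalerDr !scalerA.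
  by rewrite [c * _]mulrC addrACA.
rewrite -nw_cat chi_ek_wdeg // !dR_npi /tdR !lin_tword -!rmorphM -!linearZ -linearD /=.
congr (npi _); elim: w => [|j w IH] /=.
  by rewrite tword1 mul1r mul0r scaler0 addr0.
rewrite IH mulrDr -!scalerAr mulrDl scalerDr mulrA twordM -!addrA mulrA; congr (_ + (_ + _)).
rewrite -scalerAl twordM scalerA big_cat /=; congr (_ *: _); ring.
Qed.

Lemma dR_homog k a x : homogeneous a x -> homogeneous (a - ek k) (dR k x).
Proof.
move=> hx; elim/homog_ind: x / hx => [|c u v hu hv|w <-].
- by rewrite linear0; apply: homog0.
- by rewrite linearP; apply: homog_lin.
elim: w => [|j w IH].
  by rewrite nw_nil dR1; apply: homog0.
rewrite nw_cons (dRM _ _ (homog_nw w)) dR_nx wdeg_cons; apply: homogD.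
  by rewrite -addrA; apply: homogM => //; apply: homog_nx.
apply: homogZ; case: eqP => [->|_]; last by rewrite mul0r; apply: homog0.
by rewrite mul1r addrC addKr; apply: homog_nw.
Qed.

Lemma dR_eq0 a x : homogeneous a x -> a != 0 -> (forall k, dR k x = 0) -> x = 0.
Proof.
move=> /homogP hx a0 h; rewrite -hx /hproj; apply/eqP; rewrite npi_eq0 -tproj_qsym; apply/eqP.
apply: tlast_eq0 => // k; rewrite tproj_qsym -qsym_tdR; apply/eqP; rewrite -npi_eq0.
by rewrite -dR_npi -/(hproj a x) hx h.
Qed.

Lemma dL_eq0 a x : homogeneous a x -> a != 0 -> (forall k, dL k x = 0) -> x = 0.
Proof.
move=> /homogP hx a0 h; rewrite -hx /hproj; apply/eqP; rewrite npi_eq0 -tproj_qsym; apply/eqP.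
apply: tfirst_eq0 => // k; rewrite tproj_qsym -qsym_tdL; apply/eqP; rewrite -npi_eq0.
by rewrite -dL_npi -/(hproj a x) hx h.
Qed.

End NicholsOperators.

(** * Lyndon words *)

Section Lyndon.
Variable n : nat.
Implicit Types (u v w s t : seq 'I_n).

Lemma wlt_nil v : wlt [::] v = (v != [::]).
Proof. by case: v. Qed.

Lemma wlt_s0 u : wlt u [::] = false.
Proof. by rewrite /wlt Order.SeqLexiOrder.Exports.ltxis0. Qed.

Lemma wlt_cons (x y : 'I_n) u v : wlt (x :: u) (y :: v) = (x < y)%N || (x == y) && wlt u v.
Proof.
rewrite /wlt Order.SeqLexiOrder.Exports.ltxi_cons !leEord -(inj_eq val_inj) /=.
by case: ltngtP.
Qed.

Lemma wltnn u : wlt u u = false. Proof. exact: ltxx. Qed.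

Lemma wlt_trans : transitive (@wlt n).
Proof. by move=> v u w; apply: lt_trans. Qed.

Lemma wltNge u v : ~~ wlt u v = (u == v) || wlt v u.
Proof. by rewrite /wlt -leNgt le_eqVlt eq_sym. Qed.

Lemma wlt_asym u v : wlt u v -> wlt v u = false.
Proof. by move=> uv; apply/negbTE; rewrite wltNge uv orbT. Qed.

Lemma wle_lt_trans u v w : ~~ wlt v u -> wlt v w -> wlt u w.
Proof. by rewrite wltNge => /orP[/eqP ->|] //; apply: wlt_trans. Qed.

Lemma wlt_le_trans u v w : wlt u v -> ~~ wlt w v -> wlt u w.
Proof. by move=> uv; rewrite wltNge => /orP[/eqP ->|] //; apply: wlt_trans. Qed.

Lemma wle_trans u v w : ~~ wlt v u -> ~~ wlt w v -> ~~ wlt w u.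
Proof. by move=> h1 h2; apply/negP => h; rewrite (wlt_le_trans h h1) in h2. Qed.

Lemma wlt_cat2l s u v : wlt (s ++ u) (s ++ v) = wlt u v.
Proof. by elim: s => //= x s IH; rewrite wlt_cons IH ltnn eqxx. Qed.

Lemma wlt_cat u v : v != [::] -> wlt u (u ++ v).
Proof. by rewrite -{1}[u]cats0 wlt_cat2l wlt_nil. Qed.

(** The comparison that is decided at a differing letter, with neither word a prefix of the other.
    Unlike [wlt] it survives appending arbitrary words on both sides. *)
Fixpoint slt u v : bool :=
  match u, v with
  | x :: u', y :: v' => (x < y)%N || (x == y) && slt u' v'
  | _, _ => false
  end.

Lemma slt_wlt u v : slt u v -> forall s t, wlt (u ++ s) (v ++ t).
Proof.
elim: u v => [|x u IH] [|y v] //= /orP[xy|/andP[xy uv]] s t; rewrite wlt_cons ?xy //.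
by rewrite IH ?orbT.
Qed.

Lemma wltE u v : wlt u v -> slt u v \/ exists2 r, r != [::] & v = u ++ r.
Proof.
elim: u v => [|x u IH] [|y v] //=; rewrite ?wlt_s0 // ?wlt_nil.
- by move=> _; right; exists (y :: v).
rewrite wlt_cons => /orP[->|/andP[/eqP -> /IH[->|[r r0 ->]]]]; first by left.
- by left; rewrite eqxx orbT.
by right; exists r.
Qed.

Lemma wlt_slt u v : (size v <= size u)%N -> wlt u v -> slt u v.
Proof.
move=> sz /wltE[//|[r r0 vE]]; move: sz; rewrite vE size_cat.
by case: r r0 {vE} => //= a r _; rewrite -{2}[size u]addn0 leq_add2l.
Qed.

(** From rotations to suffixes, the delicate case is a suffix t that is also a prefix, u = s t = t
    r. Then u < t s gives r < s, hence r t < s t = u, against u < r t. *)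
Lemma lyndonP u : reflect (u != [::] /\
    forall s t, u = s ++ t -> s != [::] -> t != [::] -> wlt u t) (lyndon u).
Proof.
apply: (iffP andP) => -[u0 h]; split=> //.
  have {}h k : (0 < k < size u)%N -> wlt u (rot k u).
    by case/andP=> k0 ku; move/forallP/(_ (Ordinal ku))/implyP: h; apply.
  move=> s t uE s0 t0.
  have sz w : w != [::] -> (0 < size w)%N by case: w.
  have szu : size u = (size s + size t)%N by rewrite uE size_cat.
  have := h (size s); rewrite {3}uE rot_size_cat szu sz // -{1}[size s]addn0 ltn_add2l sz //.
  move=> /(_ isT) uts; case: (boolP (wlt u t)) => // ; rewrite wltNge.
  case/orP=> [/eqP utE|/wltE[]].
  - by move: szu; rewrite {1}utE -[LHS]add0n => /eqP; rewrite eqn_add2r eq_sym size_eq0 (negbTE s0).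
  - by move=> /slt_wlt/(_ s [::]); rewrite cats0 (wlt_asym uts).
  case=> r r0 urE; have szr : size r = size s.
    by move/eqP: szu; rewrite urE size_cat addnC eqn_add2r => /eqP.
  have := h (size t); rewrite {3}urE rot_size_cat szu sz // addnC -{1}[size t]addn0 ltn_add2l sz //.
  move=> /(_ isT) urt; move: uts; rewrite {1}urE wlt_cat2l => rs.
  have {}rs : slt r s by apply: wlt_slt => //; rewrite szr.
  by have := slt_wlt rs t t; rewrite -uE (wlt_asym urt).
apply/forallP => k; apply/implyP => k0.
have d0 : drop k u != [::] by rewrite -size_eq0 size_drop subn_eq0 -ltnNge.
have t0 : take k u != [::] by rewrite -size_eq0 size_take ltn_ord -lt0n.
have uE : u = take k u ++ drop k u by rewrite cat_take_drop.
rewrite /rot -[X in wlt X]cats0; apply: slt_wlt; apply: wlt_slt; last exact: h t0 d0.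
by rewrite size_drop leq_subr.
Qed.

Lemma lyndon_neq0 u : lyndon u -> u != [::].
Proof. by case/lyndonP. Qed.

Lemma lyndon_suffix s t : lyndon (s ++ t) -> s != [::] -> t != [::] -> wlt (s ++ t) t.
Proof. by case/lyndonP => _; apply. Qed.

Lemma lyndon_sslt s t : lyndon (s ++ t) -> s != [::] -> t != [::] -> slt (s ++ t) t.
Proof.
move=> h s0 t0; apply: wlt_slt; last exact: lyndon_suffix.
by rewrite size_cat leq_addl.
Qed.

Lemma lyndon1 (i : 'I_n) : lyndon [:: i].
Proof.
apply/lyndonP; split=> // s t E s0 t0; have := congr1 size E; rewrite size_cat /=.
by case: s t s0 t0 {E} => [|a s] [|b t] //= _ _; rewrite addnS.
Qed.

Lemma lyndon_cat_lt u v : lyndon v -> wlt u v -> u != [::] -> wlt (u ++ v) v.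
Proof.
move=> lv uv u0; case: (wltE uv) => [/slt_wlt/(_ v [::])|[r r0 vE]]; first by rewrite cats0.
by rewrite [X in wlt _ X]vE wlt_cat2l {1}vE; apply: lyndon_suffix => //; rewrite -vE.
Qed.

Lemma lyndon_cat u v : lyndon u -> lyndon v -> wlt u v -> lyndon (u ++ v).
Proof.
move=> lu lv uv; have uvv := lyndon_cat_lt lv uv (lyndon_neq0 lu).
apply/lyndonP; split; first by case: u lu {uv uvv}.
move=> s t E s0 t0.
case: (leqP (size u) (size s)) => us.
  have E' : v = drop (size u) s ++ t.
    have := congr1 (drop (size u)) E; rewrite drop_size_cat // drop_cat.
    case: ltnP us => // su us; have -> : size u = size s by apply/eqP; rewrite eqn_leq us su.
    by rewrite subnn drop0 drop_size.
  case: (eqVneq (drop (size u) s) [::]) => [s'0|s'0]; first by have <- : v = t by rewrite E' s'0.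
  by apply: wlt_trans uvv _; rewrite E'; apply: lyndon_suffix => //; rewrite -E'.
have uE : u = s ++ drop (size s) u.
  by rewrite -{1}(cat_take_drop (size s) u) -(takel_cat v (ltnW us)) E take_size_cat.
have tE : t = drop (size s) u ++ v.
  by move/eqP: E; rewrite {1}uE -catA eqseq_cat // eqxx /= => /eqP.
rewrite tE; apply: slt_wlt; rewrite {1}uE; apply: lyndon_sslt; rewrite -?uE //.
by rewrite -size_eq0 size_drop subn_eq0 -ltnNge.
Qed.

Lemma wlt_min (l : seq (seq 'I_n)) : l != [::] ->
  exists2 m, m \in l & forall x, x \in l -> ~~ wlt x m.
Proof.
elim: l => // a l IH _; case: (eqVneq l [::]) => [->|l0].
  by exists a; rewrite ?inE // => x; rewrite inE => /eqP ->; rewrite wltnn.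
have [m ml hm] := IH l0; case: (boolP (wlt a m)) => am.
  exists a; rewrite ?inE ?eqxx // => x; rewrite inE => /orP[/eqP ->|xl]; first by rewrite wltnn.
  by rewrite (wle_trans _ (hm x xl)) // (wlt_asym am).
by exists m; rewrite ?inE ?ml ?orbT // => x; rewrite inE => /orP[/eqP ->|/hm].
Qed.

(* The standard factorization splits off the least proper suffix. *)
Lemma shirshovP u : lyndon u -> (1 < size u)%N ->
  [/\ (0 < shirshov u < size u)%N, lyndon (take (shirshov u) u),
      lyndon (drop (shirshov u) u) &
      forall k, (0 < k < size u)%N -> ~~ wlt (drop k u) (drop (shirshov u) u)].
Proof.
move=> lu u1; set P := fun k => lyndon (take k u) && lyndon (drop k u).
have [|m] := @wlt_min [seq drop k u | k <- iota 1 (size u).-1].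
  by rewrite -size_eq0 size_map size_iota; case: (size u) u1 => [|[]].
case/mapP=> k1; rewrite mem_iota add1n prednK ?(ltnW u1) // => /andP[k10 k1u] -> min1.
have {}min1 k : (0 < k < size u)%N -> ~~ wlt (drop k u) (drop k1 u).
  move=> hk; apply: min1; apply/mapP; exists k => //.
  by rewrite mem_iota add1n prednK ?(ltnW u1).
have d0 k : (k < size u)%N -> drop k u != [::].
  by move=> ku; rewrite -size_eq0 size_drop subn_eq0 -ltnNge.
have t0 k : (0 < k)%N -> (k < size u)%N -> take k u != [::].
  by move=> k0 ku; rewrite -size_eq0 size_take ku -lt0n.
have lm : lyndon (drop k1 u).
  apply/lyndonP; split=> [|s t E s0 st0]; first exact: d0.
  have tE : t = drop (k1 + size s) u by rewrite addnC -drop_drop E drop_size_cat.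
  have := min1 (k1 + size s)%N; rewrite addn_gt0 k10 -tE.
  have -> : (k1 + size s < size u)%N.
    by rewrite ltnNge; apply: contra st0 => h; rewrite tE drop_oversize.
  move=> /(_ isT); rewrite wltNge => /orP[/eqP tk|//].
  move: (congr1 size E); rewrite -tk size_cat -[LHS]add0n => /eqP.
  by rewrite eqn_add2r eq_sym size_eq0 (negbTE s0).
have lv : lyndon (take k1 u).
  apply/lyndonP; split=> [|r s E r0 s0]; first exact: t0.
  have uE : u = (r ++ s) ++ drop k1 u by rewrite -E cat_take_drop.
  have us : wlt u (s ++ drop k1 u).
    rewrite {1}uE -catA; apply: lyndon_suffix; rewrite ?catA -?uE //.
    by case: (s) s0.
  case: (boolP (wlt _ _)) => //; rewrite wltNge => /orP[/eqP ts|].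
    move: (congr1 size E); rewrite ts size_cat -[LHS]add0n => /eqP.
    by rewrite eqn_add2r eq_sym size_eq0 (negbTE r0).
  case/wltE=> [/slt_wlt/(_ (drop k1 u) (drop k1 u))|[r' r'0 E']].
    by rewrite cat_take_drop (wlt_asym us).
  have uE' : u = s ++ (r' ++ drop k1 u) by rewrite catA -E' cat_take_drop.
  move: us; rewrite {1}uE' wlt_cat2l.
  have sz : (size s < size u)%N.
    by rewrite {1}uE' size_cat -{1}[size s]addn0 ltn_add2l size_cat addn_gt0 lt0n size_eq0 r'0.
  have := min1 (size s); rewrite {2}uE' drop_size_cat // sz lt0n size_eq0 s0.
  by move=> /(_ isT) /negbTE ->.
have hP : has P (iota 0 (size u)).
  by apply/hasP; exists k1; rewrite ?mem_iota //= /P lv lm.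
have Ps : P (shirshov u).
  have := nth_find 0 hP; rewrite nth_iota ?add0n //.
  by rewrite -[X in (_ < X)%N](size_iota 0) -has_find.
have sk : (shirshov u <= k1)%N.
  rewrite leqNgt; apply/negP => /(before_find 0); rewrite nth_iota // add0n.
  by rewrite lv lm.
have s0 : (0 < shirshov u)%N.
  by rewrite lt0n; apply: contraL Ps => /eqP ->; rewrite /P take0.
suff sE : shirshov u = k1 by rewrite sE k10 k1u.
(* A split before [k1] would leave a Lyndon word with [drop k1 u] as a proper suffix, hence smaller
   than it, against the minimality of [drop k1 u]. *)
apply/eqP; rewrite eqn_leq sk leqNgt; apply/negP => lt.
case/andP: Ps => _ ld.
have E : drop (shirshov u) u = take (k1 - shirshov u) (drop (shirshov u) u) ++ drop k1 u.
  by rewrite -{1}(cat_take_drop (k1 - shirshov u) (drop _ u)) drop_drop subnK.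
have su : (shirshov u < size u)%N by apply: leq_ltn_trans k1u.
have := min1 (shirshov u); rewrite s0 su => /(_ isT); rewrite E lyndon_suffix -?E ?d0 //.
rewrite -size_eq0 size_take size_drop -lt0n; case: ifP => _; first by rewrite subn_gt0.
by rewrite subn_gt0.
Qed.

(** The least proper suffix of v w is w: a suffix starting inside v begins with a suffix of v that
    is not below w, and the proper suffixes of w are above w. This is the criterion for a bracket of
    two super-letters to be a super-letter. *)
Lemma shirshov_cat v w : lyndon v -> lyndon w -> wlt v w ->
  ((1 < size v)%N -> ~~ wlt (drop (shirshov v) v) w) -> shirshov (v ++ w) = size v.
Proof.
move=> lv lw vw hv; have lvw := lyndon_cat lv lw vw.
have v0 : (0 < size v)%N by rewrite lt0n size_eq0 lyndon_neq0.
have w0 : (0 < size w)%N by rewrite lt0n size_eq0 lyndon_neq0.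
have [|/andP[k0 ku] _ _ kmin] := shirshovP lvw.
  by rewrite size_cat -addn1 leq_add.
set k := shirshov _ in k0 ku kmin *.
have := kmin (size v); rewrite v0 size_cat -{1}[size v]addn0 ltn_add2l w0 drop_size_cat //.
move=> /(_ isT); rewrite wltNge => /orP[/eqP/(congr1 size)|].
  rewrite size_drop size_cat; rewrite size_cat in ku; move: ku w0.
  by clearbody k; clear; move: (size v) (size w); lia.
suff -> : wlt (drop k (v ++ w)) w = false by [].
apply/negbTE; rewrite drop_cat; case: ltnP => kv.
  have dv0 : drop k v != [::] by rewrite -size_eq0 size_drop subn_eq0 -ltnNge.
  have v1 : (1 < size v)%N by apply: leq_ltn_trans kv.
  have [_ _ _ vmin] := shirshovP lv v1.
  have h : ~~ wlt (drop k v) w by apply: wle_trans (hv v1) (vmin k _); rewrite k0 kv.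
  by rewrite (wlt_asym (wle_lt_trans h _)) // wlt_cat // lyndon_neq0.
case: (posnP (k - size v)) => [->|kv0]; first by rewrite drop0 wltnn.
rewrite size_cat in ku.
have d0 : drop (k - size v) w != [::].
  by rewrite -size_eq0 size_drop subn_eq0 -ltnNge ltn_subLR.
have t0 : take (k - size v) w != [::].
  by rewrite -size_eq0 size_take; case: ifP => _; rewrite -lt0n.
by rewrite (wlt_asym _) // -{1}(cat_take_drop (k - size v) w) lyndon_suffix // cat_take_drop.
Qed.

End Lyndon.

(** * Deciding identities in noncommutative algebras by reflection *)

Section AlgebraExpressions.
Variables (F : fieldType) (A : algType F).

Inductive nexp := NVar of nat | NAdd of nexp & nexp | NOpp of nexp | NScale of F & nexp
  | NMul of nexp & nexp | NZero | NOne.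

Fixpoint neval (env : seq A) e : A :=
  match e with
  | NVar i => nth 0 env i
  | NAdd e1 e2 => neval env e1 + neval env e2
  | NOpp e1 => - neval env e1
  | NScale c e1 => c *: neval env e1
  | NMul e1 e2 => neval env e1 * neval env e2
  | NZero => 0
  | NOne => 1
  end.

Fixpoint nopp (l : seq (F * seq nat)) :=
  if l is t :: l' then (- t.1, t.2) :: nopp l' else [::].
Fixpoint nscl c (m : seq nat) (l : seq (F * seq nat)) :=
  if l is t :: l' then (c * t.1, cat m t.2) :: nscl c m l' else [::].
Fixpoint nmul_terms (l1 l2 : seq (F * seq nat)) :=
  if l1 is t :: l1' then cat (nscl t.1 t.2 l2) (nmul_terms l1' l2) else [::].
Fixpoint nterms e : seq (F * seq nat) :=
  match e with
  | NVar i => [:: (1, [:: i])]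
  | NAdd e1 e2 => cat (nterms e1) (nterms e2)
  | NOpp e1 => nopp (nterms e1)
  | NScale c e1 => nscl c [::] (nterms e1)
  | NMul e1 e2 => nmul_terms (nterms e1) (nterms e2)
  | NZero => [::]
  | NOne => [:: (1, [::])]
  end.

Fixpoint meqb (m1 m2 : seq nat) : bool :=
  match m1, m2 with
  | [::], [::] => true
  | i :: m1', j :: m2' => if eqn i j then meqb m1' m2' else false
  | _, _ => false
  end.
Fixpoint ncoef m (l : seq (F * seq nat)) : F :=
  if l is t :: l' then if meqb m t.2 then t.1 + ncoef m l' else ncoef m l' else 0.
Fixpoint nrest m (l : seq (F * seq nat)) :=
  if l is t :: l' then if meqb m t.2 then nrest m l' else t :: nrest m l' else [::].
(** The coefficients are symbolic, so their vanishing is left as a conjunction of equations in F, to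
    be closed by [ring] or [field]. The fuel [k] is the number of terms, and each round removes at
    least one. *)
Fixpoint ncheck k (l : seq (F * seq nat)) : Prop :=
  match k, l with
  | k'.+1, t :: l' => t.1 + ncoef t.2 l' = 0 /\ ncheck k' (nrest t.2 l')
  | 0, _ :: _ => False
  | _, [::] => True
  end.

Definition nsum (env : seq A) (l : seq (F * seq nat)) : A :=
  \sum_(t <- l) t.1 *: \prod_(i <- t.2) nth 0 env i.

Lemma nsum_cons env t l :
  nsum env (t :: l) = t.1 *: \prod_(i <- t.2) nth 0 env i + nsum env l.
Proof. by rewrite /nsum big_cons. Qed.

Lemma nsum_nil env : nsum env [::] = 0.
Proof. by rewrite /nsum big_nil. Qed.

Lemma nsum_cat env l l' : nsum env (l ++ l') = nsum env l + nsum env l'.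
Proof. by rewrite /nsum big_cat. Qed.

Lemma nevalE env e : neval env e = nsum env (nterms e).
Proof.
have nsclE c m l : nsum env (nscl c m l) = c *: (\prod_(i <- m) nth 0 env i * nsum env l).
  elim: l => [|t l IH] /=; first by rewrite nsum_nil mulr0 scaler0.
  by rewrite !nsum_cons IH big_cat /= mulrDr scalerDr -scalerAr !scalerA.
elim: e => /= [i|e1 IH1 e2 IH2|e1 IH|c e1 IH|e1 IH1 e2 IH2||].
- by rewrite /nsum !big_seq1 scale1r.
- by rewrite IH1 IH2 nsum_cat.
- rewrite IH; elim: (nterms e1) => [|t l IHl] /=; first by rewrite nsum_nil oppr0.
  by rewrite !nsum_cons opprD IHl scaleNr.
- by rewrite IH nsclE big_nil mul1r.
- rewrite IH1 IH2; elim: (nterms e1) => [|t l IHl] /=; first by rewrite nsum_nil mul0r.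
  by rewrite nsum_cat nsum_cons mulrDl IHl nsclE scalerAl.
- by rewrite nsum_nil.
by rewrite /nsum big_seq1 big_nil scale1r.
Qed.

Lemma neval_eq env e1 e2 :
  (let l := nterms (NAdd e1 (NOpp e2)) in ncheck (size l) l) ->
  neval env e1 = neval env e2.
Proof.
move=> h; apply/eqP; rewrite -subr_eq0; apply/eqP.
rewrite -[_ - _]/(neval env (NAdd e1 (NOpp e2))) nevalE; move: h => /=.
set l := cat _ _; move: (size l) => k.
have meqbP m1 m2 : meqb m1 m2 -> m1 = m2.
  elim: m1 m2 => [|i m1 IH] [|j m2] //=; case: eqnP => // -> /IH -> //.
have split m (l' : seq (F * seq nat)) :
    nsum env l' = ncoef m l' *: \prod_(i <- m) nth 0 env i + nsum env (nrest m l').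
  elim: l' => [|t l' IH] /=; first by rewrite nsum_nil scale0r addr0.
  rewrite nsum_cons IH; case: ifP => [/meqbP ->|_]; first by rewrite scalerDl addrA.
  by rewrite nsum_cons addrCA.
elim: k l => [|k IH] [|t l] //=; rewrite ?nsum_nil // nsum_cons.
by case=> h1 h2; rewrite (split t.2) addrA -scalerDl h1 scale0r add0r IH.
Qed.

End AlgebraExpressions.

Ltac in_atoms x l :=
  lazymatch l with
  | nil => constr:(false)
  | x :: _ => constr:(true)
  | _ :: ?l' => in_atoms x l'
  end.
Ltac add_atom x l :=
  let b := in_atoms x l in
  lazymatch b with true => l | false => constr:(x :: l) end.
Ltac get_atoms e l :=
  lazymatch e with
  | (?a + ?b)%R => let l1 := get_atoms a l in get_atoms b l1
  | (?a * ?b)%R => let l1 := get_atoms a l in get_atoms b l1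
  | (- ?a)%R => get_atoms a l
  | (_ *: ?a)%R => get_atoms a l
  | 0%R => l
  | 1%R => l
  | _ => add_atom e l
  end.
Ltac atom_index x l :=
  lazymatch l with
  | x :: _ => constr:(O)
  | _ :: ?l' => let k := atom_index x l' in constr:(S k)
  end.
Ltac reify_nexp F e l :=
  lazymatch e with
  | (?a + ?b)%R =>
    let x := reify_nexp F a l in let y := reify_nexp F b l in constr:(@NAdd F x y)
  | (?a * ?b)%R =>
    let x := reify_nexp F a l in let y := reify_nexp F b l in constr:(@NMul F x y)
  | (- ?a)%R => let x := reify_nexp F a l in constr:(@NOpp F x)
  | (?c *: ?a)%R => let x := reify_nexp F a l in constr:(@NScale F c x)
  | 0%R => constr:(@NZero F)
  | 1%R => constr:(@NOne F)
  | _ => let k := atom_index e l in constr:(@NVar F k)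
  end.
(* Expands both sides of an equation in a noncommutative F-algebra A into
   monomials and leaves the vanishing of the coefficient of each monomial. *)
Ltac nring F A :=
  lazymatch goal with
  | |- ?e1 = ?e2 =>
    let V := type of e1 in
    let l0 := get_atoms e1 (@nil A) in
    let l := get_atoms e2 l0 in
    let x := reify_nexp F e1 l in
    let y := reify_nexp F e2 l in
    refine (@neval_eq F A l x y _);
    lazy beta iota zeta delta [nterms nopp nscl nmul_terms meqb ncoef nrest ncheck
      cat fst snd size eqn];
    repeat split
  end.

Section SkewCommutator.
Variables (F : fieldType) (A : algType F).
Implicit Types (a b c : A) (r s t : F).

Lemma skew_jacobi a b c r s t :
  c * (b * a - s *: (a * b)) - (t * r) *: ((b * a - s *: (a * b)) * c) =
  (c * b - r *: (b * c)) * a - (t * s) *: (a * (c * b - r *: (b * c)))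
  + r *: (b * (c * a - t *: (a * c))) - s *: ((c * a - t *: (a * c)) * b).
Proof. nring F A; ring. Qed.
End SkewCommutator.

(** * Super-letters *)

Section Superletters.
Variables (F : fieldType) (n : nat) (p : 'I_n -> 'I_n -> F).
Hypothesis hp : forall i j, p i j != 0.
Local Notation B := (nichols p).
Local Notation chi := (chi p).
Local Notation sl := (superletter p).
Local Notation br := (@nbracket F n p).
Implicit Types (x y z : B) (k : 'I_n) (u v w l : seq 'I_n) (a b : 'rV[int]_n).
Implicit Types (P Q R : seq 'I_n -> Prop).

Lemma superletter_recS m u : (1 < size u)%N ->
  superletter_rec p m.+1 u =
  br (wdeg (take (shirshov u) u)) (wdeg (drop (shirshov u) u))
     (superletter_rec p m (take (shirshov u) u)) (superletter_rec p m (drop (shirshov u) u)).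
Proof. by case: u => [|i [|j u]]. Qed.

Lemma size_shirshov u : lyndon u -> (1 < size u)%N ->
  (size (take (shirshov u) u) < size u)%N /\ (size (drop (shirshov u) u) < size u)%N.
Proof.
move=> lu u1; have [/andP[s0 su] _ _ _] := shirshovP lu u1.
by rewrite size_take su size_drop ltn_subrL s0 (ltnW u1).
Qed.

Lemma superletter_recE m u : lyndon u -> (size u <= m)%N ->
  superletter_rec p m u = sl u.
Proof.
rewrite /superletter; elim: m {-2}m (leqnn m) u => [|N IH] m mN u lu um.
  by have := lyndon_neq0 lu; rewrite -size_eq0 -leqn0 (leq_trans um mN).
case: (ltnP 1 (size u)) => u1; last first.
  by case: u lu um u1 => [|i [|]] //; case: m mN.
have [sz1 sz2] := size_shirshov lu u1; have [_ lt ld _] := shirshovP lu u1.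
case: m mN um => [|m]; first by move=> _; rewrite leqNgt ltnW.
rewrite ltnS => mN um; rewrite [LHS]superletter_recS //.
move: (u1) sz1 sz2 um; case sE: (size u) => [//|k] _ sz1 sz2 um.
rewrite [RHS]superletter_recS //; rewrite !ltnS in sz1 sz2 um.
have kN := leq_trans um mN.
have IHm := IH m mN; have IHk := IH k kN.
by rewrite (IHm _ lt) ?(leq_trans sz1) // (IHm _ ld) ?(leq_trans sz2) // (IHk _ lt) // (IHk _ ld).
Qed.

Lemma superletter1 i : sl [:: i] = nx p i.
Proof. by []. Qed.

Lemma superletterE u : lyndon u -> (1 < size u)%N ->
  let v := take (shirshov u) u in let w := drop (shirshov u) u in
  sl u = br (wdeg v) (wdeg w) (sl v) (sl w).
Proof.
move=> lu u1 v w; have [/andP[s0 su] lv lw _] := shirshovP lu u1.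
have [sz1 sz2] := size_shirshov lu u1.
rewrite {1}/superletter; move: (u1) sz1 sz2; case sE: (size u) => [//|k] _ sz1 sz2.
by rewrite superletter_recS // !superletter_recE.
Qed.

Lemma homog_br a b x y : homogeneous a x -> homogeneous b y -> homogeneous (a + b) (br a b x y).
Proof.
move=> hx hy; apply: homogB; first by rewrite addrC; apply: homogM.
by apply: homogZ; apply: homogM.
Qed.

Lemma wdeg_take_drop u m : wdeg (take m u) + wdeg (drop m u) = wdeg u.
Proof. by rewrite -wdeg_cat cat_take_drop. Qed.

Lemma homog_sl u : lyndon u -> homogeneous (wdeg u) (sl u).
Proof.
elim: {u}(size u) {-2}u (leqnn (size u)) => [|m IH] u um lu.
  by have := lyndon_neq0 lu; rewrite -size_eq0 -leqn0 um.
case: (leqP (size u) 1) => u1.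
  case: u lu u1 {um} => [|i [|//]]; first by case/lyndonP.
  by move=> _ _; rewrite superletter1 wdeg1; apply: homog_nx.
have [/andP[s0 su] lv lw _] := shirshovP lu u1.
rewrite superletterE // -(wdeg_take_drop u (shirshov u)).
apply: homog_br; apply: IH => //.
  by rewrite size_take su; rewrite -ltnS; apply: leq_trans su um.
by rewrite size_drop leq_subLR; apply: leq_trans um _; rewrite -add1n leq_add2r.
Qed.

(* gsub P a: the component of degree a of the subalgebra generated by the [w], P w. *)
Inductive gsub P : 'rV[int]_n -> B -> Prop :=
| gsub0 a : gsub P a 0
| gsub1 : gsub P 0 1
| gsub_lin a c x y : gsub P a x -> gsub P a y -> gsub P a (c *: x + y)
| gsub_mul b w y : P w -> gsub P b y -> gsub P (wdeg w + b) (sl w * y).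

Lemma gsub_cast P a b x : gsub P a x -> a = b -> gsub P b x.
Proof. by move=> h <-. Qed.

Lemma gsubD P a x y : gsub P a x -> gsub P a y -> gsub P a (x + y).
Proof. by move=> hx hy; rewrite -[x]scale1r; apply: gsub_lin. Qed.

Lemma gsubZ P a c x : gsub P a x -> gsub P a (c *: x).
Proof. by move=> hx; rewrite -[_ *: _]addr0; apply: gsub_lin => //; apply: gsub0. Qed.

Lemma gsubB P a x y : gsub P a x -> gsub P a y -> gsub P a (x - y).
Proof. by move=> hx hy; apply: gsubD => //; rewrite -scaleN1r; apply: gsubZ. Qed.

Lemma gsub_letter P w : P w -> gsub P (wdeg w) (sl w).
Proof.
move=> Pw; have := gsub_mul Pw (gsub1 P); rewrite mulr1; move/gsub_cast; apply.
by rewrite addr0.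
Qed.

Lemma gsubM P a b x y : gsub P a x -> gsub P b y -> gsub P (a + b) (x * y).
Proof.
move=> hx hy; elim: hx => {a x} [a||a c x z _ IHx _ IHz|a w x Pw _ IHx].
- by rewrite mul0r; apply: gsub0.
- by rewrite mul1r add0r.
- by rewrite mulrDl -scalerAl; apply: gsub_lin.
by rewrite -mulrA -addrA; apply: gsub_mul.
Qed.

Lemma gsub_sub P Q a x : (forall w, P w -> gsub Q (wdeg w) (sl w)) -> gsub P a x -> gsub Q a x.
Proof.
move=> PQ; elim=> {a x} [a||a c x z _ IHx _ IHz|a w x Pw _ IHx].
- exact: gsub0.
- exact: gsub1.
- exact: gsub_lin.
by apply: gsubM => //; apply: PQ.
Qed.

Lemma gsubW P Q a x : (forall w, P w -> Q w) -> gsub P a x -> gsub Q a x.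
Proof. by move=> PQ; apply: gsub_sub => w Pw; apply: gsub_letter; apply: PQ. Qed.

Lemma gsub_homog P a x : (forall w, P w -> lyndon w) -> gsub P a x -> homogeneous a x.
Proof.
move=> Pl; elim=> {a x} [a||a c x z _ IHx _ IHz|a w x Pw _ IHx].
- exact: homog0.
- exact: homog1.
- exact: homog_lin.
by apply: homogM => //; apply: homog_sl; apply: Pl.
Qed.

Lemma gsub_tot P a x : gsub P a x -> 0 <= tot a \/ x = 0.
Proof.
elim=> {a x} [a||a c x z _ [h|->] _ [h'|->]|a w x Pw _ [h|->]]; try by [left|right].
- by left; rewrite tot0.
- by right; rewrite scaler0 addr0.
- by left; rewrite totD tot_wdeg addr_ge0.
by right; rewrite mulr0.
Qed.

(** No factor can be longer than the whole product. The length bound matters because a comparison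
    with a word that is not longer is decided at a letter. *)
Lemma gsub_small P a x (m : nat) : gsub P a x -> tot a <= m%:Z ->
  gsub (fun w => P w /\ (size w <= m)%N) a x.
Proof.
elim=> {a x} [a _|_|a c x z _ IHx _ IHz am|a w x Pw hx IHx].
- exact: gsub0.
- exact: gsub1.
- by apply: gsub_lin; auto.
rewrite totD tot_wdeg => am.
case: (gsub_tot hx) => [h|->]; last by rewrite mulr0; apply: gsub0.
apply: gsub_mul; first by split=> //; rewrite -lez_nat; apply: le_trans am; rewrite lerDl.
by apply: IHx; apply: le_trans am; rewrite lerDr.
Qed.

Lemma brM a b1 b2 x y z :
  br a (b1 + b2) x (y * z) = y * br a b2 x z + chi b2 a *: (br a b1 x y * z).
Proof. by rewrite /nbracket chiDl //; nring F (nichols p); ring. Qed.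

Lemma br_lin a b x c y z : br a b x (c *: y + z) = c *: br a b x y + br a b x z.
Proof. by rewrite /nbracket; nring F (nichols p); ring. Qed.

Lemma br_gsub Q R a b x y : (forall w, Q w -> R w) ->
  (forall w, Q w -> gsub R (a + wdeg w) (br a (wdeg w) x (sl w))) ->
  gsub Q b y -> gsub R (a + b) (br a b x y).
Proof.
move=> QR h; elim=> {b y} [b||b c y z _ IHy _ IHz|b w y Qw hy IHy].
- by rewrite /nbracket mulr0 mul0r scaler0 subr0; apply: gsub0.
- by rewrite /nbracket chi0l // scale1r mulr1 mul1r subrr; apply: gsub0.
- by rewrite br_lin; apply: gsub_lin.
rewrite brM; apply: gsubD; last apply: gsubZ.
  by rewrite addrCA; apply: gsub_mul => //; apply: QR.
by rewrite addrA; apply: gsubM; [apply: h|apply: gsubW hy].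
Qed.

Definition ge_word u w : Prop := lyndon w /\ ~~ wlt w u.
Definition gt_word u w : Prop := lyndon w /\ wlt u w.

Lemma gt_word_ge u w : gt_word u w -> ge_word u w.
Proof. by case=> lw uw; split=> //; rewrite (wlt_asym uw). Qed.

Lemma ge_word_gt u u' w : wlt u u' -> ge_word u' w -> gt_word u w.
Proof. by move=> uu' [lw h]; split=> //; apply: wlt_le_trans uu' h. Qed.

Lemma jacobi a b c x y z :
  br (a + b) c (br a b x y) z =
  br a (b + c) x (br b c y z) + chi c b *: (y * br a c x z) - chi b a *: (br a c x z * y).
Proof.
rewrite /nbracket !chiDl // !chiDr // skew_jacobi.
by rewrite [chi b a * _]mulrC.
Qed.

(** Induction on the length of v w, then on that of v. If v, w is the standard factorization of v w,
    the bracket is a super-letter. Otherwise v = v1 v2 with v2 < w, and the Jacobi identity leaves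
    the brackets of v2 and of v1 with w, which are shorter in total, and the bracket of v1 with
    [[v2], [w]], where v1 is shorter than v. *)
Lemma br_superletter v w : lyndon v -> lyndon w -> wlt v w ->
  gsub (ge_word (v ++ w)) (wdeg v + wdeg w) (br (wdeg v) (wdeg w) (sl v) (sl w)).
Proof.
suff H N M : forall v w, lyndon v -> lyndon w -> wlt v w ->
    (size v + size w <= N)%N -> (size v <= M)%N ->
    gsub (ge_word (v ++ w)) (wdeg v + wdeg w) (br (wdeg v) (wdeg w) (sl v) (sl w)).
  by move=> lv lw vw; apply: (H (size v + size w)%N (size v)).
elim: N M => [|N IHN] M {}v {}w.
  move=> lv _ _; rewrite leqn0 addn_eq0 size_eq0 => /andP[/eqP v0].
  by move: (lyndon_neq0 lv); rewrite v0.
elim: M v w => [|M IHM] v w lv lw vw.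
  by move=> _; rewrite leqn0 size_eq0 => /eqP v0; move: (lyndon_neq0 lv); rewrite v0.
move=> hN hM; have lvw := lyndon_cat lv lw vw.
have v0 : (0 < size v)%N by rewrite lt0n size_eq0 lyndon_neq0.
have w0 : (0 < size w)%N by rewrite lt0n size_eq0 lyndon_neq0.
case: (boolP ((1 < size v)%N && wlt (drop (shirshov v) v) w)); last first.
  rewrite negb_and -implybE => /implyP std.
  have sE := shirshov_cat lv lw vw std.
  have -> : br (wdeg v) (wdeg w) (sl v) (sl w) = sl (v ++ w).
    rewrite [RHS]superletterE // ?sE ?take_size_cat ?drop_size_cat //.
    by rewrite size_cat -addn1 leq_add.
  by rewrite -wdeg_cat; apply: gsub_letter; split=> //; rewrite wltnn.
case/andP=> v1 v2w; have [/andP[s0 sv] lv1 lv2 _] := shirshovP lv v1.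
rewrite (superletterE lv v1) /=.
set v1' := take _ _ in lv1 *; set v2 := drop _ _ in v2w lv2 *.
have vE : v = v1' ++ v2 by rewrite cat_take_drop.
have v1'0 := lyndon_neq0 lv1; have v20 := lyndon_neq0 lv2.
have vv2 : wlt v v2 by rewrite vE lyndon_suffix -?vE.
have v1v : wlt v1' v by rewrite vE wlt_cat.
have sz : (size v = size v1' + size v2)%N by rewrite vE size_cat.
have sz1 : (size v1' < size v)%N by rewrite sz -{1}[size v1']addn0 ltn_add2l lt0n size_eq0.
have sz2 : (size v2 < size v)%N by rewrite sz -{1}[size v2]add0n ltn_add2r lt0n size_eq0.
have lv2w := lyndon_cat lv2 lw v2w.
have v2ww : wlt (v2 ++ w) w by apply: lyndon_cat_lt.
have vw_v1w : wlt (v ++ w) (v1' ++ w) by rewrite vE -catA wlt_cat2l.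
have vw_v2 : wlt (v ++ w) v2.
  by rewrite -[v2]cats0; apply: slt_wlt; apply: wlt_slt => //; apply: ltnW.
have t1 : gsub (ge_word (v2 ++ w)) (wdeg v2 + wdeg w) (br (wdeg v2) (wdeg w) (sl v2) (sl w)).
  by apply: (IHN (size v2)) => //; rewrite -ltnS; apply: leq_trans hN; rewrite ltn_add2r.
have t2 : gsub (ge_word (v1' ++ w)) (wdeg v1' + wdeg w) (br (wdeg v1') (wdeg w) (sl v1') (sl w)).
  apply: (IHN (size v1')) => //; last by rewrite -ltnS; apply: leq_trans hN; rewrite ltn_add2r.
  by apply: wlt_trans v1v vw.
have {}t2 : gsub (ge_word (v ++ w)) (wdeg v1' + wdeg w) (br (wdeg v1') (wdeg w) (sl v1') (sl w)).
  by apply: gsubW t2 => l /(ge_word_gt vw_v1w)/gt_word_ge.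
have t3 : gsub (ge_word (v ++ w)) (wdeg v2) (sl v2).
  by apply: gsub_letter; split=> //; rewrite (wlt_asym vw_v2).
rewrite -(wdeg_take_drop v (shirshov v)) -/v1' -/v2 jacobi.
apply: gsubB; last by apply: gsubZ; apply: gsub_cast (gsubM t2 t3) _; rewrite addrAC.
apply: gsubD; last by apply: gsubZ; apply: gsub_cast (gsubM t3 t2) _; rewrite addrCA addrA.
have v1_v2w : wlt v1' (v2 ++ w).
  by apply: wlt_trans v1v (wlt_trans vv2 _); rewrite wlt_cat // lyndon_neq0.
have vw_v2w : wlt (v ++ w) (v2 ++ w) by rewrite vE -catA; apply: lyndon_cat_lt.
(* The words [l] occurring in the bracket of [v2] and [w] are no longer than [v2 ++ w], so the inner
   induction applies to [v1'] and [l] without exceeding the total length. *)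
rewrite -addrA; apply: br_gsub (gsub_small t1 (m := size (v2 ++ w)) _) => [l [/(ge_word_gt vw_v2w)/gt_word_ge //]|l [[ll h] szl]|].
  have v1l := wlt_le_trans v1_v2w h.
  apply: gsubW (IHM v1' l lv1 ll v1l _ _) => [l' [ll' h']||].
  - by split=> //; apply: wle_trans h'; rewrite vE -catA wlt_cat2l.
  - apply: leq_trans hN; rewrite sz -addnA leq_add2l.
    by rewrite -size_cat.
  by rewrite -ltnS; apply: leq_trans sz1 hM.
by rewrite -wdeg_cat tot_wdeg.
Qed.

Lemma br_gt_word u b y : lyndon u -> gsub (gt_word u) b y ->
  gsub (gt_word u) (wdeg u + b) (br (wdeg u) b (sl u) y).
Proof.
move=> lu; apply: br_gsub => // w [lw uw].
apply: gsubW (br_superletter lu lw uw) => l; apply: ge_word_gt.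
by rewrite wlt_cat // lyndon_neq0.
Qed.

Lemma dR_gsub P a x k : (forall w, P w -> lyndon w) ->
  (forall w, P w -> gsub P (wdeg w - ek k) (dR k (sl w))) ->
  gsub P a x -> gsub P (a - ek k) (dR k x).
Proof.
move=> Pl h; elim=> {a x} [a||a c x y _ IHx _ IHy|b w y Pw hy IHy].
- by rewrite linear0; apply: gsub0.
- by rewrite dR1; apply: gsub0.
- by rewrite linearP; apply: gsub_lin.
rewrite (dRM hp _ _ (gsub_homog Pl hy)); apply: gsubD; last apply: gsubZ.
  by rewrite -addrA; apply: gsub_mul.
by rewrite addrAC; apply: gsubM => //; apply: h.
Qed.

(** Induction along the standard factorization: every super-letter that survives in the derivative
    of [[v], [w]] is above u = v w. This makes derivatives of lower order in the arguments with
    leading coefficients. *)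
Lemma dR_superletter u k : lyndon u -> gsub (gt_word u) (wdeg u - ek k) (dR k (sl u)).
Proof.
elim: {u}(size u) {-2}u (leqnn (size u)) => [|m IH] u um lu.
  by have := lyndon_neq0 lu; rewrite -size_eq0 -leqn0 um.
case: (leqP (size u) 1) => u1.
  case: u lu u1 {um} => [|i [|//]]; first by case/lyndonP.
  move=> _ _; rewrite superletter1 dR_nx wdeg1; case: eqP => [->|_]; last exact: gsub0.
  by rewrite subrr; apply: gsub1.
have [/andP[s0 su] lv lw _] := shirshovP lu u1.
rewrite superletterE //=; set v := take _ _ in lv *; set w := drop _ _ in lw *.
have uE : u = v ++ w by rewrite cat_take_drop.
have v0 := lyndon_neq0 lv; have w0 := lyndon_neq0 lw.
have uw : wlt u w by rewrite uE lyndon_suffix // -uE.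
have vu : wlt v u by rewrite uE wlt_cat.
have sz : (size u = size v + size w)%N by rewrite uE size_cat.
have szv : (size v < size u)%N by rewrite sz -{1}[size v]addn0 ltn_add2l lt0n size_eq0.
have szw : (size w < size u)%N by rewrite sz -{1}[size w]add0n ltn_add2r lt0n size_eq0.
have hv : gsub (gt_word u) (wdeg v - ek k) (dR k (sl v)).
  have h := IH v (leq_trans szv um) lv.
  apply: gsubW (gsub_small h (m := size v) _) => [l [[ll vl] szl]|]; last first.
    by rewrite totB tot_wdeg tot_ek gerBl.
  (* A word above v and no longer than v differs from v at some letter, so it stays above
     [v ++ w]. *)
  split=> //; rewrite uE -[l]cats0; apply: slt_wlt; exact: wlt_slt.
have hw := IH w (leq_trans szw um) lw.
have gw : gsub (gt_word u) (wdeg w) (sl w) by apply: gsub_letter.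
have hv' : gsub (gt_word u) (wdeg v + (wdeg w - ek k)) (br (wdeg v) (wdeg w - ek k) (sl v) (dR k (sl w))).
  apply: br_gsub hw => l [ll wl]; first by split=> //; apply: wlt_trans uw wl.
  have vl : wlt v l by apply: wlt_trans vu (wlt_trans uw wl).
  apply: gsubW (br_superletter lv ll vl) => l'; apply: ge_word_gt.
  by rewrite uE wlt_cat2l.
(* The two terms with [dR k (sl w)] recombine to its bracket with [sl v], taken in the degree
   [wdeg w - ek k]. Thus [sl v] itself, which is below u, occurs only inside a bracket. *)
have -> : dR k (br (wdeg v) (wdeg w) (sl v) (sl w)) =
   sl w * dR k (sl v) - (chi (wdeg w) (wdeg v) * chi (ek k) (wdeg w)) *: (dR k (sl v) * sl w)
   + chi (ek k) (wdeg v) *: br (wdeg v) (wdeg w - ek k) (sl v) (dR k (sl w)).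
  rewrite /nbracket linearB linearZ /= (dRM hp _ _ (homog_sl lv)) (dRM hp _ _ (homog_sl lw)).
  rewrite chiBl //; have h0 := chi_neq0 hp (ek k) (wdeg v).
  by nring F (nichols p); field.
rewrite uE wdeg_cat; apply: gsubD; last by apply: gsubZ; rewrite -uE -addrA.
rewrite -uE; apply: gsubB; last by apply: gsubZ; apply: gsub_cast (gsubM hv gw) _; rewrite addrAC.
by apply: gsub_cast (gsubM gw hv) _; rewrite addrCA addrA.
Qed.

Lemma dR_gt_word u k a x : gsub (gt_word u) a x -> gsub (gt_word u) (a - ek k) (dR k x).
Proof.
apply: dR_gsub => [w [] //|w [lw uw]].
by apply: gsubW (dR_superletter k lw) => l [ll wl]; split=> //; apply: wlt_trans wl.
Qed.

End Superletters.

Ltac degring := apply/rowP => ?; rewrite !(mxE, mulmxnE, mulrS); ring.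

(** * Power sums in one element over a graded subspace *)

Section PowerSums.
Variables (F : fieldType) (n : nat) (p : 'I_n -> 'I_n -> F).
Local Notation B := (nichols p).
Variables (L : 'rV[int]_n -> B -> Prop) (y : B) (b : 'rV[int]_n).
Hypothesis L0 : forall d, L d 0.
Hypothesis Llin : forall d c x z, L d x -> L d z -> L d (c *: x + z).

(** Two instances occur: [L] is the subalgebra of the super-letters above u and [y] is [sl u], or
    [L] is the subalgebra K and [y] is x_i. *)
Definition psum (m : nat) (d : 'rV[int]_n) (x : B) : Prop :=
  exists a : nat -> B, (forall k, L (d - b *+ k) (a k)) /\ x = \sum_(k < m) a k * y ^+ k.

Definition pind (m : nat) : Prop := forall d (a : nat -> B),
  (forall k, L (d - b *+ k) (a k)) -> \sum_(k < m) a k * y ^+ k = 0 ->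
  forall k, (k < m)%N -> a k = 0.

Lemma psum0 m d : psum m d 0.
Proof. by exists (fun=> 0); split=> // ; rewrite big1 // => k _; rewrite mul0r. Qed.

Lemma psum_lin m d c x z : psum m d x -> psum m d z -> psum m d (c *: x + z).
Proof.
move=> [a1 [h1 ->]] [a2 [h2 ->]]; exists (fun k => c *: a1 k + a2 k); split=> [k|].
  exact: Llin.
by rewrite scaler_sumr -big_split; apply: eq_bigr => k _; rewrite mulrDl scalerAl.
Qed.

Lemma psumD m d x z : psum m d x -> psum m d z -> psum m d (x + z).
Proof. by move=> hx hz; rewrite -[x]scale1r; apply: psum_lin. Qed.

Lemma psumZ m d c x : psum m d x -> psum m d (c *: x).
Proof. by move=> hx; rewrite -[_ *: _]addr0; apply: psum_lin => //; apply: psum0. Qed.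

Lemma psumB m d x z : psum m d x -> psum m d z -> psum m d (x - z).
Proof. by move=> hx hz; apply: psumD => //; rewrite -scaleN1r; apply: psumZ. Qed.

Lemma psum_cast m d d' x : psum m d x -> d = d' -> psum m d' x.
Proof. by move=> h <-. Qed.

Lemma psumS m d x : psum m.+1 d x <->
  exists a x', [/\ L (d - b *+ m) a, psum m d x' & x = x' + a * y ^+ m].
Proof.
split=> [[a [ha ->]]|[a [x' [ha [a' [ha' ->]] ->]]]].
  exists (a m), (\sum_(k < m) a k * y ^+ k); rewrite big_ord_recr; split=> //.
  by exists a.
exists (fun k => if k == m then a else a' k); split=> [k|].
  by case: eqP => [->|].
rewrite big_ord_recr /= eqxx; congr (_ + _); apply: eq_bigr => k _.
by rewrite ltn_eqF.
Qed.

Lemma psum_term m d a : L (d - b *+ m) a -> psum m.+1 d (a * y ^+ m).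
Proof.
move=> ha; apply/psumS; exists a, 0; split=> //; last by rewrite add0r.
exact: psum0.
Qed.

Lemma psumW m m' d x : (m <= m')%N -> psum m d x -> psum m' d x.
Proof.
move=> /subnK <-; elim: (m' - m)%N => // k IH /IH h.
by rewrite addSn; apply/psumS; exists 0, x; rewrite mul0r addr0; split.
Qed.

Lemma pind_top m d a x : pind m.+1 -> L (d - b *+ m) a -> psum m d x ->
  x + a * y ^+ m = 0 -> a = 0.
Proof.
move=> ind ha [a' [ha' ->]] E; have := ind d (fun k => if k == m then a else a' k) _ _ m.
rewrite eqxx; apply=> // [k|]; first by case: eqP => [->|].
rewrite big_ord_recr /= eqxx -[RHS]E; congr (_ + _); apply: eq_bigr => k _.
by rewrite ltn_eqF.
Qed.

Lemma pindS m : pind m ->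
  (forall d a x, L (d - b *+ m) a -> psum m d x -> x + a * y ^+ m = 0 -> a = 0) -> pind m.+1.
Proof.
move=> ind top d a ha; rewrite big_ord_recr /= => E.
have am : a m = 0 by apply: top E => //; exists a.
move=> k; rewrite ltnS leq_eqVlt => /orP[/eqP -> //|km].
by move: E; rewrite am mul0r addr0 => E; apply: ind E _ km.
Qed.

Lemma pindW m m' : (m <= m')%N -> pind m' -> pind m.
Proof.
move=> mm' ind d a ha E k km; have := ind d (fun k => if (k < m)%N then a k else 0) _ _ k.
rewrite km; apply; last exact: leq_trans mm'.
  by move=> j; case: ifP.
rewrite -[RHS]E (big_ord_widen m' (fun k => a k * y ^+ k) mm') [RHS]big_mkcond /=.
by apply: eq_bigr => j _; case: ifP => //; rewrite mul0r.
Qed.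

End PowerSums.

Section PBW.
Variables (F : fieldType) (n : nat) (p : 'I_n -> 'I_n -> F).
Hypothesis hp : forall i j, p i j != 0.
Local Notation B := (nichols p).
Local Notation chi := (chi p).
Local Notation sl := (superletter p).
Local Notation br := (@nbracket F n p).
Implicit Types (x y z : B) (k : 'I_n) (u v w l : seq 'I_n) (d e : 'rV[int]_n).

Section OneLetter.
Variable u : seq 'I_n.
Hypothesis lu : lyndon u.
Local Notation L := (@gsub F n p (gt_word u)).
Local Notation y := (sl u).
Local Notation b := (wdeg u).
Local Notation ps := (psum L y b).
Local Notation q := (chi b b).

Let L0 d : L d 0. Proof. exact: gsub0. Qed.
Let Llin d c x z : L d x -> L d z -> L d (c *: x + z). Proof. exact: gsub_lin. Qed.
Let Lhom d x : L d x -> homogeneous d x.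
Proof. by apply: gsub_homog => // w []. Qed.

Lemma psum_mull m d e x z : L e z -> ps m d x -> ps m (e + d) (z * x).
Proof.
move=> hz [a [ha ->]]; exists (fun j => z * a j); split=> [k|].
  by rewrite -addrA; apply: gsubM.
by rewrite mulr_sumr; apply: eq_bigr => k _; rewrite mulrA.
Qed.

(** Brackets of [u] with larger super-letters produce only larger ones, so powers of [u] can be
    collected on the right. *)
Lemma superletter_comm d x : L d x ->
  exists2 x', L (b + d) x' & y * x = (chi d b)^-1 *: (x * y) + x'.
Proof.
move=> hx; exists (- (chi d b)^-1 *: br b d y x).
  by apply: gsubZ; apply: (br_gt_word hp lu hx).
rewrite /nbracket; have h0 := chi_neq0 hp d b.
by nring F (nichols p); field.
Qed.

Lemma psum_letter m d x : ps m d x -> ps m.+1 (b + d) (y * x).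
Proof.
elim: m x => [|m IH] x.
  by case=> a [_ ->]; rewrite big_ord0 mulr0; apply: psum0.
case/psumS => a [x' [ha hx' ->]]; rewrite mulrDr; apply: psumD => //.
  by apply: psumW (IH _ hx').
rewrite mulrA; have [a' ha' ->] := superletter_comm ha.
rewrite mulrDl -scalerAl -mulrA -exprS; apply: psumD => //.
  apply: psumZ => //; apply: psum_term => //; rewrite mulrS opprD addrACA subrr add0r.
  by [].
apply: (psumW L0 (leqnSn m.+1)); apply: psum_term => //.
by rewrite -addrA.
Qed.

Definition qinv_sum (m : nat) : F := \sum_(j < m) q ^- j.

(** Commuting [y] past [dR k y] costs [(chi (b - ek k) b)^-1] modulo lower powers; together with the
    factors from the Leibniz rule, the powers of [q^-1] add up to [qinv_sum]. *)
Lemma dR_power k m :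
  ps m (b *+ m.+1 - ek k)
    (dR k (y ^+ m.+1) - (qinv_sum m.+1 * chi (ek k) b ^+ m) *: (dR k y * y ^+ m)).
Proof.
have hz : L (b - ek k) (dR k y) by apply: (dR_superletter hp k lu).
elim: m => [|m IH].
  rewrite /qinv_sum big_ord1 !expr0 invr1 mulr1 scale1r mulr1 expr1 subrr.
  exact: psum0.
have hy : homogeneous b y by apply: homog_sl.
rewrite exprS (dRM hp _ _ (homogX m.+1 hy)) chiMnr //.
set X := dR k (y ^+ m.+1) in IH *.
have [z' hz' zE] := superletter_comm hz.
have -> : y * X + chi (ek k) b ^+ m.+1 *: (dR k y * y ^+ m.+1)
    - (qinv_sum m.+2 * chi (ek k) b ^+ m.+1) *: (dR k y * y ^+ m.+1) =
  y * (X - (qinv_sum m.+1 * chi (ek k) b ^+ m) *: (dR k y * y ^+ m))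
  + (qinv_sum m.+1 * chi (ek k) b ^+ m) *: (z' * y ^+ m).
  have -> : z' = y * dR k y - (chi (b - ek k) b)^-1 *: (dR k y * y).
    by rewrite zE addrAC subrr add0r.
  have -> : qinv_sum m.+2 = 1 + q^-1 * qinv_sum m.+1.
    rewrite /qinv_sum big_ord_recl expr0 invr1 mulr_sumr; congr (_ + _).
    by apply: eq_bigr => j _; rewrite lift0 exprS invfM.
  have h0 := chi_neq0 hp (ek k) b; have h1 := chi_neq0 hp b b.
  rewrite chiBl // [y ^+ m.+1]exprS [chi (ek k) b ^+ m.+1]exprS.
  by nring F (nichols p); field; rewrite ?h0 ?h1.
apply: psumD => //; last first.
  apply: psumZ => //; apply: psum_term => //; apply: gsub_cast hz' _.
  by degring.
by apply: psum_cast (psum_letter IH) _; rewrite [in RHS]mulrS addrA.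
Qed.

Lemma dR_powerW k m : ps m (b *+ m - ek k) (dR k (y ^+ m)).
Proof.
case: m => [|m]; first by rewrite expr0 dR1; apply: psum0.
rewrite -[dR k _](subrK ((qinv_sum m.+1 * chi (ek k) b ^+ m) *: (dR k y * y ^+ m))).
apply: psumD => //; first exact: (psumW L0 (leqnSn m) (dR_power k m)).
apply: psumZ => //; apply: psum_term => //.
by apply: gsub_cast (dR_superletter hp k lu) _; degring.
Qed.

Lemma dR_term k m d a : L (d - b *+ m) a ->
  ps m (d - ek k) (dR k (a * y ^+ m) - chi (ek k) b ^+ m *: (dR k a * y ^+ m)).
Proof.
move=> ha; rewrite (dRM hp _ _ (homogX m (homog_sl p lu))) chiMnr // addrK.
by apply: psum_cast (psum_mull ha (dR_powerW k m)) _; degring.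
Qed.

Lemma dR_psum k m d x : ps m d x -> ps m (d - ek k) (dR k x).
Proof.
elim: m x => [|m IH] x; first by case=> a [_ ->]; rewrite big_ord0 linear0; apply: psum0.
case/psumS => a [x' [ha hx' ->]]; rewrite linearD /=; apply: psumD => //.
  by apply: (psumW L0 (leqnSn m)); apply: IH.
rewrite -[dR k _](subrK (chi (ek k) b ^+ m *: (dR k a * y ^+ m))); apply: psumD => //.
  exact: (psumW L0 (leqnSn m) (dR_term k ha)).
apply: psumZ => //; apply: psum_term => //.
by apply: gsub_cast (dR_gt_word hp k ha) _; degring.
Qed.

(* Skew derivations lower the leading coefficient of a relation to a scalar. *)
Lemma pind_superletter m : (forall j : nat, (j < m)%N -> ~ ps j (b *+ j) (y ^+ j)) -> pind L y b m.
Proof.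
elim: m => [|m IH] red; first by move=> d a _ _ k.
apply: pindS => //; first by apply: IH => j jm; apply: red; apply: ltnW.
move=> d a x; have [N] := ubnP `|tot (d - b *+ m)|%N.
elim: N => // N IHN in d a x *; rewrite ltnS => tN ha hx E.
apply/eqP/negPn/negP => a0.
have ta : 0 <= tot (d - b *+ m) by case: (gsub_tot ha) => // a1; rewrite a1 eqxx in a0.
(* In degree zero the leading coefficient is a scalar, and a nonzero one would express [y ^+ m] by
   lower powers, which [red] excludes. *)
have [d0|d0] := eqVneq (d - b *+ m) 0.
  rewrite d0 in ha; have [c cE] := homog_deg0 (Lhom ha).
  have c0 : c != 0 by apply: contraNneq a0 => c0; rewrite cE c0 scale0r.
  case: (red m (leqnn _)); have <- : - c^-1 *: x = y ^+ m.
    have -> : x = - (a * y ^+ m) by apply/eqP; rewrite -addr_eq0 E.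
    by rewrite cE -scalerAl mul1r scaleNr scalerN opprK scalerA mulVf // scale1r.
  by apply: psumZ => //; apply: psum_cast hx _; apply/eqP; rewrite -subr_eq0 d0.
have [k k0] : exists k, dR k a != 0.
  case: (boolP [exists k, dR k a != 0]) => [/existsP //|]; rewrite negb_exists => /forallP h.
  by case/eqP: a0; apply: (dR_eq0 (Lhom ha)) => // k; apply/eqP/negPn/h.
have tk : 0 <= tot (d - b *+ m - ek k).
  by case: (gsub_tot (dR_gt_word hp k ha)) => // a1; rewrite a1 eqxx in k0.
have := congr1 (dR k) E; rewrite linear0 linearD /=.
rewrite -[dR k (a * _)](subrK (chi (ek k) b ^+ m *: (dR k a * y ^+ m))) addrA scalerAl => E'.
have : chi (ek k) b ^+ m *: dR k a = 0.
  apply: (IHN (d - ek k) _ _ _ _ _ E').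
  - rewrite totB tot_ek in tk; rewrite [d - ek k - _]addrAC totB tot_ek.
    by move: tN ta tk; set t := tot _; lia.
  - by apply: gsubZ; apply: gsub_cast (dR_gt_word hp k ha) _; degring.
  apply: psumD => //; first exact: dR_psum.
  by rewrite -scalerAl; apply: dR_term.
by move/eqP; rewrite scaler_eq0 (negbTE k0) orbF expf_eq0 (negbTE (chi_neq0 hp _ _)) andbF.
Qed.

(** Let a be the coefficient of y^(m-1) in an expression of y^m. Applying every [dR k] and comparing
    coefficients of y^(m-1) shows that [qinv_sum m *: y - a] has no nonzero derivative, hence is
    zero; a nonzero [qinv_sum m] would put y into the span of larger monomials. *)
Lemma psum_qinv_sum m : (0 < m)%N -> (forall j : nat, (j < m)%N -> ~ ps j (b *+ j) (y ^+ j)) ->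
  ps m (b *+ m) (y ^+ m) -> ~ L b y -> qinv_sum m = 0.
Proof.
case: m => // m _ red; have ind := pind_superletter red.
case/psumS => a [x [ha hx E]] nL.
have b0 : b != 0 by rewrite wdeg_eq0 lyndon_neq0.
rewrite mulrS addrK in ha.
suff : qinv_sum m.+1 *: y - a = 0.
  move/eqP; rewrite subr_eq0 => /eqP aE; apply/eqP/negPn/negP => q0; case: nL.
  have -> : y = (qinv_sum m.+1)^-1 *: a by rewrite -aE scalerA mulVf // scale1r.
  exact: gsubZ.
have hom : homogeneous b (qinv_sum m.+1 *: y - a).
  by apply: homogB; [apply: homogZ; apply: homog_sl|apply: Lhom].
apply: (dR_eq0 hom b0) => k.
have := congr1 (dR k) E; rewrite linearD /= => E'.
set X := dR k (y ^+ m.+1) in E'.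
set c := chi (ek k) b ^+ m.
have c0 : c != 0 by rewrite expf_eq0 (negbTE (chi_neq0 hp _ _)) andbF.
have h1 := dR_power k m; rewrite -/X -/c in h1.
have ha' : L (b *+ m.+1 - b *+ m) a by rewrite mulrS addrK.
have h2 := dR_term k ha'; rewrite -/c in h2.
have h3 := dR_psum k hx.
have hz : L (b *+ m.+1 - ek k - b *+ m) (c *: dR k (qinv_sum m.+1 *: y - a)).
  rewrite linearB linearZ /=; apply: gsubZ; apply: gsubB; first apply: gsubZ.
    by apply: gsub_cast (dR_superletter hp k lu) _; degring.
  by apply: gsub_cast (dR_gt_word hp k ha) _; degring.
have := pind_top ind hz (psumB L0 Llin h1 (psumD Llin h2 h3)).
rewrite E' => h; have {}h : c *: dR k (qinv_sum m.+1 *: y - a) = 0.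
  by apply: h; rewrite [dR k (_ - a)]linearB /= [dR k (_ *: _)]linearZ /=; nring F (nichols p); ring.
by move/eqP: h; rewrite scaler_eq0 (negbTE c0) => /eqP.
Qed.

Lemma ge_psum m d x : ps m (b *+ m) (y ^+ m) -> gsub (ge_word u) d x -> ps m d x.
Proof.
move=> red; have m0 : (0 < m)%N.
  case: m red => // -[a [_ /eqP]]; by rewrite big_ord0 expr0 oner_eq0.
elim=> {d x} [d||d c x z _ hx _ hz|d w x [lw uw] hx hp'].
- exact: psum0.
- rewrite -[1]mulr1 -[X in _ * X](expr0 y); apply: (psumW L0 m0); apply: psum_term => //.
  by rewrite mulr0n subr0; apply: gsub1.
- exact: psum_lin.
case: (eqVneq u w) => [uE|uw']; last first.
  apply: psum_mull => //; apply: gsub_letter; split=> //.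
  by move: uw; rewrite wltNge eq_sym (negbTE uw').
rewrite -uE; have := psum_letter hp'; case/psumS => a [x' [ha hx' ->]].
apply: psumD => //; apply: psum_cast (psum_mull ha red) _; degring.
Qed.

Lemma ge_psum_ex d x : gsub (ge_word u) d x -> exists m, ps m d x.
Proof.
elim=> {d x} [d||d c x z _ [m1 hx] _ [m2 hz]|d w x [lw uw] hx [m hm]].
- by exists 0%N; apply: psum0.
- exists 1%N; rewrite -[1]mulr1 -[X in _ * X](expr0 y); apply: psum_term => //.
  by rewrite mulr0n subr0; apply: gsub1.
- exists (maxn m1 m2); apply: psum_lin => //.
    by apply: psumW hx; rewrite ?leq_maxl.
  by apply: psumW hz; rewrite ?leq_maxr.
case: (eqVneq u w) => [uE|uw']; last first.
  exists m; apply: psum_mull => //; apply: gsub_letter; split=> //.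
  by move: uw; rewrite wltNge eq_sym (negbTE uw').
by exists m.+1; rewrite -uE; apply: psum_letter.
Qed.

Lemma psum_ge m d x : ps m d x -> gsub (ge_word u) d x.
Proof.
elim: m x => [|m IH] x; first by case=> a [_ ->]; rewrite big_ord0; apply: gsub0.
case/psumS => a [x' [ha hx' ->]]; apply: gsubD; first exact: IH.
rewrite -[d](subrK (b *+ m)); apply: gsubM; first by apply: gsubW ha => w; apply: gt_word_ge.
elim: m {IH hx' ha} => [|m IH]; first exact: gsub1.
by rewrite exprS mulrS; apply: gsub_mul => //; split=> //; rewrite wltnn.
Qed.

End OneLetter.
End PBW.

(** * Dimensions and the PBW basis *)

Section Dimension.
Variables (F : fieldType) (V : lmodType F).
Implicit Types (b : seq V) (c : nat -> F) (L : V -> Prop).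

Definition lincomb c b : V := \sum_(0 <= i < size b) c i *: b`_i.

Definition lfree b : Prop := forall c, lincomb c b = 0 -> forall i, (i < size b)%N -> c i = 0.

Definition subspace L : Prop := L 0 /\ forall (a : F) x y, L x -> L y -> L (a *: x + y).

(** Subspaces are predicates on a space that need not be finite-dimensional, so a dimension is
    asserted by exhibiting a finite basis. *)
Definition hasdim L (d : nat) : Prop := exists b,
  [/\ size b = d, forall x, x \in b -> L x, lfree b & forall x, L x -> exists c, x = lincomb c b].

Lemma lincomb0 b : lincomb (fun=> 0) b = 0.
Proof. by rewrite /lincomb big1 // => i _; rewrite scale0r. Qed.

Lemma lincomb_nil c : lincomb c [::] = 0.
Proof. by rewrite /lincomb big_nil. Qed.

Lemma lincomb_lin a c c' b : a *: lincomb c b + lincomb c' b = lincomb (fun i => a * c i + c' i) b.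
Proof.
rewrite /lincomb scaler_sumr -big_split; apply: eq_bigr => i _.
by rewrite scalerDl scalerA.
Qed.

Lemma lincomb_cat c b1 b2 :
  lincomb c (b1 ++ b2) = lincomb c b1 + lincomb (fun i => c (size b1 + i)%N) b2.
Proof.
rewrite /lincomb size_cat (big_cat_nat (n := size b1)) ?leq_addr //=; congr (_ + _).
  by apply: eq_big_nat => i /andP[_ ib]; rewrite nth_cat ib.
rewrite -{1}[size b1]add0n big_addn addKn; apply: eq_big_nat => i _.
by rewrite addnC nth_cat ltnNge leq_addr /= addKn.
Qed.

Lemma lincomb_cons c x b : lincomb c (x :: b) = c 0%N *: x + lincomb (fun i => c i.+1) b.
Proof. by rewrite /lincomb /= big_nat_recl. Qed.

Lemma eq_lincomb c c' b : (forall i, (i < size b)%N -> c i = c' i) -> lincomb c b = lincomb c' b.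
Proof. by move=> h; apply: eq_big_nat => i /andP[_ /h ->]. Qed.

Lemma lincomb_in L c b : subspace L -> (forall x, x \in b -> L x) -> L (lincomb c b).
Proof.
move=> [L0 Ll] hb; elim: b c hb => [|x b IH] c hb; first by rewrite /lincomb big_nil.
rewrite lincomb_cons; apply: Ll; first by apply: hb; rewrite inE eqxx.
by apply: IH => y yb; apply: hb; rewrite inE yb orbT.
Qed.

(** A family longer than the list that spans it has a coefficient matrix with more rows than
    columns; a nonzero vector of its left kernel is a dependence. *)
Lemma steinitz b b' : lfree b -> (forall x, x \in b -> exists c, x = lincomb c b') ->
  (size b <= size b')%N.
Proof.
move=> fb hb; rewrite leqNgt; apply/negP => lt.
have [C hC] : exists C : nat -> nat -> F, forall i, (i < size b)%N -> b`_i = lincomb (C i) b'.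
  elim: b hb {fb lt} => [|x b IH] hb; first by exists (fun _ _ => 0).
  have [|C hC] := IH; first by move=> y yb; apply: hb; rewrite inE yb orbT.
  have [c xE] := hb x (mem_head _ _).
  by exists (fun i => if i is j.+1 then C j else c) => -[|i] //= ib; apply: hC.
pose M := \matrix_(i < size b, j < size b') C i j.
have : kermx M != 0.
  rewrite -mxrank_eq0 mxrank_ker subn_eq0 -ltnNge.
  by apply: leq_ltn_trans lt; apply: rank_leq_col.
case/rowV0Pn => v /sub_kermxP vM v0; case/eqP: v0; apply/rowP => i; rewrite mxE.
have [c cE] : exists c : nat -> F, forall i : 'I_(size b), c i = v 0 i.
  exists (fun j => if insub j is Some i then v 0 i else 0) => j.
  by rewrite valK.
rewrite -cE; apply: (fb c) => //; rewrite /lincomb big_mkord.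
have -> : \sum_(i < size b) c i *: b`_i = \sum_(j < size b') (v *m M) 0 j *: b'`_j.
  under [RHS]eq_bigr do rewrite mxE scaler_suml.
  rewrite exchange_big; apply: eq_bigr => k _.
  rewrite hC // /lincomb big_mkord scaler_sumr; apply: eq_bigr => j _.
  by rewrite scalerA mxE cE.
by rewrite vM big1 // => j _; rewrite mxE scale0r.
Qed.

Lemma hasdim_uniq L d d' : hasdim L d -> hasdim L d' -> d = d'.
Proof.
move=> [b [<- hb fb sb]] [b' [<- hb' fb' sb']]; apply/eqP; rewrite eqn_leq.
by apply/andP; split; apply: steinitz => // x; [move/hb/sb' | move/hb'/sb].
Qed.

Lemma hasdim_iff L L' d : (forall x, L x <-> L' x) -> hasdim L d -> hasdim L' d.
Proof.
move=> LL' [b [sb hb fb hs]]; exists b; split=> // x; first by move/hb/LL'.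
by move/LL'/hs.
Qed.

(** A free family in L is extended as long as it does not span L; the exchange lemma bounds its size
    by that of b'. *)
Lemma hasdim_ex L b' : subspace L -> (forall x, L x -> exists c, x = lincomb c b') ->
  exists d, hasdim L d.
Proof.
move=> sL hL.
suff H N : forall b, (size b' - size b < N)%N -> (forall x, x \in b -> L x) -> lfree b ->
    exists d, hasdim L d.
  by apply: (H (size b').+1 [::]) => [|x|c _ i] /=; rewrite ?subn0 ?in_nil ?ltn0.
elim: N => // N IH b; rewrite ltnS => sz hb fb.
case: (classic (forall x, L x -> exists c, x = lincomb c b)) => [h|hn].
  by exists (size b), b.
have [x [Lx hx]] : exists x, L x /\ ~ exists c, x = lincomb c b.
  by have [x hx] := not_all_ex_not _ _ hn; exists x; apply: imply_to_and hx.
have fxb : lfree (x :: b).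
  move=> c; rewrite lincomb_cons => E.
  have c0 : c 0%N = 0.
    apply/eqP/negPn/negP => c0; case: hx; exists (fun i => - (c 0%N)^-1 * c i.+1 + 0).
    rewrite -lincomb_lin lincomb0 addr0; apply: (scalerI c0); rewrite scalerA mulrN divff //.
    by rewrite scaleN1r; apply/eqP; rewrite -addr_eq0 E.
  move: E; rewrite c0 scale0r add0r => /fb h [|i] //=; exact: h.
have hxb y : y \in x :: b -> L y by rewrite inE => /orP[/eqP ->|/hb].
have szx : (size (x :: b) <= size b')%N by apply: steinitz => // y /hxb/hL.
apply: (IH (x :: b)) => //; rewrite /= in szx *.
by rewrite subnS prednK ?subn_gt0.
Qed.

Lemma hasdim_add L L1 L2 d1 d2 : hasdim L1 d1 -> hasdim L2 d2 -> subspace L1 -> subspace L2 ->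
  (forall x, L x <-> exists x1 x2, [/\ L1 x1, L2 x2 & x = x1 + x2]) ->
  (forall x1 x2, L1 x1 -> L2 x2 -> x1 + x2 = 0 -> x2 = 0) -> hasdim L (d1 + d2).
Proof.
move=> [b1 [<- h1 f1 s1]] [b2 [<- h2 f2 s2]] sL1 sL2 LE ind.
exists (b1 ++ b2); split=> [||c|x].
- by rewrite size_cat.
- move=> x; rewrite mem_cat => /orP[/h1 hx|/h2 hx]; apply/LE.
    by exists x, 0; rewrite addr0; split=> //; case: sL2.
  by exists 0, x; rewrite add0r; split=> //; case: sL1.
- rewrite lincomb_cat => E.
  have E2 := ind _ _ (lincomb_in c sL1 h1) (lincomb_in _ sL2 h2) E.
  move: E; rewrite E2 addr0 => E1 i; rewrite size_cat => ib.
  case: (ltnP i (size b1)) => ib1; first exact: (f1 c E1).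
  have := f2 _ E2 (i - size b1)%N; rewrite /= subnKC //; apply.
  by rewrite ltn_subLR.
case/LE=> x1 [x2 [/s1[c1 ->] /s2[c2 ->] ->]].
exists (fun i => if (i < size b1)%N then c1 i else c2 (i - size b1)%N).
rewrite lincomb_cat; congr (_ + _); apply: eq_lincomb => i ib; rewrite ?ib //.
by rewrite ltnNge leq_addr /= addKn.
Qed.

Lemma hasdim_gt0 L d : hasdim L d -> (0 < d)%N <-> exists2 x, L x & x != 0.
Proof.
case=> b [<- hb fb sb]; split=> [b0|[x /sb[c ->] x0]].
  case: b b0 hb fb {sb} => [//|x b] _ hb fb; exists x; first by apply: hb; rewrite mem_head.
  apply/eqP => x0; have := fb (fun i => (i == 0%N)%:R) _ 0%N isT.
  rewrite lincomb_cons x0 scaler0 add0r lincomb0 => /(_ erefl)/eqP.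
  by rewrite oner_eq0.
by move: x0; rewrite lt0n; apply: contraNneq; rewrite /lincomb => ->; rewrite big_geq.
Qed.

End Dimension.

(** G is the graph of a partial linear map that reaches all of LW. Single-valuedness is asked only
    at 0, which suffices by linearity: preimages of a basis of LW are then free. *)
Lemma hasdim_image (F : fieldType) (V W : lmodType F) (LV : V -> Prop) (LW : W -> Prop)
    (G : V -> W -> Prop) d d' :
  hasdim LV d -> hasdim LW d' -> G 0 0 ->
  (forall c x y x' y', G x y -> G x' y' -> G (c *: x + x') (c *: y + y')) ->
  (forall y, LW y -> exists2 x, LV x & G x y) -> (forall y, G 0 y -> y = 0) -> (d' <= d)%N.
Proof.
move=> [b [<- hb fb sb]] [b' [<- hb' fb' sb']] G0 Gl Gs Gi.
have [a [sa ha Ga]] : exists a : seq V, [/\ size a = size b', forall x, x \in a -> LV x &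
    forall c, G (lincomb c a) (lincomb c b')].
  elim: b' hb' {fb' sb'} => [|y b' IH] hb'.
    by exists [::]; split=> // c; rewrite /lincomb !big_nil.
  have [|a [sa ha Ga]] := IH; first by move=> z zb; apply: hb'; rewrite inE zb orbT.
  have [x hx Gx] := Gs y (hb' y (mem_head _ _)).
  exists (x :: a); split=> [|z|c]; first by rewrite /= sa.
    by rewrite inE => /orP[/eqP ->|/ha].
  by rewrite !lincomb_cons; apply: Gl.
rewrite -sa; apply: steinitz => [c E i|x /ha/sb //].
by rewrite sa => ib; apply: (fb' c) => //; apply: Gi; rewrite -E.
Qed.

Section Counting.
Variable n : nat.
Local Notation deg := 'rV[int]_n.
Local Notation root := (deg * option nat)%type.
Implicit Types (d b : deg) (h : option nat) (r : root) (R : seq root).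

Definition below h (k : nat) : bool := if h is Some m then (k < m)%N else true.

(* cnt R d is the number of ways to write d as a sum of k_r copies of r.1 for
   r in R with k_r below the height r.2; k_r <= |tot d| is automatic when all
   tot r.1 are positive. *)
Fixpoint cnt R d : nat :=
  if R is r :: R' then
    (\sum_(k < `|tot d|%N.+1 | below r.2 k) cnt R' (d - r.1 *+ k))%N
  else d == 0.

Definition posR R : bool := all (fun r => 0 < tot r.1) R.

Lemma cnt_tot R d : posR R -> (0 < cnt R d)%N -> 0 <= tot d.
Proof.
elim: R d => [|r R IH] d /=; first by move=> _; rewrite lt0b => /eqP ->; rewrite tot0.
case/andP=> r0 R0; rewrite lt0n sum_nat_eq0 negb_forall => /existsP[k].
rewrite negb_imply -lt0n => /andP[_ /(IH _ R0)]; rewrite totB totMn subr_ge0.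
by apply: le_trans; rewrite mulrn_wge0 // ltW.
Qed.

(** Exponents above [tot d] contribute nothing, so the bound built into [cnt] may be replaced by any
    larger one. Comparing counts in different degrees requires a common bound. *)
Lemma cnt_cons N r R d : 0 < tot r.1 -> posR R -> tot d < N%:Z ->
  cnt (r :: R) d = (\sum_(k < N | below r.2 k) cnt R (d - r.1 *+ k))%N.
Proof.
move=> r0 R0; have widen N1 N2 : (N1 <= N2)%N -> tot d < N1%:Z ->
    (\sum_(k < N1 | below r.2 k) cnt R (d - r.1 *+ k))%N =
    (\sum_(k < N2 | below r.2 k) cnt R (d - r.1 *+ k))%N.
  move=> N12 dN; rewrite (big_ord_widen_cond N2 (fun k => below r.2 k) (fun k => cnt R (d - r.1 *+ k)) N12).
  rewrite big_mkcond [RHS]big_mkcond; apply: eq_bigr => k _ /=.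
  case: (below r.2 k) => //=; case: ltnP => // N1k.
  apply/eqP; rewrite eq_sym eqn0Ngt; apply/negP => /(cnt_tot R0).
  rewrite totB totMn subr_ge0 => hk.
  have : k%:Z <= tot r.1 *+ k by rewrite -mulr_natr natz ler_peMl // -gtz0_ge1.
  move=> /le_trans/(_ hk); rewrite leNgt => /negP; apply.
  by apply: lt_le_trans dN _; rewrite lez_nat.
move=> dN; rewrite [LHS]/=.
have dM : tot d < `|tot d|%N.+1%:Z by lia.
by case: (leqP N `|tot d|%N.+1) => [/widen ->|/ltnW/widen <-].
Qed.

Lemma cnt_swap r1 r2 R d : posR (r1 :: r2 :: R) -> cnt (r1 :: r2 :: R) d = cnt (r2 :: r1 :: R) d.
Proof.
case/and3P => p1 p2 pR; have [N dN] : exists N : nat, tot d < N%:Z by exists `|tot d|%N.+1; lia.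
have lt r k : 0 < tot r.1 -> tot (d - r.1 *+ k) < N%:Z.
  move=> r0; apply: le_lt_trans dN; rewrite totB totMn gerBl.
  by rewrite mulrn_wge0 // ltW.
have pR1 : posR (r1 :: R) by apply/andP.
have pR2 : posR (r2 :: R) by apply/andP.
rewrite (cnt_cons p1 pR2 dN) (cnt_cons p2 pR1 dN).
under eq_bigr do rewrite (cnt_cons p2 pR (lt _ _ p1)).
under [RHS]eq_bigr do rewrite (cnt_cons p1 pR (lt _ _ p2)).
rewrite exchange_big; apply: eq_bigr => k _; apply: eq_bigr => j _.
by rewrite addrAC.
Qed.

Lemma cnt_rem r R d : posR R -> r \in R -> cnt (r :: rem r R) d = cnt R d.
Proof.
elim: R d => // x R IH d pR; rewrite inE => /orP[/eqP <-|rR]; first by rewrite /= eqxx.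
case: (eqVneq x r) => [<-|xr]; first by rewrite /= eqxx.
have -> : rem r (x :: R) = x :: rem r R by rewrite /= (negbTE xr).
case/andP: (pR) => x0 R0; have r0 : 0 < tot r.1 := allP R0 r rR.
have prem : posR (rem r R) by apply/allP => y /mem_rem; apply: (allP R0).
rewrite cnt_swap; last by apply/and3P.
by apply: eq_bigr => k _; apply: IH.
Qed.

(** Counting uses only addition and the test for 0, apart from the range of the exponents;
    positivity on both sides provides a common range. *)
Lemma cnt_map (f : deg -> deg) R d : (forall x y, f (x - y) = f x - f y) ->
  (forall x, f x = 0 -> x = 0) -> posR R -> posR [seq (f r.1, r.2) | r <- R] ->
  cnt [seq (f r.1, r.2) | r <- R] (f d) = cnt R d.
Proof.
move=> fB f0; have f00 : f 0 = 0 by have := fB 0 0; rewrite !subrr.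
have fN x : f (- x) = - f x by rewrite -[- x]sub0r fB f00 sub0r.
have fD x y : f (x + y) = f x + f y by rewrite -{1}[y]opprK fB fN opprK.
have fM x m : f (x *+ m) = f x *+ m.
  by elim: m => [|m IH]; rewrite ?mulr0n // !mulrS fD IH.
elim: R d => [|r R IH] d /=; first by move=> _ _; congr nat_of_bool; apply/eqP/eqP => [/f0|->].
case/andP=> r0 R0 /andP[fr0 fR0].
have [N [dN fdN]] : exists N : nat, tot d < N%:Z /\ tot (f d) < N%:Z.
  by exists (`|tot d| + `|tot (f d)|)%N.+1; lia.
rewrite -/(cnt ((f r.1, r.2) :: [seq (f r.1, r.2) | r <- R]) (f d)) -/(cnt (r :: R) d).
rewrite (cnt_cons r0 R0 dN) (cnt_cons (r := (f r.1, r.2)) fr0 fR0 fdN); apply: eq_bigr => k _ /=.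
by rewrite -fM -fB IH.
Qed.

End Counting.

Section HardWords.
Variables (F : fieldType) (n : nat) (p : 'I_n -> 'I_n -> F).
Hypothesis hp : forall i j, p i j != 0.
Local Notation B := (nichols p).
Local Notation chi := (chi p).
Local Notation sl := (superletter p).
Local Notation gs := (@gsub F n p).
Implicit Types (x y z : B) (u v w : seq 'I_n) (us : seq (seq 'I_n)) (d e : 'rV[int]_n).

Lemma gsub_prod (P : seq 'I_n -> Prop) (l : seq (seq 'I_n)) : (forall w, w \in l -> P w) ->
  gs P (wdeg (flatten l)) (\prod_(w <- l) sl w).
Proof.
elim: l => [|w l IH] hl; first by rewrite big_nil /= wdeg_nil; apply: gsub1.
rewrite big_cons /= wdeg_cat; apply: gsub_mul; first by apply: hl; rewrite mem_head.
by apply: IH => v vl; apply: hl; rewrite inE vl orbT.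
Qed.

Lemma gsub_sumP (P : seq 'I_n -> Prop) d x : gs P d x <->
  exists r : seq (F * seq (seq 'I_n)),
    (forall t, t \in r -> wdeg (flatten t.2) = d /\ forall w, w \in t.2 -> P w) /\
    x = \sum_(t <- r) t.1 *: \prod_(w <- t.2) sl w.
Proof.
split=> [|[r [hr ->]]]; last first.
  elim: r hr => [|t r IH] hr; first by rewrite big_nil; apply: gsub0.
  rewrite big_cons; apply: gsub_lin; last by apply: IH => t' t'r; apply: hr; rewrite inE t'r orbT.
  by have [<- ht] := hr t (mem_head _ _); apply: gsub_prod.
elim=> {d x} [d||d c x z _ [r1 [h1 ->]] _ [r2 [h2 ->]]|d w x Pw _ [r [hr ->]]].
- by exists [::]; rewrite big_nil.
- exists [:: (1, [::])]; rewrite big_seq1 big_nil scale1r; split=> // t.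
  by rewrite inE => /eqP -> /=; rewrite wdeg_nil.
- exists ([seq (c * t.1, t.2) | t <- r1] ++ r2); split=> [t|].
    by rewrite mem_cat => /orP[/mapP[t' /h1 h ->]|/h2].
  rewrite big_cat big_map scaler_sumr; congr (_ + _); apply: eq_bigr => t _.
  by rewrite scalerA.
exists [seq (t.1, w :: t.2) | t <- r]; split=> [t /mapP[t' /hr[h1 h2] ->] /=|].
  by rewrite wdeg_cat h1; split=> // v; rewrite inE => /orP[/eqP ->|/h2].
rewrite big_map mulr_sumr; apply: eq_bigr => t _.
by rewrite big_cons scalerAr.
Qed.

Lemma hardP u : hard p u <-> lyndon u /\ ~ gs (gt_word u) (wdeg u) (sl u).
Proof.
rewrite /hard; split=> -[lu h]; split=> // h'; apply: h.
  have [r [hr E]] := (gsub_sumP _ _ _).1 h'; exists r; split=> // t /hr[h1 h2].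
  by split=> // w /h2[lw uw]; apply/andP.
apply/gsub_sumP; case: h' => r [hr E]; exists r; split=> // t /hr[h1 h2].
by split=> // w /h2/andP[].
Qed.

Lemma hard_lyndon u : hard p u -> lyndon u. Proof. by case. Qed.

Fixpoint words (m : nat) : seq (seq 'I_n) :=
  if m is m'.+1 then [::] :: [seq i :: w | i <- enum 'I_n, w <- words m'] else [:: [::]].

Lemma mem_words m w : (w \in words m) = (size w <= m)%N.
Proof.
elim: m w => [|m IH] [|i w] //=; rewrite inE /= ltnS -IH.
apply/allpairsP/idP => [[[j v] /= [_ hv [_ ->]]] //|hw].
by exists (i, w); rewrite mem_enum.
Qed.

(** A super-letter that is not hard is replaced by larger ones. This terminates because the words
    never get longer than w: the induction is on the number of words of bounded length above w. *)
Lemma superletter_hard w : lyndon w -> gs (fun v => hard p v /\ ~~ wlt v w) (wdeg w) (sl w).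
Proof.
suff H m N : forall w, (count (fun v => wlt w v) (words m) < N)%N -> (size w <= m)%N ->
    lyndon w -> gs (fun v => hard p v /\ ~~ wlt v w) (wdeg w) (sl w).
  exact: (H (size w) (count (fun v => wlt w v) (words (size w))).+1).
elim: N => // N IH {}w; rewrite ltnS => cw szw lw.
case: (classic (hard p w)) => hw; first by apply: gsub_letter; rewrite wltnn.
have /gsub_small : gs (gt_word w) (wdeg w) (sl w) by apply: NNPP => h; apply: hw; apply/hardP.
move=> /(_ (size w)); rewrite tot_wdeg => /(_ (lexx _)); apply: gsub_sub => v [[lv wv] szv].
have szvm := leq_trans szv szw.
apply: gsubW (IH v _ szvm lv) => [l [hl vl]|].
  by split=> //; apply: wle_trans vl; rewrite (wlt_asym wv).
apply: leq_trans cw; have vm : v \in words m by rewrite mem_words.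
elim: (words m) vm => // a l IHl; rewrite inE => /orP[/eqP <-|vl] /=.
  rewrite wltnn wv add0n add1n ltnS; apply: sub_count => a'; exact: wlt_trans.
have h1 : (wlt v a <= wlt w a)%N.
  by case: (boolP (wlt v a)) => // va; rewrite (wlt_trans wv va).
by rewrite -addnS leq_add // IHl.
Qed.

(* us lists, in increasing order, all hard words above its least element. *)
Definition hard_list us : Prop := [/\ forall u, u \in us -> hard p u, pairwise (@wlt n) us &
  forall u v, u \in us -> hard p v -> wlt u v -> v \in us].

Lemma hard_list_behead u us : hard_list (u :: us) -> hard_list us.
Proof.
case=> h1 /=/andP[/allP h2 h2'] h3; split=> // [v vus|v w vus hw vw].
  by apply: h1; rewrite inE vus orbT.
have uv := h2 v vus; have := h3 v w; rewrite !inE vus orbT => /(_ isT hw vw).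
by case/orP => // /eqP wu; move: (wlt_trans uv vw); rewrite wu wltnn.
Qed.

Lemma gsub_gt_list u us d x : hard_list (u :: us) ->
  gs (gt_word u) d x <-> gs (fun w => w \in us) d x.
Proof.
case=> h1 /=/andP[/allP h2 h2'] h3; split.
  apply: gsub_sub => w [lw uw]; apply: gsubW (superletter_hard lw) => v [hv wv].
  have uv := wlt_le_trans uw wv.
  have := h3 u v (mem_head _ _) hv uv; rewrite inE => /orP[/eqP vu|//].
  by rewrite vu wltnn in uv.
apply: gsubW => w wus; split; last exact: h2.
by apply: hard_lyndon; apply: h1; rewrite inE wus orbT.
Qed.

Lemma gsub_ge_list u us d x : hard_list (u :: us) ->
  gs (ge_word u) d x <-> gs (fun w => w \in u :: us) d x.
Proof.
case=> h1 /=/andP[/allP h2 h2'] h3; split.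
  apply: gsub_sub => w [lw uw]; apply: gsubW (superletter_hard lw) => v [hv wv].
  have := wle_trans uw wv; rewrite wltNge => /orP[/eqP <-|uv]; first exact: mem_head.
  exact: h3 (mem_head _ _) hv uv.
apply: gsubW => w wus; split; first by apply: hard_lyndon; apply: h1.
by move: wus; rewrite inE => /orP[/eqP ->|/h2/wlt_asym ->] //; rewrite wltnn.
Qed.

Lemma gsub_all us d x : (forall w, hard p w -> w \in us) -> homogeneous d x ->
  gs (fun w => w \in us) d x.
Proof.
move=> hus hx; elim/homog_ind: x / hx => [|c a b|w <-]; first exact: gsub0.
  exact: gsub_lin.
elim: w => [|i w IH]; first by rewrite nw_nil wdeg_nil; apply: gsub1.
rewrite nw_cons wdeg_cons; apply: gsubM => //; rewrite -superletter1 -wdeg1.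
by apply: gsubW (superletter_hard (lyndon1 i)) => v [/hus].
Qed.

Definition reducible u m : Prop :=
  psum (gs (gt_word u)) (sl u) (wdeg u) m (wdeg u *+ m) (sl u ^+ m).

(** The height that the PBW argument produces; [below_heightE] identifies it with the height of the
    theorem. *)
Definition height_spec u h : Prop :=
  if h is Some m then reducible u m /\ forall j, (j < m)%N -> ~ reducible u j
  else forall j, ~ reducible u j.

Lemma height_ex u : exists h, height_spec u h.
Proof.
case: (classic (exists m, reducible u m)) => [[m hm]|h]; last by exists None => j hj; apply: h; exists j.
elim/ltn_ind: m hm => m IH hm.
case: (classic (exists2 j, (j < m)%N & reducible u j)) => [[j jm rj]|h]; first exact: IH rj.
by exists (Some m); split=> // j jm rj; apply: h; exists j.
Qed.

Lemma heights_ex us : exists H : seq 'I_n -> option nat, forall u, u \in us -> height_spec u (H u).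
Proof.
elim: us => [|u us [H hH]]; first by exists (fun=> None).
have [h hu] := height_ex u; exists (fun v => if v == u then h else H v) => v.
by rewrite inE; case: eqP => [-> _|_ /hH].
Qed.

Lemma height_pos u m : height_spec u (Some m) -> (0 < m)%N.
Proof.
case: m => // -[[a [_ /eqP]]]; by rewrite expr0 big_ord0 oner_eq0.
Qed.

Lemma height_qinv u m : hard p u -> height_spec u (Some m) -> qinv_sum p u m = 0.
Proof.
move=> /hardP[lu hu] hs; have m0 := height_pos hs; case: hs => red nred.
exact (psum_qinv_sum hp lu m0 nred red hu).
Qed.

Lemma height_pind u h m : lyndon u -> height_spec u h -> (forall k, (k < m)%N -> below h k) ->
  pind (gs (gt_word u)) (sl u) (wdeg u) m.
Proof.
move=> lu hs hm; apply: (pind_superletter hp lu) => j jm; have := hm j jm.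
by case: h hs {hm} => [k [_ hk] /= /hk|h _]; last exact: h.
Qed.

Lemma height_span u h d x : lyndon u -> height_spec u h -> gs (ge_word u) d x ->
  exists m, (forall k, (k < m)%N -> below h k) /\
    psum (gs (gt_word u)) (sl u) (wdeg u) m d x.
Proof.
move=> lu hs hx; case: h hs => [m [red _]|_].
  by exists m; split=> //; apply: ge_psum.
by have [m hm] := ge_psum_ex hp lu hx; exists m.
Qed.

Lemma gsub_subspace P d : subspace (gs P d).
Proof. by split; [apply: gsub0|move=> c x y; apply: gsub_lin]. Qed.

End HardWords.

Section PsumDimension.
Variables (F : fieldType) (n : nat) (p : 'I_n -> 'I_n -> F).
Local Notation B := (nichols p).
Variables (L : 'rV[int]_n -> B -> Prop) (y : B) (b : 'rV[int]_n).
Hypothesis sL : forall d, subspace (L d).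
Hypothesis Ltot : forall d x, L d x -> x != 0 -> 0 <= tot d.
Hypothesis b0 : 0 < tot b.

Lemma psum_subspace m d : subspace (psum L y b m d).
Proof.
split; first by apply: psum0 => e; case: (sL e).
by move=> c x z; apply: psum_lin => e; case: (sL e).
Qed.

Lemma hasdim_psum (N : 'rV[int]_n -> nat) m d : (forall e, hasdim (L e) (N e)) ->
  pind L y b m -> hasdim (psum L y b m d) (\sum_(k < m) N (d - b *+ k)%R)%N.
Proof.
have L0 e : L e 0 by case: (sL e).
move=> hN; elim: m => [|m IH] ind.
  rewrite big_ord0; exists [::]; split=> // x [a [_ ->]].
  by exists (fun=> 0); rewrite big_ord0 lincomb0.
rewrite big_ord_recr /=.
have indm := pindW L0 (leqnSn m) ind.
pose L2 x := exists2 a, L (d - b *+ m) a & x = a * y ^+ m.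
apply: (@hasdim_add _ _ _ (psum L y b m d) L2 _ _ (IH indm)).
- have [s [<- hs fs ss]] := hN (d - b *+ m).
  exists [seq a * y ^+ m | a <- s]; split.
  + by rewrite size_map.
  + by move=> x /mapP[a /hs ha ->]; exists a.
  + have E c : lincomb c [seq a * y ^+ m | a <- s] = lincomb c s * y ^+ m.
      rewrite /lincomb size_map mulr_suml; apply: eq_big_nat => i /andP[_ si].
      by rewrite (nth_map 0) // scalerAl.
    move=> c; rewrite E size_map => E0; apply: fs.
    apply: (pind_top ind (d := d) (x := 0)); last by rewrite add0r.
      by apply: lincomb_in => // x /hs.
    exact: psum0.
  move=> x [a /ss[c ->] ->]; exists c.
  rewrite /lincomb size_map mulr_suml; apply: eq_big_nat => i /andP[_ si].
  by rewrite (nth_map 0) // scalerAl.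
- exact: psum_subspace.
- split; first by exists 0; rewrite ?mul0r.
  move=> c x z [a1 h1 ->] [a2 h2 ->]; exists (c *: a1 + a2); first by case: (sL (d - b *+ m)) => _; apply.
  by rewrite mulrDl scalerAl.
- move=> x; rewrite psumS; split=> [[a [x' [ha hx' ->]]]|[x1 [x2 [h1 [a ha ->] ->]]]].
    by exists x', (a * y ^+ m); split=> //; exists a.
  by exists a, x1.
move=> x1 x2 h1 [a ha ->] E; by rewrite (pind_top ind ha h1 E) mul0r.
Qed.

Lemma psum_high m M d x : (forall k, (m <= k)%N -> tot d < k%:Z) -> psum L y b M d x -> psum L y b m d x.
Proof.
have L0 e : L e 0 by case: (sL e).
move=> hm; elim: M x => [|M IH] x; first by case=> a [_ ->]; rewrite big_ord0; apply: psum0.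
case/psumS => a [x' [ha hx' ->]]; have {}hx' := IH _ hx'.
case: (leqP m M) => mM; last first.
  apply: psumD => // [e|]; first by case: (sL e).
  by apply: (psumW L0 mM); apply: psum_term.
suff -> : a = 0 by rewrite mul0r addr0.
apply/eqP/negPn/negP => /(Ltot ha); rewrite totB totMn subr_ge0 => h.
have : M%:Z <= tot b *+ M by rewrite -mulr_natr natz ler_peMl // -gtz0_ge1.
by move=> /le_trans/(_ h); rewrite leNgt hm.
Qed.

(** The independent powers of y below h multiply the Hilbert series of L by one factor. The sum may
    stop at any m above [tot d], since later coefficients would have negative degree. *)
Lemma hasdim_below (N : 'rV[int]_n -> nat) h m d : (forall e, hasdim (L e) (N e)) ->
  (forall m, (forall k, (k < m)%N -> below h k) -> pind L y b m) -> tot d < m%:Z ->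
  hasdim (fun x => exists m, (forall k, (k < m)%N -> below h k) /\ psum L y b m d x)
    (\sum_(k < m | below h k) N (d - b *+ k)%R)%N.
Proof.
have L0 e : L e 0 by case: (sL e).
move=> hN ind dm; pose M := if h is Some k then minn k m else m.
have MB k : (k < M)%N = (k < m)%N && below h k.
  by rewrite /M; case: (h) => [j|] /=; rewrite ?andbT // leq_min andbC.
have -> : (\sum_(k < m | below h k) N (d - b *+ k)%R)%N = (\sum_(k < M) N (d - b *+ k)%R)%N.
  have Mm : (M <= m)%N by rewrite /M; case: (h) => [j|] //; rewrite geq_minr.
  rewrite (big_ord_widen m (fun k => N (d - b *+ k)) Mm); apply: eq_bigl => k.
  by rewrite MB ltn_ord.
apply: hasdim_iff (hasdim_psum d hN (ind M _)) => [x|k]; last by rewrite MB => /andP[].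
split=> [hx|[m' [hm' hx]]]; first by exists M; split=> // k; rewrite MB => /andP[].
case: (leqP m' M) => m'M; first exact: psumW hx.
have mM : (m <= M)%N by move: (MB M); rewrite ltnn (hm' _ m'M) andbT ltnNge => /esym/negbFE.
apply: psum_high hx => k Mk; apply: lt_le_trans dm _.
by rewrite lez_nat (leq_trans mM Mk).
Qed.

End PsumDimension.

Section FiniteCombinations.
Variables (F : fieldType) (V : lmodType F) (I : eqType) (K : I -> Prop) (b : I -> V).

(** This and [indep] are the spanning and independence clauses of [is_basis]. *)
Definition fincomb (x : V) : Prop := exists (r : seq I) (c : I -> F),
  (forall k, k \in r -> K k) /\ x = \sum_(k <- r) c k *: b k.

Definition indep : Prop := forall (r : seq I) (c : I -> F), uniq r ->
  (forall k, k \in r -> K k) -> \sum_(k <- r) c k *: b k = 0 -> forall k, k \in r -> c k = 0.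

Lemma fincomb_uniq x : fincomb x -> exists (r : seq I) (c : I -> F),
  [/\ uniq r, forall k, k \in r -> K k & x = \sum_(k <- r) c k *: b k].
Proof.
case=> r [c [hr ->]]; elim: r hr => [|k r IH] hr; first by exists [::], c; rewrite big_nil.
have [|r' [c' [ur' hr' E]]] := IH; first by move=> j jr; apply: hr; rewrite inE jr orbT.
rewrite big_cons E; case: (boolP (k \in r')) => kr'.
  exists r', (fun j => if j == k then c k + c' k else c' j); split=> //.
  rewrite (bigD1_seq k) //= [RHS](bigD1_seq k) //= eqxx addrA -scalerDl; congr (_ + _).
  by apply: eq_bigr => j /negbTE ->.
exists (k :: r'), (fun j => if j == k then c k else c' j); split=> /=.
- by rewrite kr'.
- by move=> j; rewrite inE => /orP[/eqP ->|/hr' //]; apply: hr; rewrite mem_head.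
rewrite big_cons eqxx; congr (_ + _); rewrite !big_seq; apply: eq_bigr => j jr'.
by case: eqP => // jk; rewrite jk (negbTE kr') in jr'.
Qed.

Lemma fincomb_lin a x y : fincomb x -> fincomb y -> fincomb (a *: x + y).
Proof.
move=> /fincomb_uniq[r1 [c1 [u1 h1 ->]]] /fincomb_uniq[r2 [c2 [u2 h2 ->]]].
have widen r c : uniq r -> {subset r <= undup (r1 ++ r2)} ->
    \sum_(k <- r) c k *: b k = \sum_(k <- undup (r1 ++ r2)) (if k \in r then c k else 0) *: b k.
  move=> ur sr; have pr : perm_eq r [seq k <- undup (r1 ++ r2) | k \in r].
    apply: uniq_perm; rewrite ?filter_uniq ?undup_uniq // => k.
    by rewrite mem_filter; case: (boolP (k \in r)) => //= /sr ->.
  rewrite {1}(perm_big _ pr) big_filter big_mkcond; apply: eq_bigr => k _.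
  by case: ifP; rewrite ?scale0r.
rewrite (widen r1) //; last by move=> k kr; rewrite mem_undup mem_cat kr.
rewrite (widen r2) //; last by move=> k kr; rewrite mem_undup mem_cat kr orbT.
exists (undup (r1 ++ r2)),
  (fun k => a * (if k \in r1 then c1 k else 0) + (if k \in r2 then c2 k else 0)); split=> [k|].
  by rewrite mem_undup mem_cat => /orP[/h1|/h2].
by rewrite scaler_sumr -big_split; apply: eq_bigr => k _; rewrite scalerDl scalerA.
Qed.

Lemma fincomb0 : fincomb 0.
Proof. by exists [::], (fun=> 0); rewrite big_nil. Qed.

Lemma fincomb_in k : K k -> fincomb (b k).
Proof.
move=> Kk; exists [:: k], (fun=> 1); rewrite big_seq1 scale1r; split=> // j.
by rewrite inE => /eqP ->.
Qed.

Lemma fincomb_sum (J : Type) (s : seq J) (P : pred J) (f : J -> V) :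
  (forall j, P j -> fincomb (f j)) -> fincomb (\sum_(j <- s | P j) f j).
Proof.
move=> h; elim/big_ind: _ => [|x y hx hy|j /h //]; first exact: fincomb0.
by rewrite -[x]scale1r; apply: fincomb_lin.
Qed.

End FiniteCombinations.

Section PBWBasis.
Variables (F : fieldType) (n : nat) (p : 'I_n -> 'I_n -> F).
Hypothesis hp : forall i j, p i j != 0.
Local Notation B := (nichols p).
Local Notation chi := (chi p).
Local Notation sl := (superletter p).
Local Notation gs := (@gsub F n p).
Variable H : seq 'I_n -> option nat.
Implicit Types (x y z : B) (u v w : seq 'I_n) (us : seq (seq 'I_n)) (d e : 'rV[int]_n).
Implicit Types (ks : seq nat).

Definition pbw_roots us : seq ('rV[int]_n * option nat) := [seq (wdeg u, H u) | u <- us].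

Lemma gsub_nil (P : seq 'I_n -> Prop) d x : (forall w, ~ P w) -> gs P d x ->
  x = 0 \/ d = 0 /\ exists c : F, x = c *: 1.
Proof.
move=> hP; elim=> {d x} [d||d c x z _ [->|[d0 [c1 ->]]] _ [->|[d0' [c2 ->]]]|d w x /hP //].
- by left.
- by right; split=> //; exists 1; rewrite scale1r.
- by left; rewrite scaler0 addr0.
- by right; split=> //; exists c2; rewrite scaler0 add0r.
- by right; split=> //; exists (c * c1); rewrite addr0 scalerA.
by right; split=> //; exists (c * c1 + c2); rewrite scalerA scalerDl.
Qed.

Lemma pbw_dim us d : hard_list p us -> (forall u, u \in us -> height_spec p u (H u)) ->
  hasdim (gs (fun w => w \in us) d) (cnt (pbw_roots us) d).
Proof.
elim: us d => [|u us IH] d hus hH.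
  have h0 x : gs (fun w => w \in [::]) d x -> x = 0 \/ d = 0 /\ exists c : F, x = c *: 1.
    by apply: gsub_nil.
  rewrite /=; move: h0; case: eqP => [->|d0] h0.
    exists [:: 1]; split=> // [x|c|x].
    - by rewrite inE => /eqP ->; apply: gsub1.
    - rewrite lincomb_cons lincomb_nil addr0 => /eqP; rewrite scaler_eq0 oner_eq0 orbF.
      by move=> /eqP c0 [|i].
    case/h0=> [->|[_ [c ->]]]; first by exists (fun=> 0); rewrite lincomb0.
    by exists (fun=> c); rewrite lincomb_cons lincomb_nil addr0.
  exists [::]; split=> // x; case/h0=> [->|[/d0 //]].
  by exists (fun=> 0); rewrite lincomb0.
have hus' := hard_list_behead hus.
have lu : lyndon u by case: hus => h _ _; case: (h u (mem_head _ _)).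
have hu := hH u (mem_head _ _).
have IH' e : hasdim (gs (gt_word u) e) (cnt (pbw_roots us) e).
  apply: hasdim_iff (IH e hus' _) => [x|v vus]; first by have [h1 h2] := gsub_gt_list e x hus; split.
  by apply: hH; rewrite inE vus orbT.
apply: hasdim_iff (hasdim_below (b := wdeg u) (y := sl u) (L := gs (gt_word u)) (h := H u) _ _ _ IH' _ _) => //.
- move=> x; split=> [[m [_ hm]]|/(gsub_ge_list d x hus).2 hx].
    by apply/(gsub_ge_list d x hus); apply: psum_ge hm.
  exact: height_span hx.
- exact: gsub_subspace.
- by move=> e x hx x0; case: (gsub_tot hx) => // xE; rewrite xE eqxx in x0.
- by rewrite tot_wdeg ltz_nat lt0n size_eq0 lyndon_neq0.
- move=> m hm; exact: height_pind hu hm.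
lia.
Qed.

(** The list is increasing and its head goes to the right end, so larger words stand to the left, as
    in the theorem. *)
Fixpoint pbw us ks : B :=
  match us, ks with
  | u :: us', k :: ks' => pbw us' ks' * sl u ^+ k
  | _, _ => 1
  end.

Fixpoint pbw_deg us ks : 'rV[int]_n :=
  match us, ks with
  | u :: us', k :: ks' => pbw_deg us' ks' + wdeg u *+ k
  | _, _ => 0
  end.

Fixpoint pbw_adm us ks : bool :=
  match us, ks with
  | u :: us', k :: ks' => below (H u) k && pbw_adm us' ks'
  | [::], [::] => true
  | _, _ => false
  end.

Lemma pbw_gsub us ks : pbw_adm us ks -> gs (fun w => w \in us) (pbw_deg us ks) (pbw us ks).
Proof.
elim: us ks => [|u us IH] [|k ks] //= => [_|/andP[_ h]]; first exact: gsub1.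
apply: gsubM; first by apply: gsubW (IH _ h) => w wus; rewrite inE wus orbT.
elim: k => [|k IHk]; first exact: gsub1.
by rewrite exprS mulrS; apply: gsub_mul => //; rewrite inE eqxx.
Qed.

Lemma pbw_homog us ks : (forall u, u \in us -> lyndon u) -> pbw_adm us ks ->
  homogeneous (pbw_deg us ks) (pbw us ks).
Proof. by move=> lus /pbw_gsub; apply: gsub_homog. Qed.

Lemma pbw_span us d x : hard_list p us -> (forall u, u \in us -> height_spec p u (H u)) ->
  gs (fun w => w \in us) d x ->
  fincomb (fun ks => pbw_adm us ks /\ pbw_deg us ks = d) (pbw us) x.
Proof.
elim: us d x => [|u us IH] d x hus hH hx.
  have [|->|[-> [c ->]]] := gsub_nil _ hx => //; first exact: fincomb0.
  by rewrite -[_ *: 1]addr0; apply: fincomb_lin (fincomb0 _ _); apply: (@fincomb_in _ _ _ _ _ [::]).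
have hus' := hard_list_behead hus.
have lu : lyndon u by case: hus => h _ _; case: (h u (mem_head _ _)).
have hu := hH u (mem_head _ _).
have [m [hm [a [ha ->]]]] := height_span hp lu hu ((gsub_ge_list d x hus).2 hx).
apply: fincomb_sum => k _.
have [|r [c [hr ->]]] := IH _ (a k) hus' _ ((gsub_gt_list _ _ hus).1 (ha k)).
  by move=> v vus; apply: hH; rewrite inE vus orbT.
rewrite mulr_suml; rewrite big_seq; apply: fincomb_sum => ks /hr[h1 h2].
rewrite -scalerAl -[_ *: _]addr0; apply: fincomb_lin (fincomb0 _ _).
apply: (@fincomb_in _ _ _ _ _ (val k :: ks)); rewrite /= h1 hm ?ltn_ord //.
by rewrite h2 subrK.
Qed.

(** Within one degree, collecting the monomials by the exponent of the least letter turns a relation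
    into a power sum in that letter, whose coefficients vanish by [height_pind]. *)
Lemma pbw_indep us : hard_list p us -> (forall u, u \in us -> height_spec p u (H u)) ->
  indep (fun ks => pbw_adm us ks) (pbw us).
Proof.
move=> hus hH.
suff Hd d : indep (fun ks => pbw_adm us ks /\ pbw_deg us ks = d) (pbw us).
  move=> r c ur hr E ks ksr; set d := pbw_deg us ks.
  have lus u : u \in us -> lyndon u by case: hus => h _ _ /h[].
  have := congr1 (hproj d) E; rewrite linear0 linear_sum /= => {}E.
  apply: (Hd d [seq k <- r | pbw_deg us k == d] c) => [|k||].
  - by rewrite filter_uniq.
  - by rewrite mem_filter => /andP[/eqP kd /hr].
  - rewrite -[RHS]E big_filter big_mkcond /= !big_seq; apply: eq_bigr => k /hr hk.
    have hom := (homogP _ _).1 (pbw_homog lus hk).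
    by rewrite linearZ /= -hom hprojK eq_sym; case: ifP; rewrite ?scaler0 ?hom.
  by rewrite mem_filter eqxx.
elim: us d hus hH => [|u us IH] d hus hH r c ur hr E ks ksr.
  have rnil k : k \in r -> k = [::] by move=> /hr[]; case: k.
  move: E; rewrite (bigD1_seq ks) //= [X in _ + X]big1_seq ?addr0 => [/eqP|k /andP[kks kr]].
    by rewrite scaler_eq0 oner_eq0 orbF => /eqP.
  by rewrite (rnil _ kr) (rnil _ ksr) eqxx in kks.
have hus' := hard_list_behead hus.
have lu : lyndon u by case: hus => h _ _; case: (h u (mem_head _ _)).
have hu := hH u (mem_head _ _).
have consE k : k \in r -> k = head 0%N k :: behead k by move=> /hr[]; case: k.
have admr k : k \in r -> [/\ below (H u) (head 0%N k), pbw_adm us (behead k) &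
    pbw_deg us (behead k) = d - wdeg u *+ head 0%N k].
  by move=> /hr[]; case: k => //= k0 k' /andP[-> ->] <-; rewrite addrK.
(* If the height is infinite, the finitely many monomials of the relation still bound the
   exponents. *)
have [m [hm hr']] : exists m, (forall k, (k < m)%N -> below (H u) k) /\
    forall k, k \in r -> (head 0%N k < m)%N.
  case Hu: (H u) => [j|]; first by exists j; split=> // k /admr[]; rewrite Hu.
  exists (\max_(k <- r) head 0%N k).+1; split=> // k kr.
  by rewrite ltnS (big_rem k kr) leq_maxl.
pose a k := \sum_(ks <- r | head 0%N ks == k) c ks *: pbw us (behead ks).
have ha k : gs (gt_word u) (d - wdeg u *+ k) (a k).
  apply/(gsub_gt_list _ _ hus); rewrite /a big_seq_cond.
  elim/big_ind: _ => [|x y hx hy|ks' /andP[/admr[_ h1 h2] /eqP hk]].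
  - exact: gsub0.
  - exact: gsubD.
  by apply: gsubZ; rewrite -hk -h2; apply: pbw_gsub.
have Ea : \sum_(k < m) a k * sl u ^+ k = 0.
  rewrite -[RHS]E; under eq_bigr do rewrite /a mulr_suml big_mkcond.
  rewrite exchange_big [LHS]big_seq [RHS]big_seq; apply: eq_bigr => k kr.
  rewrite -big_mkcond (big_pred1 (Ordinal (hr' k kr))) /=.
    by rewrite -scalerAl; congr (_ *: _); case: (k) (consE k kr).
  by move=> j; rewrite /= -val_eqE eq_sym.
have := height_pind hp lu hu hm ha Ea (hr' ks ksr); rewrite /a -big_filter => Eks.
have [_ adm1 deg1] := admr ks ksr.
have := IH (d - wdeg u *+ head 0%N ks) hus' _
  [seq behead k | k <- r & head 0%N k == head 0%N ks] (fun k => c (head 0%N ks :: k)).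
rewrite [in c ks](consE ks ksr); apply.
- by move=> v vus; apply: hH; rewrite inE vus orbT.
- rewrite map_inj_in_uniq ?filter_uniq // => k1 k2.
  rewrite !mem_filter => /andP[/eqP h1 kr1] /andP[/eqP h2 kr2] hb.
  by rewrite (consE _ kr1) (consE _ kr2) h1 h2 hb.
- move=> k' /mapP[k]; rewrite mem_filter => /andP[/eqP hk kr] ->.
  by have [_ h1 h2] := admr k kr; rewrite -hk.
- rewrite big_map -[RHS]Eks !big_filter; rewrite [LHS]big_seq_cond [RHS]big_seq_cond.
  by apply: eq_bigr => k /andP[kr /eqP hk]; rewrite -hk -consE.
by apply/mapP; exists ks; rewrite // mem_filter eqxx.
Qed.

End PBWBasis.

(** The q-integer, written as a sum so that it also makes sense at q = 1, where it equals m. *)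
Definition qn (F : fieldType) (q : F) m : F := \sum_(k < m) q ^+ k.

(** * One letter x_i and the complementary subalgebra K *)

Section SmallestLetter.
Variables (F : fieldType) (n : nat) (p : 'I_n -> 'I_n -> F).
Hypothesis hp : forall i j, p i j != 0.
Local Notation B := (nichols p).
Local Notation chi := (chi p).
Variable i : 'I_n.
Local Notation x := (nx p i).
Local Notation q := (p i i).
Implicit Types (a b y : B) (j k : 'I_n) (d e : 'rV[int]_n) (m : nat).

Lemma degcast (P : 'rV[int]_n -> B -> Prop) d e a : P d a -> d = e -> P e a.
Proof. by move=> h <-. Qed.

(** With the inverse factor the letters x removed by [dL i] from the two products cancel, so [eop]
    preserves the kernel of [dL i]. *)
Definition eop d a : B := x * a - (chi d (ek i))^-1 *: (a * x).

(* zel j m, of degree zdeg j m, is the m-fold skew commutator of x = x_i with x_j. *)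
Definition zdeg j m : 'rV[int]_n := ek j + ek i *+ m.

Fixpoint zel j m : B := if m is m'.+1 then eop (zdeg j m') (zel j m') else nx p j.

(** The factor by which [dR i] takes [zel j m] to its predecessor ([dR_zel]); [dd j m] is the factor
    by which [dL j] takes it to x^m ([dL_zel]). *)
Definition cc j m : F := \sum_(k < m) (p i j * q ^+ k - (p j i * q ^+ k)^-1).
Definition dd j m : F := \prod_(k < m) (p i j - (p j i * q ^+ k)^-1).

Lemma ccS j m : cc j m.+1 = cc j m + (p i j * q ^+ m - (p j i * q ^+ m)^-1).
Proof. by rewrite /cc big_ord_recr. Qed.

Lemma chi_zdeg_i j m : chi (zdeg j m) (ek i) = p j i * q ^+ m.
Proof. by rewrite chiDl // chiMnl // !chi_ek. Qed.

Lemma chi_i_zdeg j m : chi (ek i) (zdeg j m) = p i j * q ^+ m.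
Proof. by rewrite chiDr // chiMnr // !chi_ek. Qed.

Lemma eop_homog d a : homogeneous d a -> homogeneous (d + ek i) (eop d a).
Proof.
move=> ha; apply: homogB; first by rewrite addrC; apply: homogM => //; apply: homog_nx.
by apply: homogZ; apply: homogM => //; apply: homog_nx.
Qed.

Lemma eopM d e a b : eop (d + e) (a * b) = eop d a * b + (chi d (ek i))^-1 *: (a * eop e b).
Proof.
have h1 := chi_neq0 hp d (ek i); have h2 := chi_neq0 hp e (ek i).
by rewrite /eop chiDl //; nring F (nichols p); field; rewrite ?h1 ?h2.
Qed.

Lemma eop_lin d c a b : eop d (c *: a + b) = c *: eop d a + eop d b.
Proof. by rewrite /eop; nring F (nichols p); ring. Qed.

Lemma eop0 d : eop d 0 = 0.
Proof. by rewrite /eop mulr0 mul0r scaler0 subrr. Qed.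

Lemma zelS j m : zel j m.+1 = eop (zdeg j m) (zel j m).
Proof. by []. Qed.

Lemma zdegS j m : zdeg j m.+1 = zdeg j m + ek i.
Proof. by rewrite /zdeg mulrSr addrA. Qed.

Lemma zel_homog j m : homogeneous (zdeg j m) (zel j m).
Proof.
elim: m => [|m IH]; first by rewrite /zdeg mulr0n addr0; apply: homog_nx.
by rewrite zdegS; apply: eop_homog.
Qed.

Lemma zdeg_neq0 j m : zdeg j m != 0.
Proof. by apply/eqP => /(congr1 (@tot n)); rewrite totD totMn !tot_ek tot0; lia. Qed.

Lemma dR_eop k d a : homogeneous d a -> dR k (eop d a) =
  x * dR k a - ((chi d (ek i))^-1 * p k i) *: (dR k a * x)
  + (i == k)%:R *: ((chi (ek k) d - (chi d (ek i))^-1) *: a).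
Proof.
move=> ha; rewrite /eop linearB linearZ /= (dRM hp k _ ha) (dRM hp k _ (homog_nx p i)) dR_nx chi_ek //.
have -> : (i == k)%:R = (i == k)%:R *: 1 :> B by rewrite scaler_nat.
by nring F (nichols p); ring.
Qed.

Lemma dR_zel j k m : j != i -> dR k (zel j m.+1) = (i == k)%:R *: (cc j m.+1 *: zel j m).
Proof.
move=> ji; elim: m k => [|m IH] k.
  rewrite zelS (dR_eop k (zel_homog j 0)) /= dR_nx chi_zdeg_i.
  rewrite /zdeg mulr0n addr0 expr0 mulr1 chi_ek // /cc big_ord1 expr0 !mulr1.
  case: (eqVneq j k) => [<-|jk]; last first.
    rewrite mulr0n mulr0 mul0r scaler0 subrr add0r.
    by case: (eqVneq i k) => [<-|ik] //; rewrite !scale0r.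
  by rewrite mulr1n mulr1 mul1r mulVf // scale1r subrr add0r eq_sym (negbTE ji) !scale0r.
rewrite zelS (dR_eop k (zel_homog j m.+1)) IH.
case: (eqVneq i k) => [<-|ik]; last by rewrite !(scale0r, mulr0, mul0r, scaler0, subrr, addr0).
rewrite !scale1r chi_zdeg_i chi_i_zdeg [cc j m.+2]ccS [RHS]scalerDl; congr (_ + _).
rewrite zelS; move: (zel j m) => z; rewrite /eop chi_zdeg_i !exprS.
have h1 := hp j i; have h2 := hp i i; have h3 : q ^+ m != 0 by rewrite expf_neq0.
by nring F (nichols p); field; rewrite ?h1 ?h2 ?h3.
Qed.

Lemma dL_eop k d a : homogeneous d a -> dL k (eop d a) =
  p i k *: (x * dL k a) - (chi d (ek i))^-1 *: (dL k a * x)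
  + (i == k)%:R *: ((1 - (chi d (ek i))^-1 * chi d (ek k)) *: a).
Proof.
move=> ha; rewrite /eop linearB linearZ /= (dLM hp k _ ha) (dLM hp k _ (homog_nx p i)) dL_nx chi_ek //.
have -> : (i == k)%:R = (i == k)%:R *: 1 :> B by rewrite scaler_nat.
by nring F (nichols p); ring.
Qed.

Lemma dL_zel j k m : j != i -> dL k (zel j m) = (j == k)%:R *: (dd j m *: x ^+ m).
Proof.
move=> ji; elim: m => [|m IH].
  by rewrite /= dL_nx /dd big_ord0 expr0 scale1r scaler_nat.
rewrite zelS (dL_eop k (zel_homog j m)) IH.
case: (eqVneq i k) => [<-|ik].
  rewrite (negbTE ji) mulVf ?chi_neq0 // subrr scale0r.
  by rewrite !(scale0r, mulr0, mul0r, scaler0, subrr, addr0).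
rewrite scale0r addr0; case: eqP => [<-|]; last first.
  by rewrite !(scale0r, mulr0, mul0r, scaler0, subrr, addr0).
rewrite !scale1r chi_zdeg_i [dd j m.+1]big_ord_recr /= -/(dd j m) exprS.
by rewrite -!scalerAr -!scalerAl -exprSr -exprS !scalerA -scalerBl; congr (_ *: _); ring.
Qed.

(* gK d: the component of degree d of the subalgebra K generated by the zel j m, j != i. *)
Inductive gK : 'rV[int]_n -> B -> Prop :=
| gK0 d : gK d 0
| gK1 : gK 0 1
| gK_lin d c a b : gK d a -> gK d b -> gK d (c *: a + b)
| gK_mul d a j m : j != i -> gK d a -> gK (d + zdeg j m) (a * zel j m).

Lemma gK_subspace d : subspace (gK d).
Proof. by split; [apply: gK0 | move=> c a b; apply: gK_lin]. Qed.

Lemma gKZ d c a : gK d a -> gK d (c *: a).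
Proof. by move=> ha; rewrite -[_ *: _]addr0; apply: gK_lin => //; apply: gK0. Qed.

Lemma gKD d a b : gK d a -> gK d b -> gK d (a + b).
Proof. by move=> ha hb; rewrite -[a]scale1r; apply: gK_lin. Qed.

Lemma gKM d e a b : gK d a -> gK e b -> gK (d + e) (a * b).
Proof.
move=> ha; elim=> {e b} [e||e c b b' _ IH _ IH'|e b j m ji _ IH].
- by rewrite mulr0; apply: gK0.
- by rewrite mulr1 addr0.
- by rewrite mulrDr -scalerAr; apply: gK_lin.
by rewrite mulrA addrA; apply: gK_mul.
Qed.

Lemma gK_zel j m : j != i -> gK (zdeg j m) (zel j m).
Proof. by move=> ji; rewrite -[zel j m]mul1r -[zdeg j m]add0r; apply: gK_mul => //; apply: gK1. Qed.

Lemma gK_homog d a : gK d a -> homogeneous d a.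
Proof.
elim=> {d a} [d||d c a b _ ha _ hb|d a j m ji _ ha].
- exact: homog0.
- exact: homog1.
- exact: homog_lin.
by apply: homogM => //; apply: zel_homog.
Qed.

Lemma gK_dL d a : gK d a -> dL i a = 0.
Proof.
elim=> {d a} [d||d c a b _ ha _ hb|d a j m ji ga ha].
- by rewrite linear0.
- by rewrite dL1.
- by rewrite linearP /= ha hb scaler0 addr0.
rewrite (dLM hp i _ (gK_homog ga)) ha dL_zel // (negbTE ji).
by rewrite mul0r scale0r mulr0 scaler0 addr0.
Qed.

(** [eop] is a skew derivation that sends each generator to the next one. Consequently x can be
    moved to the right of an element of K at the cost of another element of K. *)
Lemma gK_eop d a : gK d a -> gK (d + ek i) (eop d a).
Proof.
elim=> {d a} [d||d c a b _ ha _ hb|d a j m ji ga ha].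
- by rewrite eop0; apply: gK0.
- by rewrite /eop chi0l // invr1 scale1r mulr1 mul1r subrr; apply: gK0.
- by rewrite eop_lin; apply: gK_lin.
rewrite eopM; apply: gKD.
  by rewrite addrAC; apply: gK_mul.
by apply: gKZ; rewrite -addrA -zdegS; apply: gK_mul.
Qed.

Lemma gK_tot d a : gK d a -> a != 0 -> 0 <= tot d.
Proof.
move=> /gK_homog ha a0; have [w <-] := homog_word ha a0.
by rewrite tot_wdeg.
Qed.

Local Notation ps := (psum gK x (ek i)).

Let K0 d : gK d 0. Proof. exact: gK0. Qed.
Let Klin d (c : F) a b : gK d a -> gK d b -> gK d (c *: a + b). Proof. exact: gK_lin. Qed.

Lemma psumK_mull m d e a y : gK e a -> ps m d y -> ps m (e + d) (a * y).
Proof.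
move=> ha [f [hf ->]]; exists (fun l => a * f l); split=> [l|].
  by rewrite -addrA; apply: gKM.
by rewrite mulr_sumr; apply: eq_bigr => l _; rewrite mulrA.
Qed.

Lemma x_comm d a : x * a = (chi d (ek i))^-1 *: (a * x) + eop d a.
Proof. by rewrite /eop addrC subrK. Qed.

Lemma psumK_x m d y : ps m d y -> ps m.+1 (ek i + d) (x * y).
Proof.
elim: m y => [|m IH] y.
  by case=> f [_ ->]; rewrite big_ord0 mulr0; apply: psum0.
case/psumS => a [y' [ha hy' ->]]; rewrite mulrDr; apply: psumD => //.
  by apply: (psumW K0 (leqnSn m.+1)); apply: IH.
rewrite mulrA (x_comm (d - ek i *+ m)) mulrDl -scalerAl -mulrA -exprS.
apply: psumD => //.
  by apply: psumZ => //; apply: psum_term => //; apply: degcast ha _; degring.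
apply: (psumW K0 (leqnSn m.+1)); apply: psum_term => //.
by apply: degcast (gK_eop ha) _; degring.
Qed.

Lemma psumK_all d y : homogeneous d y -> exists m, ps m d y.
Proof.
move=> hy; elim/homog_ind: y / hy => [|c a b [m1 h1] [m2 h2]|w <-].
- by exists 0%N; apply: psum0.
- exists (maxn m1 m2); apply: psum_lin => //.
    by apply: psumW h1; rewrite ?leq_maxl.
  by apply: psumW h2; rewrite ?leq_maxr.
elim: w => [|j w [m hm]].
  exists 1%N; rewrite nw_nil wdeg_nil -[1]mulr1 -[X in _ * X](expr0 x); apply: psum_term => //.
  by rewrite mulr0n subr0; apply: gK1.
rewrite nw_cons wdeg_cons; case: (eqVneq j i) => [->|ji]; first by exists m.+1; apply: psumK_x.
exists m; apply: psumK_mull hm; have := gK_zel 0 ji.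
by rewrite /zdeg mulr0n addr0.
Qed.

Local Notation qnum := (qn q).

Lemma qnumS m : qnum m.+1 = 1 + q * qnum m.
Proof.
rewrite /qn big_ord_recl expr0 mulr_sumr; congr (_ + _).
by apply: eq_bigr => k _; rewrite lift0 exprS.
Qed.

Lemma dL_xpow k m : dL k (x ^+ m.+1) = (i == k)%:R *: (qnum m.+1 *: x ^+ m).
Proof.
elim: m => [|m IH].
  by rewrite expr1 dL_nx /qn big_ord1 !expr0 scale1r scaler_nat.
rewrite exprS dL_nxM // IH [qnum m.+2]qnumS; case: (eqVneq i k) => [<-|_].
  by rewrite !scale1r -scalerAr -exprS scalerDl scale1r scalerA.
by rewrite !scale0r mulr0 scaler0 addr0.
Qed.

Lemma xpow_homog m : homogeneous (ek i *+ m) (x ^+ m).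
Proof. by apply: homogX; apply: homog_nx. Qed.

Lemma ekMn_neq0 m : ek i *+ m.+1 != 0 :> 'rV[int]_n.
Proof. by apply/eqP => /(congr1 (@tot n)); rewrite totMn tot_ek tot0; lia. Qed.

Lemma xpow_eq0 m : qnum m.+1 = 0 -> x ^+ m.+1 = 0.
Proof.
move=> q0; apply: (dL_eq0 (xpow_homog m.+1) (ekMn_neq0 m)) => k.
by rewrite dL_xpow q0 scale0r scaler0.
Qed.

Lemma xpow_neq0 m : x ^+ m != 0 <-> forall l : nat, (l < m)%N -> qnum l.+1 != 0.
Proof.
split=> [x0 k km|].
  by apply: contraNneq x0 => /xpow_eq0 E; rewrite -(subnK km) exprD E mulr0.
elim: m => [|m IH] h; first by rewrite expr0 oner_eq0.
have xm : x ^+ m != 0 by apply: IH => k km; apply: h; apply: ltnW.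
apply: contraNneq xm => E; have := dL_xpow i m; rewrite E linear0 eqxx scale1r.
by move/esym/eqP; rewrite scaler_eq0 (negbTE (h m _)).
Qed.

Lemma dL_term d a m : gK d a ->
  dL i (a * x ^+ m.+1) = (chi d (ek i) * qnum m.+1) *: (a * x ^+ m).
Proof.
move=> ga; rewrite (dLM hp i _ (gK_homog ga)) (gK_dL ga) mul0r add0r dL_xpow eqxx scale1r.
by rewrite -scalerAr scalerA.
Qed.

(** [dL i] kills the coefficients, so it acts on a relation as a q-derivative in x. The
    differentiated relation is shorter, and the q-integers in it are nonzero as long as the powers
    of x are. *)
Lemma pindK m : x ^+ m.-1 != 0 -> pind gK x (ek i) m.
Proof.
elim: m => [|m IH] xm d a ha E k; first by rewrite ltn0.
have {}E' : \sum_(l < m) (chi (d - ek i *+ l.+1) (ek i) * qnum l.+1) *: (a l.+1 * x ^+ l) = 0.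
  have := congr1 (dL i) E; rewrite linear0 linear_sum big_ord_recl /=.
  rewrite expr0 mulr1 (gK_dL (ha 0%N)) add0r => {}E; rewrite -[RHS]E.
  by apply: eq_bigr => l _; rewrite -(dL_term _ (ha l.+1)).
rewrite /= in xm.
have am l : (l < m)%N -> a l.+1 = 0.
  move=> lm; have := IH _ (d - ek i) (fun l => (chi (d - ek i *+ l.+1) (ek i) * qnum l.+1) *: a l.+1) _ _ l lm.
  have xm' : x ^+ m.-1 != 0.
    by apply: contraNneq xm => h; case: (m) lm h => // m' _ /= h; rewrite exprS h mulr0.
  move=> /(_ xm') h; have : (chi (d - ek i *+ l.+1) (ek i) * qnum l.+1) *: a l.+1 = 0.
    apply: h => [l'|].
      by apply: gKZ; apply: degcast (ha l'.+1) _; degring.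
    by rewrite -[RHS]E'; apply: eq_bigr => l' _; rewrite scalerAl.
  move/eqP; rewrite scaler_eq0 mulf_eq0 (negbTE (chi_neq0 hp _ _)) /=.
  by rewrite (negbTE ((xpow_neq0 m).1 xm l lm)) => /eqP.
case: k => [_|k]; last by rewrite ltnS; apply: am.
move: E; rewrite big_ord_recl expr0 mulr1 big1 ?addr0 // => l _.
by rewrite lift0 am // mul0r.
Qed.

Definition xheight (h : option nat) : Prop :=
  if h is Some m then x ^+ m = 0 /\ (0 < m)%N /\ x ^+ m.-1 != 0 else forall m, x ^+ m != 0.

Lemma xheight_below h m : xheight h -> (x ^+ m != 0) = below h m.
Proof.
case: h => [l [xl [l0 xl']]|/= h] /=; last by rewrite h.
case: ltnP => ml; last by rewrite -(subnK ml) exprD xl mulr0 eqxx.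
apply: contraNneq xl' => xm; rewrite -(@subnK m l.-1) ?exprD ?xm ?mulr0 //.
by rewrite -ltnS prednK.
Qed.

Lemma xheight_ex : exists h, xheight h.
Proof.
case: (classic (exists m, x ^+ m == 0)) => [ex|h]; last first.
  by exists None => m; apply/negP => xm; apply: h; exists m.
case: (ex_minnP ex) => m /eqP xm min; exists (Some m).
case: m xm min => [|m] xm min; first by move/eqP: xm; rewrite expr0 oner_eq0.
by split=> //; split=> //; apply/negP => /min; rewrite ltnn.
Qed.

Lemma psumK_below h d y : xheight h -> homogeneous d y <->
  exists m, (forall l : nat, (l < m)%N -> below h l) /\ ps m d y.
Proof.
move=> hh; split=> [/psumK_all[m hm]|[m [_ [a [ha ->]]]]]; last first.
  elim/big_ind: _ => [|u v|k _]; [exact: homog0|exact: homogD|].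
  by rewrite -[d](subrK (ek i *+ k)); apply: homogM (gK_homog (ha k)) (xpow_homog k).
case: h hh => [l|] hh; last by exists m.
exists l; split=> //; elim: m y hm => [|m IH] y; first by case=> a [_ ->]; rewrite big_ord0; apply: psum0.
case/psumS => a [y' [ha hy' ->]]; apply: psumD => //; first exact: IH.
case: (ltnP m l) => ml; first by apply: (psumW K0 ml); apply: psum_term.
have := xheight_below m hh; rewrite /= ltnNge ml => /negbFE/eqP ->.
by rewrite mulr0; apply: psum0.
Qed.

(** The powers of x_i below its height form a basis of B(V) over K: they span by [psumK_below] and
    are independent by [pindK]. *)
Lemma hasdim_letter h (N : 'rV[int]_n -> nat) d m : xheight h -> (forall e, hasdim (gK e) (N e)) ->
  tot d < m%:Z ->
  hasdim (@homogeneous F n p d) (\sum_(k < m | below h k) N (d - ek i *+ k)%R)%N.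
Proof.
move=> hh hN dm; apply: hasdim_iff (hasdim_below (L := gK) (y := x) (b := ek i) (h := h) _ _ _ hN _ dm).
- by move=> y; have [h1 h2] := psumK_below d y hh; split.
- exact: gK_subspace.
- by move=> e a; apply: gK_tot.
- by rewrite tot_ek.
move=> [|m'] hm; first by move=> e a _ _ k.
by apply: pindK; rewrite (xheight_below _ hh) hm.
Qed.

End SmallestLetter.

(** * Reflections *)

Section Reflection.
Variables (F : fieldType) (n : nat) (i : 'I_n) (M : 'I_n -> nat).
Implicit Types (j k : 'I_n) (d e : 'rV[int]_n) (m : nat).

(* srefl e_i = - e_i and srefl e_j = e_j + M_j e_i; - M_j is the Cartan entry. *)
Definition srefl d : 'rV[int]_n :=
  \row_k (if k == i then \sum_(j | j != i) d 0 j *+ M j - d 0 i else d 0 k).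

Lemma sreflB d e : srefl (d - e) = srefl d - srefl e.
Proof.
apply/rowP => k; rewrite !mxE; case: eqP => // _.
have -> : \sum_(j | j != i) (d - e) 0 j *+ M j =
   \sum_(j | j != i) d 0 j *+ M j - \sum_(j | j != i) e 0 j *+ M j.
  by rewrite -sumrB; apply: eq_bigr => j _; rewrite !mxE mulrnBl.
by ring.
Qed.

Lemma srefl0 : srefl 0 = 0.
Proof. by have := sreflB 0 0; rewrite !subrr. Qed.

Lemma sreflN d : srefl (- d) = - srefl d.
Proof. by rewrite -[- d]sub0r sreflB srefl0 sub0r. Qed.

Lemma sreflD d e : srefl (d + e) = srefl d + srefl e.
Proof. by rewrite -{1}[e]opprK sreflB sreflN opprK. Qed.

Lemma sreflMn d m : srefl (d *+ m) = srefl d *+ m.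
Proof. by elim: m => [|m IH]; rewrite ?mulr0n ?srefl0 // !mulrS sreflD IH. Qed.

Lemma sreflMz d (z : int) : srefl (d *~ z) = srefl d *~ z.
Proof. by case: z => m; rewrite ?NegzE ?mulrNz ?sreflN -!pmulrn sreflMn. Qed.

Lemma sreflK : involutive srefl.
Proof.
move=> d; apply/rowP => k; rewrite !mxE; case: eqP => [->|//].
rewrite eqxx opprB addrCA.
have -> : \sum_(j | j != i) srefl d 0 j *+ M j = \sum_(j | j != i) d 0 j *+ M j.
  by apply: eq_bigr => j /negbTE ji; rewrite mxE ji.
by rewrite subrr addr0.
Qed.

Lemma srefl_ek_i : srefl (ek i) = - ek i.
Proof.
apply/rowP => k; rewrite !mxE !eqxx; case: (eqVneq k i) => [_|ki] //.
by rewrite big1 // => j /negbTE ji; rewrite mxE ji andbF mul0rn.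
Qed.

Lemma srefl_ek j : j != i -> srefl (ek j) = ek j + ek i *+ M j.
Proof.
move=> ji; apply/rowP => k; rewrite !(mxE, mulmxnE) !eqxx /=; case: (eqVneq k i) => [->|ki].
  rewrite (bigD1 j) //= big1 => [|l /andP[_ /negbTE lj]]; last by rewrite mxE lj andbF mul0rn.
  by rewrite !mxE !eqxx [i == j]eq_sym (negbTE ji) /= addr0 subr0 add0r.
by rewrite mul0rn addr0.
Qed.

Lemma srefl_zdeg j m : j != i -> (m <= M j)%N -> srefl (zdeg i j m) = zdeg i j (M j - m).
Proof.
move=> ji mM; rewrite /zdeg sreflD sreflMn srefl_ek_i srefl_ek // -{1}(subnK mM) mulrnDr.
by rewrite mulNrn addrA addrK.
Qed.

(* Transposed, because the reflection map grefl below is antimultiplicative. *)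
Definition prefl (p : 'I_n -> 'I_n -> F) j k : F := chi p (srefl (ek k)) (srefl (ek j)).

Lemma chiMzl (p : 'I_n -> 'I_n -> F) (hp : forall j k, p j k != 0) d e (z : int) :
  chi p (d *~ z) e = chi p d e ^ z.
Proof. by case: z => m; rewrite ?NegzE ?mulrNz ?chiNl // -!pmulrn chiMnl. Qed.

Lemma chiMzr (p : 'I_n -> 'I_n -> F) (hp : forall j k, p j k != 0) d e (z : int) :
  chi p d (e *~ z) = chi p d e ^ z.
Proof. by case: z => m; rewrite ?NegzE ?mulrNz ?chiNr // -!pmulrn chiMnr. Qed.

Lemma chi_prefl p (hp : forall j k, p j k != 0) d e :
  chi (prefl p) d e = chi p (srefl e) (srefl d).
Proof.
have sE a : srefl a = \sum_k srefl (ek k) *~ a 0 k.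
  rewrite {1}[a]row_ek; elim/big_ind2: _ => [|x x' y y' <- <-|k _]; rewrite ?srefl0 ?sreflD //.
  exact: sreflMz.
have suml (f : 'I_n -> 'rV[int]_n) v : chi p (\sum_k f k) v = \prod_k chi p (f k) v.
  by elim/big_ind2: _ => [|x x' y y' <- <-|k _]; rewrite ?chi0l ?chiDl.
have sumr (f : 'I_n -> 'rV[int]_n) v : chi p v (\sum_k f k) = \prod_k chi p v (f k).
  by elim/big_ind2: _ => [|x x' y y' <- <-|k _]; rewrite ?chi0r ?chiDr.
rewrite [srefl e]sE suml {1}/chi exchange_big; apply: eq_bigr => k _ /=.
rewrite chiMzl // [srefl d]sE sumr.
have -> : (\prod_k0 chi p (srefl (ek k)) (srefl (ek k0) *~ d 0 k0)) ^ e 0 k =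
   \prod_k0 (chi p (srefl (ek k)) (srefl (ek k0) *~ d 0 k0)) ^ e 0 k.
  elim/big_rec2: _ => [|j x y _ <-]; first by rewrite exp1rz.
  by rewrite expfzMl.
by apply: eq_bigr => j _; rewrite chiMzr // exprz_exp.
Qed.

Lemma prefl_neq0 p (hp : forall j k, p j k != 0) j k : prefl p j k != 0.
Proof. exact: chi_neq0. Qed.

Lemma preflK p (hp : forall j k, p j k != 0) j k : prefl (prefl p) j k = p j k.
Proof. by rewrite {1}/prefl chi_prefl // !sreflK chi_ek. Qed.

End Reflection.

Section CartanEntries.
Variables (F : fieldType) (n : nat) (i : 'I_n) (M : 'I_n -> nat).
Implicit Types (j k : 'I_n) (d e : 'rV[int]_n) (m l : nat).

(** A predicate on M rather than a function of p, because such an M exists only under a finiteness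
    condition, established in [cartan_ex]. *)
Definition cartan (p : 'I_n -> 'I_n -> F) : Prop :=
  forall j, j != i -> zel p i j (M j).+1 = 0 /\ zel p i j (M j) <> 0.

Section OneMatrix.
Variable p : 'I_n -> 'I_n -> F.
Hypothesis hp : forall j k, p j k != 0.
Local Notation x := (nx p i).

Lemma nx_neq0 j : nx p j != 0.
Proof.
apply/eqP => h; have := dR_nx p j j; rewrite h linear0 eqxx => /esym/eqP.
by rewrite oner_eq0.
Qed.

Lemma zelS_eq0 j m : j != i -> zel p i j m.+1 = 0 -> cc p i j m.+1 = 0 \/ zel p i j m = 0.
Proof.
move=> ji z0; have := dR_zel hp i m ji; rewrite z0 linear0 eqxx scale1r => /esym/eqP.
by rewrite scaler_eq0 => /orP[] /eqP; [left | right].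
Qed.

Lemma cc_zelS_eq0 j m : j != i -> cc p i j m.+1 = 0 -> zel p i j m.+1 = 0.
Proof.
move=> ji c0; apply: (dR_eq0 (zel_homog p i j m.+1) (zdeg_neq0 i j m.+1)) => k.
by rewrite (dR_zel hp k m ji) c0 scale0r scaler0.
Qed.

Lemma zel_zelS_eq0 j m : zel p i j m = 0 -> zel p i j m.+1 = 0.
Proof. by move=> z0; rewrite zelS z0 eop0. Qed.

Lemma zel_eq0W j m l : (m <= l)%N -> zel p i j m = 0 -> zel p i j l = 0.
Proof.
move=> ml z0; rewrite -(subnK ml); elim: (l - m)%N => [|r IH]; first by rewrite add0n.
by rewrite addSn; apply: zel_zelS_eq0.
Qed.

Hypothesis hM : cartan p.

Lemma zel_neq0 j m : j != i -> (m <= M j)%N -> zel p i j m <> 0.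
Proof. by move=> ji mM z0; have [_] := hM ji; apply; apply: zel_eq0W z0. Qed.

Lemma zel_gt0 j m : j != i -> (M j < m)%N -> zel p i j m = 0.
Proof. by move=> ji mM; have [z0 _] := hM ji; apply: zel_eq0W z0. Qed.

Lemma cc_neq0 j m : j != i -> (m < M j)%N -> cc p i j m.+1 != 0.
Proof. by move=> ji mM; apply/eqP => /(cc_zelS_eq0 ji); apply: zel_neq0. Qed.

Lemma cc_eq0 j : j != i -> cc p i j (M j).+1 = 0.
Proof. by move=> ji; have [/(zelS_eq0 ji)[//|z0]] := hM ji; case. Qed.

(** Among the left derivations only [dL j] can be nonzero on the nonzero element [zel p i j (M j)],
    and its value there is the product of these two factors. *)
Lemma dd_xpow_neq0 j : j != i -> dd p i j (M j) != 0 /\ x ^+ M j != 0.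
Proof.
move=> ji; apply/andP; rewrite -negb_or; apply/negP => h.
have [_] := hM ji; apply; apply: (dL_eq0 (zel_homog p i j (M j)) (zdeg_neq0 i j _)) => k.
by rewrite dL_zel //; case/orP: h => /eqP ->; rewrite ?scale0r ?scaler0.
Qed.

(** The summand of index k for the reflected matrix is the negative of the summand of index M j - k
    for p. Since all summands of p up to index M j add up to zero, the first m reflected ones add up
    to the complementary partial sum. *)
Lemma cc_prefl j m : j != i -> (m <= (M j).+1)%N ->
  cc (prefl i M p) i j m = cc p i j ((M j).+1 - m).
Proof.
move=> ji; elim: m => [|m IH] mM; first by rewrite subn0 cc_eq0 // /cc big_ord0.
rewrite ccS IH; last exact: ltnW.
rewrite subSS subSn // ccS -addrA -[RHS]addr0; congr (_ + _).
have qE : prefl i M p i i = p i i.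
  by rewrite /prefl srefl_ek_i chiNl // chiNr // invrK chi_ek.
have -> : prefl i M p i j = (p j i * p i i ^+ M j)^-1.
  by rewrite /prefl srefl_ek_i srefl_ek // chiNr // chiDl // chiMnl // !chi_ek.
have -> : prefl i M p j i = (p i j * p i i ^+ M j)^-1.
  by rewrite /prefl srefl_ek_i srefl_ek // chiNl // chiDr // chiMnr // !chi_ek.
have -> : p i i ^+ M j = p i i ^+ (M j - m) * p i i ^+ m by rewrite -exprD subnK.
have h1 := hp i j; have h2 := hp j i; have h3 : p i i ^+ m != 0 by rewrite expf_neq0.
have h4 : p i i ^+ (M j - m) != 0 by rewrite expf_neq0.
by rewrite qE; field; rewrite h1 h2 h3 h4 oner_eq0.
Qed.

End OneMatrix.

(** By [cc_prefl] the coefficients [cc] of the reflected matrix are those of p in reverse order, so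
    they too vanish first at index M j + 1. *)
Lemma cartan_prefl p : (forall j k, p j k != 0) -> cartan p -> cartan (prefl i M p).
Proof.
move=> hp hM j ji; have hp1 := prefl_neq0 i M hp.
split.
  apply: cc_zelS_eq0 => //; rewrite cc_prefl // subnn.
  by rewrite /cc big_ord0.
have : (M j <= M j)%N by [].
elim: {1 3}(M j) => [|m IH] mM; first by apply/eqP; apply: nx_neq0.
case/(zelS_eq0 hp1 ji) => [|z0]; last exact: (IH (ltnW mM) z0).
rewrite cc_prefl // ?subSS; last exact: ltnW.
rewrite -(subnSK mM); apply/eqP; apply: cc_neq0 => //.
by rewrite ltn_subrL /=; apply: leq_ltn_trans mM.
Qed.

End CartanEntries.

Section ReflectionMap.
Variables (F : fieldType) (n : nat) (p : 'I_n -> 'I_n -> F).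
Hypothesis hp : forall j k, p j k != 0.
Variables (i : 'I_n) (M : 'I_n -> nat).
Hypothesis hM : cartan i M p.
Implicit Types (j k : 'I_n) (d e : 'rV[int]_n) (m l : nat).
Local Notation p1 := (prefl i M p).
Local Notation s := (srefl i M).
Local Notation x := (nx p i).
Local Notation chi := (chi p).
Local Notation z := (zel p i).
Local Notation z1 := (zel p1 i).

Let hp1 : forall j k, p1 j k != 0. Proof. exact: prefl_neq0. Qed.

(** Normalised so that [dR i] sends the image of [z j m] to that of [z j m.+1]: each application
    contributes one factor [cc]. *)
Definition bb j m : F := \prod_(k < m) cc p1 i j (M j - k).

(* The graph of an antimultiplicative map: z j m goes to a multiple of the
   element z j (M j - m) built from the reflected matrix. *)
Inductive grefl : 'rV[int]_n -> nichols p -> nichols p1 -> Prop :=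
| grefl0 d : grefl d 0 0
| grefl1 : grefl 0 1 1
| grefl_lin d c a a' b b' :
    grefl d a b -> grefl d a' b' -> grefl d (c *: a + a') (c *: b + b')
| grefl_mul j m d a b : j != i -> (m <= M j)%N -> grefl d a b ->
    grefl (zdeg i j m + d) (z j m * a) (b * (bb j m *: z1 j (M j - m))).

Lemma grefl_cast d e a b : grefl d a b -> d = e -> grefl e a b.
Proof. by move=> h <-. Qed.

Lemma grefl_eq d a a' b b' : grefl d a b -> a = a' -> b = b' -> grefl d a' b'.
Proof. by move=> h <- <-. Qed.

Lemma greflZ d c a b : grefl d a b -> grefl d (c *: a) (c *: b).
Proof. by move=> h; rewrite -[c *: a]addr0 -[c *: b]addr0; apply: grefl_lin => //; apply: grefl0. Qed.

Lemma greflD d a a' b b' : grefl d a b -> grefl d a' b' -> grefl d (a + a') (b + b').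
Proof. by move=> h h'; rewrite -[a]scale1r -[b]scale1r; apply: grefl_lin. Qed.

Lemma grefl_gK d a b : grefl d a b -> gK i d a.
Proof.
elim=> {d a b} [d||d c a a' b b' _ h _ h'|j m d a b ji mM _ h].
- exact: gK0.
- exact: gK1.
- exact: gK_lin.
by apply: gKM => //; apply: gK_zel.
Qed.

Lemma grefl_homog d a b : grefl d a b -> homogeneous (s d) b.
Proof.
elim=> {d a b} [d||d c a a' b b' _ h _ h'|j m d a b ji mM _ h].
- exact: homog0.
- by rewrite srefl0; apply: homog1.
- exact: homog_lin.
rewrite sreflD addrC srefl_zdeg //; apply: homogM => //; apply: homogZ.
exact: zel_homog.
Qed.

Lemma grefl_tot d a b : grefl d a b -> 0 <= tot d \/ a = 0 /\ b = 0.
Proof.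
elim=> {d a b} [d||d c a a' b b' _ [h|[-> ->]] _ [h'|[-> ->]]|j m d a b ji mM _ [h|[-> ->]]];
  try by [left|right].
- by left; rewrite tot0.
- by right; rewrite !scaler0 !addr0.
- by left; rewrite totD /zdeg totD totMn !tot_ek; lia.
by right; rewrite mulr0 mul0r.
Qed.

Lemma grefl_deg0 d a b : grefl d a b -> d = 0 -> exists c : F, a = c *: 1 /\ b = c *: 1.
Proof.
elim=> {d a b} [d||d c a a' b b' _ h _ h'|j m d a b ji mM h _] d0.
- by exists 0; rewrite !scale0r.
- by exists 1; rewrite !scale1r.
- have [c1 [-> ->]] := h d0; have [c2 [-> ->]] := h' d0.
  by exists (c * c1 + c2); rewrite !scalerDl !scalerA.
case: (grefl_tot h) => [h'|[-> ->]]; last by exists 0; rewrite !scale0r mulr0 mul0r.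
by move/(congr1 (@tot n)): d0; rewrite totD /zdeg totD totMn !tot_ek tot0; lia.
Qed.

Lemma chi1_zdeg e j m : j != i -> (m <= M j)%N ->
  Defs.chi p1 e (zdeg i j (M j - m)) = chi (zdeg i j m) (s e).
Proof. by move=> ji mM; rewrite chi_prefl // -srefl_zdeg // sreflK. Qed.

(** Both operators are skew derivations, so it is enough to compare them on generators. At m = M j
    both sides vanish: the next generator is zero, and the image is a multiple of the letter j,
    which differs from i. *)
Lemma grefl_eop d a b : grefl d a b -> grefl (d + ek i) (eop i d a) (dR i b).
Proof.
elim=> {d a b} [d||d c a a' b b' _ h _ h'|j m d a b ji mM gab h].
- by rewrite eop0 linear0; apply: grefl0.
- by rewrite /eop chi0l // invr1 scale1r mulr1 mul1r subrr dR1; apply: grefl0.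
- by rewrite eop_lin linearP; apply: grefl_lin.
rewrite eopM // (dRM hp1 i _ (homogZ _ (zel_homog p1 i j (M j - m)))) chi1_zdeg //.
rewrite srefl_ek_i chiNr //; apply: greflD; last first.
  by apply: greflZ; rewrite -addrA; apply: grefl_mul.
move: mM; rewrite leq_eqVlt => /orP[/eqP mM|mM].
  have [z0 _] := hM ji; rewrite -zelS mM z0 mul0r subnn linearZ /= dR_nx.
  by rewrite (negbTE ji) scaler0 mulr0; apply: grefl0.
rewrite -zelS; apply: grefl_cast (grefl_eq (grefl_mul ji mM gab) erefl _) _; last first.
  by rewrite zdegS addrAC.
rewrite -(subnSK mM) linearZ /= dR_zel // eqxx scale1r (subnSK mM) scalerA /bb big_ord_recr /=.
by [].
Qed.

Local Notation ps := (psum (@gK F n p i) x (ek i)).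
Let K0 d : gK i d (0 : nichols p). Proof. exact: gK0. Qed.
Let Klin d (c : F) (a b : nichols p) : gK i d a -> gK i d b -> gK i d (c *: a + b).
Proof. exact: gK_lin. Qed.

Lemma xpow_comm d m (a : nichols p) : gK i d a -> exists2 L, ps m (ek i *+ m + d) L &
  x ^+ m * a = L + (chi d (ek i)) ^- m *: (a * x ^+ m).
Proof.
move=> ga; elim: m => [|m [L hL E]].
  by exists 0; [apply: psum0 | rewrite !expr0 invr1 scale1r mul1r mulr1 add0r].
exists (x * L + (chi d (ek i)) ^- m *: (eop i d a * x ^+ m)).
  apply: psumD => //; first by rewrite mulrS -addrA; apply: psumK_x.
  apply: psumZ => //; apply: psum_term => //; apply: degcast (gK_eop hp ga) _; degring.
have h0 := chi_neq0 hp d (ek i).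
have h1 : chi d (ek i) ^+ m != 0 by rewrite expf_neq0.
rewrite [x ^+ m.+1]exprS -mulrA E mulrDr -scalerAr [x * (a * _)]mulrA [x * a](x_comm i d) exprS.
by move: (eop i d a) => w; nring F (nichols p); field; rewrite ?h0 ?h1.
Qed.

(** The value is forced by the generator [z j (M j)]: its derivative [dL j] is [dd p i j (M j)]
    times a power of x, and its image is [bb j (M j)] times the letter j. *)
Definition kappa j : F := bb j (M j) / (chi (zdeg i j (M j)) (ek i *+ M j) * dd p i j (M j)).

(** [dL j] leads out of K, but only up to the power x^(M j). The coefficient of that top power,
    suitably scaled, is what corresponds to [dR j] on the image side. *)
Lemma grefl_dL j d a b : j != i -> grefl d a b -> exists a' L,
  [/\ gK i (d - ek j - ek i *+ M j) a', ps (M j) (d - ek j) L, dL j a = L + a' * x ^+ M j &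
      grefl (d - ek j - ek i *+ M j) ((chi d (ek i *+ M j) * kappa j) *: a') (dR j b)].
Proof.
move=> ji; elim=> {d a b} [d||d c a1 a2 b1 b2 _ [a1' [L1 [g1 h1 E1 G1]]] _ [a2' [L2 [g2 h2 E2 G2]]]|
  k m d a b ki mM gab [a' [L [g h E Gh]]]].
- exists 0, 0; rewrite !linear0 mul0r addr0; split=> //; [exact: psum0|exact: grefl0].
- exists 0, 0; rewrite dL1 dR1 mul0r addr0 scaler0.
  by split=> //; [exact: psum0|exact: grefl0].
- exists (c *: a1' + a2'), (c *: L1 + L2); split.
  + exact: gK_lin.
  + exact: psum_lin.
  + by rewrite linearP /= E1 E2 mulrDl -scalerAl scalerDr !addrA; congr (_ + _); rewrite addrAC.
  have -> : dR j (c *: b1 + b2) = c *: dR j b1 + dR j b2 by rewrite linearP.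
  apply: grefl_eq (grefl_lin c G1 G2) _ erefl.
  by nring F (nichols p); ring.
rewrite (dLM hp j _ (zel_homog p i k m)) dL_zel // E.
rewrite (dRM hp1 j _ (homogZ _ (zel_homog p1 i k (M k - m)))) chi1_zdeg // srefl_ek // [dR j (_ *: _)]linearZ /=.
have hz := gK_zel p m ki.
pose a2 := chi (zdeg i k m) (ek j) *: (z k m * a').
have ga2 : gK i (zdeg i k m + d - ek j - ek i *+ M j) a2.
  by apply: gKZ; apply: degcast (gKM hz g) _; rewrite !addrA.
pose L2 := chi (zdeg i k m) (ek j) *: (z k m * L).
have hL2 : ps (M j) (zdeg i k m + d - ek j) L2.
  by apply: psumZ => //; rewrite -addrA; apply: psumK_mull.
have G2 : grefl (zdeg i k m + d - ek j - ek i *+ M j)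
   ((chi (zdeg i k m + d) (ek i *+ M j) * kappa j) *: a2)
   (chi (zdeg i k m) (ek j + ek i *+ M j) *: (dR j b * (bb k m *: z1 k (M k - m)))).
  apply: grefl_cast (grefl_eq (greflZ (chi (zdeg i k m) (ek j + ek i *+ M j)) (grefl_mul ki mM Gh)) _ erefl) _; last by rewrite !addrA.
  by rewrite /a2 chiDr // chiDl // -scalerAr !scalerA; congr (_ *: _); ring.
(* Only [z j (M j)] contributes to the power x^(M j), and only its image is the bare letter j. For
   every other generator the extra term is zero on the image side and zero or of lower power on the
   source side. *)
case: (boolP ((k == j) && (m == M j))) => [/andP[/eqP kj /eqP mj]|ne]; last first.
  have dz1 : dR j (z1 k (M k - m)) = 0.
    case Emk: (M k - m)%N => [|l]; last first.
      by rewrite dR_zel // eq_sym (negbTE ji) scale0r.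
    rewrite dR_nx; case: eqP => // kj; move: ne; rewrite kj eqxx /=.
    by rewrite eqn_leq -{1}kj mM /= leqNgt -subn_gt0 -kj Emk.
  rewrite dz1 scaler0 mulr0 add0r.
  exists a2, ((k == j)%:R *: (dd p i k m *: x ^+ m * a) + L2); split=> //.
  - apply: psumD => //; case: (eqVneq k j) => [kj|kj]; last by rewrite scale0r; apply: psum0.
    have lt : (m < M j)%N by move: ne; rewrite kj eqxx /= ltn_neqAle => ->; rewrite -kj.
    rewrite scale1r -scalerAl; apply: psumZ => //.
    have [L' hL' ->] := xpow_comm m (grefl_gK gab).
    have dE : ek i *+ m + d = zdeg i k m + d - ek j by rewrite kj /zdeg; degring.
    apply: (psumW K0 lt); apply: psumD => //.
      by apply: (psumW K0 (leqnSn m)); rewrite -dE.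
    apply: psumZ => //; apply: psum_term => //; apply: degcast (grefl_gK gab) _.
    by rewrite -dE; degring.
  rewrite /L2 /a2; move: ((k == j)%:R : F) (x ^+ m) (z k m) => c xm zm.
  by nring F (nichols p); ring.
subst k m; rewrite eqxx scale1r subnn /= dR_nx eqxx.
have [dd0 x0] := dd_xpow_neq0 hp hM ji.
have [L' hL' E'] := xpow_comm (M j) (grefl_gK gab).
have dE : ek i *+ M j + d = zdeg i j (M j) + d - ek j by rewrite /zdeg; degring.
exists ((dd p i j (M j) * chi d (ek i) ^- M j) *: a + a2), (dd p i j (M j) *: L' + L2); split.
- apply: gKD => //; apply: gKZ; apply: degcast (grefl_gK gab) _.
  by rewrite /zdeg; degring.
- apply: psumD => //; apply: psumZ => //; by rewrite -dE.
- rewrite -scalerAl E' /L2 /a2.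
  by nring F (nichols p); ring.
rewrite scalerDr; apply: greflD; last by move: G2; rewrite subnn.
rewrite scalerA -[b * _]scalerAr mulr1.
have -> : chi (zdeg i j (M j) + d) (ek i *+ M j) * kappa j * (dd p i j (M j) * chi d (ek i) ^- M j)
    = bb j (M j).
  rewrite /kappa chiDl // [chi d (_ *+ _)]chiMnr //.
  have h1 := chi_neq0 hp (zdeg i j (M j)) (ek i *+ M j).
  have h2 : chi d (ek i) ^+ M j != 0 by rewrite expf_neq0 ?chi_neq0.
  by field; rewrite ?h1 ?h2 ?dd0.
apply: greflZ; apply: grefl_cast gab _.
by rewrite /zdeg; degring.
Qed.

(** This is well-definedness. If 0 is related to b, it is related to every [dR k b]: by [grefl_eop]
    for k = i, and otherwise by [grefl_dL], where independence of the powers of x makes the top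
    coefficient zero. Induction on the total degree of b finishes. *)
Lemma grefl_inj d b : grefl d 0 b -> b = 0.
Proof.
have [N] := ubnP `|tot (s d)|%N; elim: N => // N IH in d b *; rewrite ltnS => tN gb.
apply/eqP/negPn/negP => b0; have hb := grefl_homog gb.
have t0 : 0 <= tot (s d) by have [w <-] := homog_word hb b0; rewrite tot_wdeg.
case: (eqVneq (s d) 0) => [sd0|sd0].
  have d0 : d = 0 by rewrite -[d](sreflK i M) sd0 srefl0.
  have [c [/esym/eqP]] := grefl_deg0 gb d0; rewrite scaler_eq0 oner_eq0 orbF => /eqP ->.
  by rewrite scale0r => bE; rewrite bE eqxx in b0.
case/eqP: b0; apply: (dR_eq0 hb sd0) => k.
apply/eqP/negPn/negP => k0; have hk := dR_homog hp1 k hb.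
have tk : 0 <= tot (s d - ek k) by have [w <-] := homog_word hk k0; rewrite tot_wdeg.
rewrite totB tot_ek in tk; case/eqP: k0.
have tN' : (`|(tot (s d) - 1)%R| < N)%N by lia.
case: (eqVneq k i) => [ki|ki].
  have := grefl_eop gb; rewrite eop0 ki; apply: IH.
  by rewrite sreflD srefl_ek_i totB tot_ek.
have [a' [L [ga hL E Gh]]] := grefl_dL ki gb.
have a0 : a' = 0.
  have [_ xM] := dd_xpow_neq0 hp hM ki.
  apply: (pind_top (pindK hp (m := (M k).+1) xM) ga hL).
  by rewrite -E linear0.
move: Gh; rewrite a0 scaler0; apply: IH.
rewrite !sreflB sreflMn srefl_ek_i srefl_ek // mulNrn opprK opprD addrA subrK.
by rewrite totB tot_ek.
Qed.

Lemma grefl_surj d b : gK i d b -> exists a, grefl (s d) a b.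
Proof.
elim=> {d b} [d||d c a b _ [a1 h1] _ [a2 h2]|d b j m ji gb [a h]].
- by exists 0; apply: grefl0.
- by exists 1; rewrite srefl0; apply: grefl1.
- by exists (c *: a1 + a2); apply: grefl_lin.
have hM1 := cartan_prefl hp hM.
case: (leqP m (M j)) => mM; last first.
  by exists 0; rewrite (zel_gt0 hM1) // mulr0; apply: grefl0.
have mM' := leq_subr m (M j).
have b0 : bb j (M j - m) != 0.
  apply/prodf_neq0 => -[k /= km] _; have := cc_neq0 hp1 hM1 ji (m := M j - k.+1).
  by rewrite subnSK; [apply|]; lia.
exists ((bb j (M j - m))^-1 *: (z j (M j - m) * a)).
have := greflZ (bb j (M j - m))^-1 (grefl_mul ji mM' h); rewrite subKn // => h'.
apply: grefl_cast (grefl_eq h' erefl _) _; first by rewrite -scalerAr scalerA mulVf // scale1r.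
by rewrite sreflD srefl_zdeg // addrC.
Qed.

Lemma hasdim_grefl d N N1 : hasdim (@gK F n p i d) N -> hasdim (@gK F n p1 i (s d)) N1 ->
  (N1 <= N)%N.
Proof.
move=> h h1; apply: (hasdim_image h h1 (G := grefl d)).
- exact: grefl0.
- by move=> c a b a' b'; apply: grefl_lin.
- move=> b /grefl_surj[a]; rewrite sreflK => g; exists a => //; exact: grefl_gK g.
exact: grefl_inj.
Qed.

End ReflectionMap.

(** [hasdim_grefl] is used in both directions: the reflected matrix satisfies [cartan] with the same
    M and reflects back to p. *)
Lemma hasdim_prefl (F : fieldType) (n : nat) (p : 'I_n -> 'I_n -> F)
    (hp : forall j k, p j k != 0) (i : 'I_n) (M : 'I_n -> nat) (hM : cartan i M p) d N N1 :
  hasdim (@gK F n p i d) N -> hasdim (@gK F n (prefl i M p) i (srefl i M d)) N1 -> N1 = N.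
Proof.
move=> h h1; apply/eqP; rewrite eqn_leq (hasdim_grefl hp hM h h1) /=.
have := hasdim_grefl (prefl_neq0 i M hp) (cartan_prefl hp hM) h1.
have -> : prefl i M (prefl i M p) = p.
  by apply: functional_extensionality => j; apply: functional_extensionality => k; apply: preflK.
by rewrite sreflK; apply.
Qed.

(** * Roots and heights *)

Section SimpleRoots.
Variable n : nat.
Local Notation deg := 'rV[int]_n.
Local Notation root := (deg * option nat)%type.
Implicit Types (d b : deg) (h : option nat) (r : root) (R : seq root) (f : deg -> int).

Lemma funB_Mn f d (k : nat) : (forall x y, f (x - y) = f x - f y) -> f (d *+ k) = f d *+ k.
Proof.
move=> fB; have f0 : f 0 = 0 by have := fB 0 0; rewrite !subrr.
elim: k => [|k IH]; first by rewrite !mulr0n.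
by rewrite !mulrSr -{2}[d]opprK fB -[- d]sub0r fB f0 sub0r opprK IH.
Qed.

(** A sum of two or more roots has f-value at least 2. It is applied with the total degree, to find
    e_i among the roots, and with the total degree away from i, to find the degrees of the [zel]. *)
Lemma cnt_indecomposable f R d : (forall x y, f (x - y) = f x - f y) ->
  (forall r, r \in R -> 0 < f r.1) -> (0 < cnt R d)%N ->
  [\/ d = 0, d \in [seq r.1 | r <- R] | 2 <= f d].
Proof.
move=> fB; have f0 : f 0 = 0 by have := fB 0 0; rewrite !subrr.
elim: R d => [|r R IH] d fR /=; first by rewrite lt0b => /eqP ->; constructor.
rewrite lt0n sum_nat_eq0 negb_forall => /existsP[k].
rewrite negb_imply -lt0n => /andP[_ hk]; have fr := fR r (mem_head _ _).
have fdE : f d = f (d - r.1 *+ k) + f r.1 *+ k by rewrite fB funB_Mn // subrK.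
have kE : f r.1 *+ k = f r.1 * (k : nat)%:Z by rewrite -mulr_natr natz.
have {IH} := IH _ (fun r' hr' => fR r' (@mem_behead _ (r :: R) r' hr')) hk; rewrite kE in fdE.
case=> [|e0|].
- move/eqP; rewrite subr_eq0 => /eqP E; move: E fdE; case: (val k) => [|[|l]].
  + by rewrite mulr0n => -> _; constructor 1.
  + by rewrite mulr1n => -> _; constructor 2; rewrite mem_head.
  move=> E; rewrite E subrr f0 add0r => ->; constructor 3; nia.
- case/mapP: (e0) => r' r'R eE; have fr' := fR r' (@mem_behead _ (r :: R) r' r'R).
  move: e0 fdE eE; case: (val k) => [|l].
    by rewrite mulr0n subr0 => hd _ _; constructor 2; rewrite inE hd orbT.
  by move=> _ -> -> ; constructor 3; nia.
by move=> h; constructor 3; nia.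
Qed.

Lemma cnt_mem R r k : posR R -> r \in R -> (forall r', r' \in R -> below r'.2 0) ->
  below r.2 k -> (0 < cnt R (r.1 *+ k))%N.
Proof.
move=> pR rR h0 hk; rewrite -(cnt_rem _ pR rR).
have r0 : 0 < tot r.1 by apply: (allP pR).
have pR' : posR (rem r R) by apply/allP => y /mem_rem; apply: (allP pR).
have [N dN] : exists N : nat, tot (r.1 *+ k) < N%:Z by exists `|tot (r.1 *+ k)|%N.+1; lia.
have kN : (k < N)%N by move: dN; rewrite totMn -mulr_natr natz; nia.
rewrite (cnt_cons r0 pR' dN) (bigD1 (Ordinal kN)) //= subrr addn_gt0.
suff -> : (0 < cnt (rem r R) 0)%N by [].
have h0' r' : r' \in rem r R -> below r'.2 0 by move/mem_rem; apply: h0.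
elim: (rem r R) pR' h0' => [|r' R' IH] /=; first by rewrite eqxx.
case/andP=> [_ pR' h0'].
rewrite (bigD1 ord0) ?h0' ?mem_head //= addn_gt0 mulr0n subr0 IH //.
by move=> r2 hr2; apply: h0'; rewrite inE hr2 orbT.
Qed.

(** Cancels the factor of one letter from two Hilbert series: the summand k = 0 is the value at d,
    and all others have smaller total degree. *)
Lemma cnt_below_inj (f g : deg -> nat) b h : 0 < tot b -> below h 0 ->
  (forall d, tot d < 0 -> f d = 0%N /\ g d = 0%N) ->
  (forall d (m : nat), tot d < m%:Z -> (\sum_(k < m | below h k) f (d - b *+ k)%R)%N =
      (\sum_(k < m | below h k) g (d - b *+ k)%R)%N) ->
  forall d, f d = g d.
Proof.
move=> b0 h0 fg0 H d; have [N] := ubnP `|tot d|%N; elim: N => // N IH in d *; rewrite ltnS => dN.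
case: (ltP (tot d) 0) => [/fg0[-> ->] //|d0].
have := H d `|tot d|%N.+1; rewrite big_mkcond [RHS]big_mkcond !big_ord_recl !h0 mulr0n subr0.
move=> E; have {E}/eqP : (f d + \sum_(k < `|tot d|) (if below h (lift ord0 k) then f (d - b *+ lift ord0 k)%R else 0) =
   g d + \sum_(k < `|tot d|) (if below h (lift ord0 k) then f (d - b *+ lift ord0 k)%R else 0))%N.
  rewrite E; last by lia.
  congr addn; apply: eq_bigr => k _; case: ifP => // _.
  have hk : tot (d - b *+ lift ord0 k) = tot d - tot b * k.+1%:Z.
    by rewrite totB totMn -mulr_natr natz lift0.
  case: (ltP (tot (d - b *+ lift ord0 k)) 0) => [/fg0[-> ->] //|h'].
  apply/esym/IH; move: h'; rewrite hk; nia.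
by rewrite eqn_add2r => /eqP.
Qed.

End SimpleRoots.

Section Rays.
Variables (F : fieldType) (n : nat).
Implicit Types (p : 'I_n -> 'I_n -> F) (i j : 'I_n) (d e : 'rV[int]_n) (m l k : nat).
Local Notation root := ('rV[int]_n * option nat)%type.
Implicit Types (r : root) (R : seq root) (q : F).

(** Only a zero of the q-integer is recorded, not the least one; this weak condition is what leading
    coefficients provide, and reflections preserve it. *)
Definition qroot p r : Prop :=
  if r.2 is Some m then (0 < m)%N /\ qn (chi p r.1 r.1) m = 0 else True.

(* R is a multiset of degrees and heights with the Hilbert series of B(V). *)
Definition rootsys p R : Prop := [/\ posR R, forall r, r \in R -> qroot p r &
  forall d, hasdim (@homogeneous F n p d) (cnt R d)].

Lemma homog_hasdim p d : exists N, hasdim (@homogeneous F n p d) N.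
Proof.
apply: (@hasdim_ex _ _ _ [seq nw p w | w <- words n `|tot d|]).
  by split; [apply: homog0 | move=> c x y; apply: homog_lin].
move=> x hx; elim/homog_ind: x / hx => [|c a b [c1 ->] [c2 ->]|w wd].
- by exists (fun=> 0); rewrite lincomb0.
- by eexists; rewrite lincomb_lin.
have hw : w \in words n `|tot d| by rewrite mem_words -wd tot_wdeg.
exists (fun k => (k == index w (words n `|tot d|))%:R).
rewrite /lincomb big_mkord; set s := words n _ in hw *.
have hi : (index w s < size [seq nw p w | w <- s])%N by rewrite size_map index_mem.
rewrite (bigD1 (Ordinal hi)) //= eqxx scale1r big1 ?addr0 => [|k /negbTE kE].
  by rewrite (nth_map w) ?index_mem // nth_index.
by rewrite -[(k : nat) == _]/(k == Ordinal hi) kE scale0r.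
Qed.

Lemma gK_hasdim p i d : exists N, hasdim (@gK F n p i d) N.
Proof.
have [N [b [_ _ _ hb]]] := homog_hasdim p d.
apply: (@hasdim_ex _ _ _ b); first exact: gK_subspace.
by move=> x /gK_homog/hb.
Qed.

Lemma homog_ray p i m x : homogeneous (ek i *+ m) x -> exists c : F, x = c *: nx p i ^+ m.
Proof.
move=> hx; elim/homog_ind: x / hx => [|c a b [c1 ->] [c2 ->]|w wd].
- by exists 0; rewrite scale0r.
- by exists (c * c1 + c2); rewrite scalerDl scalerA.
exists 1; rewrite scale1r.
have -> : m = size w.
  by have := congr1 (@tot n) wd; rewrite tot_wdeg totMn tot_ek -mulr_natr natz mul1r => -[].
have : all (pred1 i) w.
  apply/allP => j jw; apply/eqP/eqP; rewrite eq_sym -[_ == _]negbK; apply/negP => ij.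
  have := congr1 (fun a : 'rV_n => a 0 j) wd; rewrite /= wdeg_entry mulmxnE mxE eqxx /=.
  rewrite [j == i]eq_sym (negbTE ij) mul0rn => /eqP.
  by rewrite eqz_nat -leqn0 leqNgt -has_count has_pred1 jw.
elim: w {wd} => [|j w IH] /=; first by rewrite nw_nil expr0.
by case/andP => /eqP -> /IH; rewrite nw_cons exprS => ->.
Qed.

Lemma hasdim_ray p i h m : xheight p i h ->
  hasdim (@homogeneous F n p (ek i *+ m)) (below h m).
Proof.
move=> hh; have := xheight_below m hh; case: (below h m) => [|] x0; last first.
  exists [::]; split=> //; move=> x /homog_ray[c ->]; exists (fun=> 0).
  by rewrite lincomb_nil; move/negbFE/eqP: x0 => ->; rewrite scaler0.
exists [:: nx p i ^+ m]; split=> // [x|c|x /homog_ray[c ->]].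
- by rewrite inE => /eqP ->; apply: xpow_homog.
- by rewrite lincomb_cons lincomb_nil addr0 => /eqP; rewrite scaler_eq0 (negbTE x0) orbF => /eqP c0 [].
by exists (fun=> c); rewrite lincomb_cons lincomb_nil addr0.
Qed.

Lemma qroot_below p r k : qroot p r -> (k <= 1)%N -> below r.2 k.
Proof.
rewrite /qroot; case: r.2 => //= -[|[|m]] [] // _.
  by rewrite /qn big_ord1 expr0 => /eqP; rewrite oner_eq0.
by move=> _ k1; apply: leq_ltn_trans k1 _.
Qed.

Section OneSystem.
Variables (p : 'I_n -> 'I_n -> F) (R : seq root).
Hypothesis hp : forall i j, p i j != 0.
Hypothesis hR : rootsys p R.

Let pR : posR R. Proof. by case: hR. Qed.

Lemma rootsys_cnt r k : r \in R -> below r.2 k -> (0 < cnt R (r.1 *+ k))%N.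
Proof.
move=> rR; apply: cnt_mem => // r' r'R; case: hR => _ hq _.
exact: qroot_below (hq r' r'R) _.
Qed.

Lemma rootsys_word d : (0 < cnt R d)%N -> exists w, wdeg w = d.
Proof.
case: hR => _ _ /(_ d) hd /(hasdim_gt0 hd)[x hx x0]; exact: homog_word hx x0.
Qed.

Lemma rootsys_root r : r \in R -> exists w, wdeg w = r.1.
Proof.
move=> rR; have [_ hq _] := hR; apply: rootsys_word; rewrite -[r.1]mulr1n.
by apply: rootsys_cnt => //; apply: qroot_below (hq r rR) _.
Qed.

(** The components of degree l e_i are spanned by the powers of x_i, so the counts along this ray
    are 0 or 1. That leaves room for exactly one root, with the height of x_i. *)
Lemma rootsys_ray i : exists h, [/\ xheight p i h, (ek i, h) \in R &
  forall r, r \in rem (ek i, h) R -> forall l, r.1 <> ek i *+ l].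
Proof.
have [h hh] := xheight_ex p i; have [_ hq hd] := hR.
have cE m : cnt R (ek i *+ m) = below h m.
  exact: hasdim_uniq (hd _) (hasdim_ray m hh).
have h1 : below h 1 by rewrite -(xheight_below 1 hh) expr1 nx_neq0.
have : [\/ ek i = 0 :> 'rV_n, ek i \in [seq r.1 | r <- R] | 2 <= tot (ek i : 'rV_n)].
  apply: cnt_indecomposable; [exact: totB|by move=> r /(allP pR)|].
  by have := cE 1%N; rewrite mulr1n h1 => ->.
case=> [/(congr1 (@tot n))|/mapP[r0 r0R rE]|]; rewrite ?tot_ek ?tot0 //.
(* Counting shows that the recorded height is at most [h]; since it is a zero of the q-integer of
   [p i i], that power of x_i vanishes, which gives the other inequality. *)
have hE : r0.2 = h.
  have lb m : below r0.2 m -> below h m.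
    by move=> b; have := rootsys_cnt r0R b; rewrite -rE cE lt0b.
  case E: r0.2 lb => [m|] lb; last first.
    by case: (h) lb => // l /(_ l isT) /=; rewrite ltnn.
  have := hq r0 r0R; rewrite /qroot E -rE chi_ek // => -[m0 qm].
  have xm : ~~ below h m.
    by rewrite -(xheight_below m hh) -(prednK m0) negbK; apply/eqP/xpow_eq0; rewrite // prednK.
  have := lb m.-1; rewrite /= prednK // leqnn => /(_ isT).
  case: (h) xm => //= l; rewrite -leqNgt => lm ml; congr Some; apply/eqP.
  by rewrite eqn_leq lm -[X in (X <= _)%N](prednK m0) ml.
have r0E : (ek i, h) = r0 by rewrite -hE rE; case: (r0).
exists h; rewrite r0E; split=> // r rR l rl.
have rR' := mem_rem rR; have pR' : posR (rem r0 R) by apply/allP => y /mem_rem; apply: (allP pR).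
have r00 : 0 < tot r0.1 by rewrite -rE tot_ek.
have [r'0 below1] : (0 < l)%N /\ below r.2 1.
  split; last exact: qroot_below (hq r rR') _.
  by have := allP pR r rR'; rewrite rl totMn tot_ek; case: (l).
have dl : tot (ek i *+ l : 'rV_n) < l.+1%:Z by rewrite totMn tot_ek; lia.
have := cE l; rewrite -(cnt_rem _ pR r0R) (cnt_cons r00 pR' dl) big_mkcond big_ord_recl.
rewrite mulr0n subr0 (qroot_below (hq r0 r0R)) //.
(* The other root alone already gives the degree l e_i. If l is below h, so do l copies of e_i, and
   the count would be at least 2; if not, the count should be 0. *)
have c1 : (0 < cnt (rem r0 R) (ek i *+ l))%N.
  rewrite -rl -[r.1]mulr1n; apply: cnt_mem => // r' /mem_rem r'R.
  exact: qroot_below (hq r' r'R) _.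
case bl: (below h l); last by move/eqP; rewrite addn_eq0 eqn0Ngt c1.
have li : (l.-1 < l)%N by rewrite prednK.
rewrite (bigD1 (Ordinal li)) //= /bump leq0n add1n prednK // -rE subrr.
rewrite hE bl; have c0 : (0 < cnt (rem r0 R) 0)%N.
  rewrite -(mulr0n r.1); apply: cnt_mem => // [r' /mem_rem r'R|].
    exact: qroot_below (hq r' r'R) _.
  exact: qroot_below (hq r rR') _.
move: c1 c0; set a := cnt _ _; set b := cnt _ _; set c := (\sum_(_ < _ | _) _)%N.
lia.
Qed.

End OneSystem.
End Rays.

Section RootChain.
Variables (F : fieldType) (n : nat).
Implicit Types (p : 'I_n -> 'I_n -> F) (i j : 'I_n) (d e : 'rV[int]_n) (m l k : nat).
Local Notation root := ('rV[int]_n * option nat)%type.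
Implicit Types (r : root) (R : seq root) (q : F).

Lemma xheight_eq p p1 i h : p1 i i = p i i -> xheight p i h -> xheight p1 i h.
Proof.
move=> pE hh.
have E m : (nx p1 i ^+ m == 0) = (nx p i ^+ m == 0).
  apply: negb_inj; apply/idP/idP.
    by move/(xpow_neq0 p1 i m) => H; apply/(xpow_neq0 p i m) => l /H; rewrite pE.
  by move/(xpow_neq0 p i m) => H; apply/(xpow_neq0 p1 i m) => l /H; rewrite pE.
case: h hh => [m [/eqP x0 [m0 x1]]|h] /=; last by move=> m; rewrite E.
by split; [apply/eqP; rewrite E|rewrite E].
Qed.

Section OneReflection.
Variables (p : 'I_n -> 'I_n -> F) (R : seq root) (i : 'I_n) (h : option nat).
Hypothesis hp : forall i j, p i j != 0.
Hypothesis hR : rootsys p R.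
Hypothesis hh : xheight p i h.
Hypothesis iR : (ek i, h) \in R.
Hypothesis hray : forall r, r \in rem (ek i, h) R -> forall l, r.1 <> ek i *+ l.

Let pR : posR R. Proof. by case: hR. Qed.
Let pR' : posR (rem (ek i, h) R). Proof. by apply/allP => y /mem_rem; apply: (allP pR). Qed.
Let i0 : 0 < tot (ek i : 'rV[int]_n). Proof. by rewrite tot_ek. Qed.
Let h0 : below h 0.
Proof. by rewrite -(xheight_below 0 hh) expr0 oner_eq0. Qed.

(** Both sides, multiplied by the factor of x_i, give the Hilbert series of B(V), and this factor
    cancels. *)
Lemma hasdim_gK d : hasdim (@gK F n p i d) (cnt (rem (ek i, h) R) d).
Proof.
pose N e := sval (constructive_indefinite_description _ (gK_hasdim p i e)).
have hN e : hasdim (@gK F n p i e) (N e) by apply: svalP.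
suff <- : N d = cnt (rem (ek i, h) R) d by [].
apply: (cnt_below_inj (b := ek i) (h := h)) => // [e e0|e m em]; last first.
  rewrite -(cnt_cons (r := (ek i, h)) i0 pR' em) cnt_rem //.
  by case: hR => _ _ /(_ e) hd; apply: hasdim_uniq hd; apply: hasdim_letter.
split; apply/eqP; rewrite eqn0Ngt; apply/negP.
  by move/(hasdim_gt0 (hN e)) => [x gx x0]; have := gK_tot gx x0; rewrite leNgt e0.
by move/(cnt_tot pR'); rewrite leNgt e0.
Qed.

Lemma rem_tot r : r \in rem (ek i, h) R -> 0 < tot r.1 - r.1 0 i.
Proof.
move=> rR; have rR' := mem_rem rR.
have [w wd] := rootsys_root hR rR'.
rewrite -wd tot_wdeg wdeg_entry subr_gt0 ltz_nat ltn_neqAle count_size andbT.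
apply/negP => /eqP cw; apply: (hray rR (l := size w)); rewrite -wd.
have : all (pred1 i) w by rewrite all_count cw.
elim: w {wd cw} => [|j w IH] /=; first by rewrite wdeg_nil mulr0n.
by case/andP => /eqP -> /IH; rewrite wdeg_cons mulrS => ->.
Qed.

(** Finiteness of the root list is used here: the degree of a nonzero [zel p i j m] has total degree
    1 away from i, while every root other than e_i has a positive one. So this degree is itself a
    root, and infinitely many m are impossible. *)
Lemma cartan_ex : exists M, cartan i M p.
Proof.
suff H j : exists m, j != i -> zel p i j m.+1 = 0 /\ zel p i j m <> 0.
  exists (fun j => sval (constructive_indefinite_description _ (H j))) => j.
  exact: (svalP (constructive_indefinite_description _ (H j))).
case: (eqVneq j i) => [->|ji]; first by exists 0%N.
case: (classic (exists m, zel p i j m == 0)) => [ex|nex]; last first.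
  pose s := [seq zdeg i j m | m <- iota 0 (size R).+1].
  have us : uniq s.
    rewrite map_inj_uniq ?iota_uniq // => m1 m2 /(congr1 (@tot n)).
    by rewrite /zdeg !totD !totMn !tot_ek; lia.
  have sub : {subset s <= [seq r.1 | r <- R]}.
    move=> d /mapP[m _ ->].
    have z0 : (0 < cnt (rem (ek i, h) R) (zdeg i j m))%N.
      apply/(hasdim_gt0 (hasdim_gK _)); exists (zel p i j m); first exact: gK_zel.
      by apply/eqP => z0; apply: nex; exists m; rewrite z0.
    have := cnt_indecomposable (f := fun d => tot d - d 0 i) _ rem_tot z0.
    have fz : tot (zdeg i j m) - zdeg i j m 0 i = 1.
      rewrite /zdeg totD totMn !tot_ek !(mxE, mulmxnE) eqxx [i == j]eq_sym (negbTE ji) !eqxx /=.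
      by lia.
    rewrite fz => -[x y||/mapP[r /mem_rem rR ->]|//].
    - by rewrite totB !mxE; ring.
    - by move=> zd0; have := zdeg_neq0 i j m; rewrite zd0 eqxx.
    by apply: map_f.
  have := uniq_leq_size us sub; by rewrite !size_map size_iota ltnn.
case: (ex_minnP ex) => -[|m] /eqP zm min.
  by move: zm => /= /eqP; rewrite (negbTE (nx_neq0 p j)).
exists m => _; split=> // zm'; have := min m; rewrite zm' eqxx => /(_ isT).
by rewrite ltnn.
Qed.

Variable M : 'I_n -> nat.
Hypothesis hM : cartan i M p.
Local Notation p1 := (prefl i M p).
Local Notation s := (srefl i M).

Definition reflroots : seq root := (ek i, h) :: [seq (s r.1, r.2) | r <- rem (ek i, h) R].

Let hp1 : forall i j, p1 i j != 0. Proof. exact: prefl_neq0. Qed.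

Lemma hasdim_gK_prefl d : hasdim (@gK F n p1 i (s d)) (cnt (rem (ek i, h) R) d).
Proof.
have [N1 hN1] := gK_hasdim p1 i (s d).
by rewrite -(hasdim_prefl hp hM (hasdim_gK d) hN1).
Qed.

(** A root other than e_i is the degree of a nonzero element of K, so its reflection is the degree
    of a nonzero element of the reflected K, hence a sum of unit vectors. *)
Lemma posR_reflroots : posR reflroots.
Proof.
rewrite /= tot_ek ltr01 /=; apply/allP => r1 /mapP[r rR ->] /=.
have c0 : (0 < cnt (rem (ek i, h) R) r.1)%N.
  have [_ hq _] := hR; rewrite -[r.1]mulr1n; apply: cnt_mem => // [r' /mem_rem r'R|].
    exact: qroot_below (hq r' r'R) _.
  exact: qroot_below (hq r (mem_rem rR)) _.
have [x gx x0] := (hasdim_gt0 (hasdim_gK_prefl r.1)).1 c0.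
have [w wd] := homog_word (gK_homog gx) x0; rewrite -wd tot_wdeg ltz_nat lt0n.
apply/negP => /nilP w0; have := allP pR' r rR.
by rewrite -[r.1](sreflK i M) -wd w0 wdeg_nil srefl0 tot0.
Qed.

Lemma rootsys_prefl : rootsys p1 reflroots.
Proof.
have pE : p1 i i = p i i by rewrite /prefl srefl_ek_i chiNl // chiNr // invrK chi_ek.
have [_ hq _] := hR; have pR1 := posR_reflroots.
split=> // [r|d].
  rewrite inE => /orP[/eqP ->|/mapP[r' /mem_rem r'R ->]].
    by have := hq _ iR; rewrite /qroot /= !chi_ek // pE.
  by have := hq _ r'R; rewrite /qroot /= chi_prefl // !sreflK.
have [m dm] : exists m, tot d < m%:Z by exists `|tot d|%N.+1; lia.
case/andP: (pR1) => _ pR1'.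
rewrite (cnt_cons (r := (ek i, h)) i0 pR1' dm).
have hN e : hasdim (@gK F n p1 i e) (cnt [seq (s r.1, r.2) | r <- rem (ek i, h) R] e).
  rewrite -[e](sreflK i M) cnt_map //; first exact: hasdim_gK_prefl.
    exact: sreflB.
  by move=> x sx; rewrite -[x](sreflK i M) sx srefl0.
exact (hasdim_letter hp1 (xheight_eq pE hh) hN dm).
Qed.

End OneReflection.

Definition qheight q (h : option nat) : Prop :=
  if h is Some m then [/\ (0 < m)%N, qn q m = 0 & forall l, (0 < l < m)%N -> qn q l != 0]
  else forall l, (0 < l)%N -> qn q l != 0.

Lemma xheight_qheight p i h : (forall i j, p i j != 0) -> xheight p i h -> qheight (p i i) h.
Proof.
move=> hp hh; have xb m := xheight_below m hh.
have q0 l : (0 < l)%N -> below h l -> qn (p i i) l != 0.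
  by move=> l0; rewrite -xb xpow_neq0 // => /(_ l.-1); rewrite prednK // => H; apply: H.
case: h hh q0 xb => [m [x0 [m0 x1]]|hh] q0 xb /=; last by move=> l l0; apply: q0.
split=> // [|l /andP[l0 lm]]; last exact: q0.
apply/eqP/negPn/negP => qm; have := (xpow_neq0 p i m).2; rewrite x0 eqxx => H.
have // : false; apply: H => l; rewrite leq_eqVlt => /orP[/eqP -> //|lm].
exact: q0.
Qed.

(* phi records the images under the previous reflections of the positive roots:
   each reflection makes one more value negative, so phi becomes negative on
   every simple root, and a given root must have been simple at some step. *)
Lemma rootsys_qheight_rec p R (phi : 'rV[int]_n -> int) : (forall i j, p i j != 0) ->
  rootsys p R -> (forall x y, phi (x - y) = phi x - phi y) ->
  (forall r, r \in R -> phi r.1 != 0) ->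
  forall r, r \in R -> 0 < phi r.1 -> qheight (chi p r.1 r.1) r.2.
Proof.
have [N] := ubnP (size R - count (fun r => (phi r.1 < 0)%R) R)%N.
elim: N => // N IH in p R phi *; rewrite ltnS => RN hp hR phiB phi0 r rR phir.
have phiN x : phi (- x) = - phi x.
  by have := phiB 0 0; rewrite !subrr => p0; rewrite -[- x]sub0r phiB p0 sub0r.
have phiD x y : phi (x + y) = phi x + phi y by rewrite -{1}[y]opprK phiB phiN opprK.
(* The root [r] is a sum of unit vectors, so [phi] cannot be nonpositive on all of them. *)
have [i phii] : exists i, 0 < phi (ek i).
  apply: not_all_not_ex => phin.
  have [w wr] := rootsys_root hR rR.
  move: phir; rewrite -wr ltNge => /negP; apply.
  elim: w {wr} => [|j w IHw]; first by rewrite wdeg_nil -(subrr (0 : 'rV_n)) phiB subrr.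
  by rewrite wdeg_cons phiD -(addr0 0) lerD // leNgt; apply/negP/phin.
have [h [hh iR hray]] := rootsys_ray hR i.
case: (eqVneq r (ek i, h)) => [->|ri]; first by rewrite /= chi_ek //; apply: xheight_qheight.
have [M hM] := cartan_ex hp hR hh iR hray.
have rR' : r \in rem (ek i, h) R.
  by have := perm_mem (perm_to_rem iR) r; rewrite rR inE (negbTE ri) => /esym.
have hR1 := rootsys_prefl hp hR hh iR hM.
have -> : chi p r.1 r.1 = chi (prefl i M p) (srefl i M r.1) (srefl i M r.1).
  by rewrite chi_prefl // !sreflK.
have := IH _ _ (fun d => phi (srefl i M d)) _ (prefl_neq0 i M hp) hR1 _ _ (srefl i M r.1, r.2).
rewrite /= !sreflK; apply=> //.
(* The new functional is negative at [ek i], where [phi] was positive, and takes the old values at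
   the reflected roots. *)
- move: RN; rewrite !(perm_size (perm_to_rem iR)) (permP (perm_to_rem iR)) /= size_map count_map.
  rewrite srefl_ek_i phiN oppr_lt0 phii ltNge (ltW phii) /=.
  rewrite (@eq_count _ (preim _ _) (fun r => phi r.1 < 0)); last by move=> r' /=; rewrite sreflK.
  have := count_size (fun r => phi r.1 < 0) (rem (ek i, h) R); set c := count _ _; lia.
- by move=> x y; rewrite sreflB.
- move=> r1; rewrite inE => /orP[/eqP ->|/mapP[r' /mem_rem r'R ->]] /=; last by rewrite sreflK phi0.
  by rewrite srefl_ek_i phiN oppr_eq0 lt0r_neq0.
by rewrite inE; apply/orP; right; apply/mapP; exists r.
Qed.

Lemma rootsys_qheight p R r : (forall i j, p i j != 0) -> rootsys p R -> r \in R ->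
  qheight (chi p r.1 r.1) r.2.
Proof.
move=> hp hR rR; have [pR _ _] := hR.
apply: (rootsys_qheight_rec hp hR (@totB n)) => //; last exact: (allP pR).
by move=> r' r'R; rewrite lt0r_neq0 // (allP pR).
Qed.
End RootChain.

Section Heights.
Variable F : fieldType.
Hypothesis hF : [pchar F] =i pred0.
Implicit Types (q : F) (m k : nat) (h : option nat).

Lemma qn_eq0 q m : q != 1 -> (qn q m == 0) = (q ^+ m == 1).
Proof.
move=> q1; have := subrX1 q m; rewrite -/(qn q m) => E.
by rewrite -[RHS]subr_eq0 E mulf_eq0 subr_eq0 (negbTE q1).
Qed.

Lemma qheight_below q h k : qheight q h ->
  (forall m, q != 1 -> m.-primitive_root q -> (k < m)%N) <-> below h k.
Proof.
have ge m : q != 1 -> m.-primitive_root q -> qn q m = 0.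
  by move=> q1 /prim_expr_order E; apply/eqP; rewrite qn_eq0 // E.
case: h => [l [l0 ql lmin]|hn] /=; last first.
  split=> // _ m q1 hm; have := hn m (prim_order_gt0 hm).
  by rewrite (ge m q1 hm) eqxx.
split=> [H|kl m q1 hm]; last first.
  apply: leq_trans kl _; rewrite leqNgt; apply/negP => ml.
  by have := lmin m; rewrite (prim_order_gt0 hm) ml (ge m q1 hm) eqxx => /(_ isT).
(* At q = 1 the q-integer of [l] is [l], which is nonzero in characteristic zero. *)
have q1 : q != 1.
  apply/eqP => q1; move: ql; rewrite /qn q1 (eq_bigr (fun=> 1)); last by move=> j _; rewrite expr1n.
  rewrite sumr_const card_ord; move/eqP.
  by have /pcharf0P -> := hF; rewrite eqn0Ngt l0.
have /eqP ql1 : q ^+ l == 1 by rewrite -qn_eq0 // ql.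
have [m hm ml] := prim_order_exists l0 ql1.
apply: leq_trans (H m q1 hm) _; exact: dvdn_leq.
Qed.

End Heights.

Lemma below_heightE (F : fieldType) (hF : [pchar F] =i pred0) (n : nat) (p : 'I_n -> 'I_n -> F)
    (hp : forall i j, p i j != 0) (us : seq (seq 'I_n)) (H : seq 'I_n -> option nat) :
  hard_list p us -> (forall w, hard p w -> w \in us) ->
  (forall u, u \in us -> height_spec p u (H u)) ->
  forall u k, u \in us -> below_height p k u <-> below (H u) k.
Proof.
move=> hus hall hH u k uus; apply: (qheight_below hF).
have hR : rootsys p (pbw_roots H us).
  have [hd _ _] := hus; split=> [|r /mapP[v vus ->]|d].
  - apply/allP => r /mapP[v vus ->] /=; rewrite tot_wdeg ltz_nat.
    by have /hard_lyndon := hd v vus; case: v {vus}.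
  - rewrite /qroot /=; case E: (H v) => [m|] //.
    have hm := hH v vus; rewrite E in hm; have m0 := height_pos hm; split=> //.
    have := height_qinv hp (hd v vus) hm; rewrite /qinv_sum; set q := chi p _ _ => qE.
    have q0 : q != 0 by apply: chi_neq0.
    (* Multiplied by [q ^+ m.-1] and read backwards, the sum of inverse powers becomes the
       q-integer. *)
    rewrite -[RHS](mulr0 (q ^+ m.-1)) -qE mulr_sumr (reindex_inj rev_ord_inj) /=.
    apply: eq_bigr => j _; have -> : m.-1 = (j + (m - j.+1))%N by have := ltn_ord j; lia.
    by rewrite exprD mulfK // expf_neq0.
  have hE x : gsub (p := p) (fun w => w \in us) d x <-> homogeneous d x.
    split=> hx; last exact: gsub_all.
    by apply: gsub_homog hx => v vus; apply/hard_lyndon/hd.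
  exact: hasdim_iff hE (pbw_dim hp d hus hH).
exact: (rootsys_qheight hp hR (map_f _ uus)).
Qed.

(** * Connected degrees *)

Section ConnectedDegrees.
Variables (F : fieldType) (n : nat) (p : 'I_n -> 'I_n -> F).
Hypothesis hp : forall i j, p i j != 0.
Hypothesis hp1 : forall i, p i i != 1.
Local Notation B := (nichols p).
Local Notation chi := (chi p).
Local Notation X := (nw p).
Local Notation L := (@nlie F n p).
Implicit Types (x y : B) (i j : 'I_n) (a b c u v w : seq 'I_n) (d e : 'rV[int]_n).
Implicit Types (S T A : {set 'I_n}).

(** Connectedness by cuts instead of paths: a nonempty part without edges to the rest is everything.
    Edges to a point outside T make the vertices automatically distinct. *)
Definition cutc S : Prop := forall T, T \subset S -> T != set0 ->
  (forall i j, i \in T -> j \in S -> j \notin T -> p i j * p j i = 1) -> T = S.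

Lemma dconnectedP S : dconnected p S <-> cutc S.
Proof.
rewrite /dconnected; set e : rel 'I_n := fun i j => [&& i \in S, j \in S & dynkin_edge p i j]; split.
  case/andP=> _ /forall_inP cS T /subsetP TS /set0Pn[i iT] hT.
  apply/setP => j; apply/idP/idP => [/TS //|jS].
  have cl : closed e (mem T).
    move=> k l /and3P[kS lS /andP[_ kl]]; apply/idP/idP => [kT|lT].
      apply: contraR kl => lT; exact/eqP/hT.
    by apply: contraR kl => kT; rewrite mulrC; apply/eqP/hT.
  have /forall_inP/(_ j jS) ij := cS i (TS i iT).
  by have := closed_connect cl ij; rewrite /= iT => <-.
move=> hS; apply/andP; split; first by apply/forall_inP => i _.
apply/forall_inP => i iS; apply/forall_inP => j.
have <- : [set k in S | connect e i k] = S; last by rewrite inE => /andP[].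
apply: hS => [|| k l].
- by apply/subsetP => k; rewrite inE => /andP[].
- by apply/set0Pn; exists i; rewrite inE iS connect0.
rewrite !inE => /andP[kS ik] lS; rewrite lS /= => il; apply/eqP/negPn/negP => kl.
case/negP: (il); apply: connect_trans (ik) (connect1 _); rewrite /e kS lS /dynkin_edge kl andbT.
by apply/eqP => E; case/negP: il; rewrite -E.
Qed.

Definition letters w : {set 'I_n} := [set i | i \in w].

Lemma mu_wdeg w : mu (wdeg w) = letters w.
Proof. by apply/setP => i; rewrite !inE wdeg_entry eqz_nat -lt0n -has_count has_pred1. Qed.

Definition apart u v : Prop :=
  forall i j, i \in u -> j \in v -> i != j /\ p i j * p j i = 1.

(** The difference of the two sides is killed by all [dR k]. *)
Lemma nx_apart i j : i != j -> p i j * p j i = 1 -> nx p i * nx p j = p i j *: (nx p j * nx p i).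
Proof.
move=> ij pij; apply/eqP; rewrite -subr_eq0; apply/eqP.
have hij : homogeneous (ek i + ek j) (nx p i * nx p j - p i j *: (nx p j * nx p i)).
  apply: homogB; first by apply: homogM; apply: homog_nx.
  by apply: homogZ; rewrite addrC; apply: homogM; apply: homog_nx.
apply: (dR_eq0 hij) => [|k].
  by apply/eqP => /(congr1 (@tot n)); rewrite totD !tot_ek tot0.
rewrite linearB linearZ /= !(dRM hp k _ (homog_nx p _)) !dR_nx !chi_ek //.
case: (eqVneq i k) => [E|_]; case: (eqVneq j k) => [E'|_] /=.
- by rewrite E E' eqxx in ij.
- by rewrite E !(mulr0, mulr1, mul0r, mul1r, scaler0, add0r, addr0) subrr.
- rewrite E' in pij *; rewrite !(mulr0, mulr1, mul0r, mul1r, scaler0, add0r, addr0).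
  by rewrite scalerA pij scale1r subrr.
by rewrite !(mulr0, mul0r, scaler0, addr0) subrr.
Qed.

Lemma nw_apart u v : apart u v -> X u * X v = chi (wdeg u) (wdeg v) *: (X v * X u).
Proof.
elim: u => [|i u IH] h.
  by rewrite nw_nil wdeg_nil chi0l // mul1r mulr1 scale1r.
have hi : X v * nx p i = (chi (ek i) (wdeg v))^-1 *: (nx p i * X v).
  have : apart [:: i] v by move=> k j; rewrite inE => /eqP ->; apply: h; rewrite mem_head.
  elim: v {IH h} => [|j v IH] h.
    by rewrite nw_nil wdeg_nil chi0r // invr1 scale1r mul1r mulr1.
  have [ij pij] := h i j (mem_head _ _) (mem_head _ _).
  rewrite nw_cons wdeg_cons chiDr // chi_ek // -mulrA IH; last first.
    by move=> k l hk hl; apply: h; rewrite // inE hl orbT.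
  rewrite -scalerAr [nx p j * (nx p i * _)]mulrA [nx p i * (nx p j * _)]mulrA (nx_apart ij pij).
  by rewrite -scalerAl scalerA invfM mulrAC mulVf ?mul1r.
have hu : apart u v by move=> k l hk hl; apply: h; rewrite // inE hk orbT.
rewrite nw_cons wdeg_cons chiDl // -mulrA IH // -scalerAr [nx p i * (X v * _)]mulrA [X v * (nx p i * _)]mulrA hi.
by rewrite -scalerAl scalerA mulrAC mulfV ?mul1r ?chi_neq0.
Qed.

Lemma chi_apart u v : apart u v -> chi (wdeg u) (wdeg v) * chi (wdeg v) (wdeg u) = 1.
Proof.
elim: u => [|i u IH] h; first by rewrite wdeg_nil chi0l // chi0r // mulr1.
rewrite wdeg_cons chiDl // chiDr // mulrACA IH ?mulr1; last first.
  by move=> k l hk hl; apply: h; rewrite // inE hk orbT.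
have {IH}h : apart [:: i] v by move=> k j; rewrite inE => /eqP ->; apply: h; rewrite mem_head.
elim: v h => [|j v IH] h; first by rewrite wdeg_nil chi0l // chi0r // mulr1.
rewrite wdeg_cons chiDl // chiDr // mulrACA IH ?mulr1; last first.
  by move=> k l hk hl; apply: h; rewrite // inE hl orbT.
by rewrite !chi_ek //; have [] := h i j (mem_head _ _) (mem_head _ _).
Qed.

Lemma nlieZ (k : F) x : L x -> L (k *: x).
Proof. by move=> hx; rewrite -[_ *: _]addr0; apply: nlie_lin hx (nlie_zero p). Qed.

Lemma nlieD x y : L x -> L y -> L (x + y).
Proof. by move=> hx hy; rewrite -[x]scale1r; apply: nlie_lin. Qed.

Definition conn w : Prop := w <> [::] /\ cutc (letters w).

Lemma letters_cat u v : letters (u ++ v) = letters u :|: letters v.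
Proof. by apply/setP => i; rewrite !inE mem_cat. Qed.

Lemma conn_perm u v : letters u = letters v -> conn u -> conn v.
Proof.
move=> E [u0 cu]; split; last by rewrite -E.
case: u u0 E {cu} => // i u _ /setP/(_ i); rewrite !inE eqxx; by case: v.
Qed.

Lemma conn_neq0 w : w <> [::] -> letters w != set0.
Proof. by case: w => // i w _; apply/set0Pn; exists i; rewrite inE mem_head. Qed.

Lemma conn1 i : conn [:: i].
Proof.
split=> // T; have -> : letters [:: i] = [set i] by apply/setP => j; rewrite !inE.
by rewrite subset1 => /orP[/eqP -> //|/eqP ->]; rewrite eqxx.
Qed.

Lemma cutc_sub S A T : cutc S -> S \subset A -> T \subset A ->
  (forall i j, i \in T -> j \in A -> j \notin T -> p i j * p j i = 1) ->
  S \subset T \/ [disjoint S & T].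
Proof.
move=> cS SA TA hT; case: (eqVneq (S :&: T) set0) => ST.
  by right; rewrite -setI_eq0 ST.
left; apply/setIidPl; apply: cS => // [|i j]; first exact: subsetIl.
rewrite !inE => /andP[iS iT] jS; rewrite jS /= => jT.
by apply: hT => //; apply: (subsetP SA).
Qed.

Lemma conn_part c u v : conn c -> apart u v -> conn (c ++ (u ++ v)) -> conn (c ++ u).
Proof.
move=> [c0 cc] uv [_ cS]; split; first by case: (c) c0.
move=> T TS T0 hT; rewrite letters_cat in TS hT *.
have hS : letters c \subset letters c :|: letters u by apply: subsetUl.
(* A side of a cut that misses c lies in u, so it is also a side of a cut of c u v. *)
have key (W : {set 'I_n}) : W \subset letters c :|: letters u -> W != set0 -> [disjoint letters c & W] ->
    (forall i j, i \in W -> j \in letters c :|: letters u -> j \notin W -> p i j * p j i = 1) ->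
    False.
  move=> WS W0 dW hW; have Wu i : i \in W -> i \in u.
    move=> iW; have := subsetP WS i iW; rewrite !inE => /orP[ic|//].
    by have := disjointFl dW iW; rewrite inE ic.
  have E : W = letters (c ++ (u ++ v)).
    apply: cS => // [|i j iW].
      by rewrite !letters_cat setUA; apply: subset_trans WS (subsetUl _ _).
    rewrite !letters_cat setUA inE => /orP[jS|]; first exact: hW.
    by rewrite inE => jv _; have [] := uv i j (Wu i iW) jv.
  have /set0Pn[k kc] := conn_neq0 c0.
  have := disjointFr dW kc; rewrite E letters_cat inE kc //.
case: (cutc_sub cc hS TS hT) => [cT|cT]; last by case: (key T).
apply/eqP; rewrite eqEsubset TS /= -setD_eq0; apply/negPn/negP => D0.
apply: (key _ _ D0) => [||i j].
- exact: subsetDl.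
- by rewrite disjoint_sym -setI_eq0 -subset0; apply/subsetP => k; rewrite !inE => /andP[/andP[/negP kT _] kc]; case: kT; apply: (subsetP cT); rewrite inE.
rewrite !inE => /andP[iT iS] jS; rewrite jS andbT negbK => jT.
by rewrite mulrC; apply: hT; rewrite // !inE.
Qed.

Lemma nw_split A v : (forall i j, i \in v -> j \in v -> i \in A -> j \notin A -> p i j * p j i = 1) ->
  exists k : F, X v = k *: (X (filter (mem A) v) * X (filter (mem (~: A)) v)).
Proof.
elim: v => [|i v IH] h; first by exists 1; rewrite nw_nil mul1r scale1r.
have [|k E] := IH; first by move=> k l kv lv; apply: h; rewrite inE ?kv ?lv orbT.
rewrite nw_cons E /= inE; case: (boolP (i \in A)) => iA /=.
  by exists k; rewrite nw_cons -scalerAr mulrA.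
exists (k * chi (ek i) (wdeg (filter (mem A) v))).
have hi : apart [:: i] (filter (mem A) v).
  move=> l j; rewrite inE mem_filter => /eqP -> /andP[/= jA jv]; split.
    by apply: contraNneq iA => ->.
  by rewrite mulrC; apply: h; rewrite ?mem_head // inE jv orbT.
have := nw_apart hi; rewrite wdeg1 nw_cons nw_nil mulr1 => E'.
by rewrite nw_cons -scalerAr [nx p i * (X _ * _)]mulrA E' -scalerAl scalerA -mulrA.
Qed.

(* Rotation modulo L(V); if v is not connected, its two parts are moved one by one. *)
Lemma nw_rot N : (forall w, (size w < N)%N -> conn w -> L (X w)) ->
  forall c v, (size (c ++ v) <= N)%N -> conn c -> conn (c ++ v) ->
  L (X (c ++ v) - chi (wdeg c) (wdeg v) *: X (v ++ c)).
Proof.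
move=> IH c v; have [m] := ubnP (size v); elim: m => // m IHm in c v *.
rewrite ltnS => vm sN hc hcv; case: (eqVneq v [::]) => [->|v0].
  by rewrite cats0 /= wdeg_nil chi0r // scale1r subrr; apply: nlie_zero.
have c0 : (0 < size c)%N by case: hc => /eqP; case: (c).
have sv : (0 < size v)%N by case: (v) v0.
rewrite size_cat in sN.
case: (classic (cutc (letters v))) => cv.
  (* For connected v the difference is the bracket of v and c, both of which are shorter than the
     whole word. *)
  rewrite !nw_cat; apply: (nlie_bracket (homog_nw p v) (homog_nw p c)).
    by apply: IH; [lia | split=> //; apply/eqP].
  by apply: IH => //; lia.
have [A [AS A0 hA AE]] : exists A, [/\ A \subset letters v, A != set0,
    forall i j, i \in A -> j \in letters v -> j \notin A -> p i j * p j i = 1 & A <> letters v].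
  apply: NNPP => nA; apply: cv => T TS T0 hT; apply: NNPP => TE.
  by apply: nA; exists T.
pose u1 : seq 'I_n := filter (mem A) v; pose u2 : seq 'I_n := filter (mem (~: A)) v.
have [|k E] := @nw_split A v.
  by move=> i j _ jv iA jA; apply: hA => //; rewrite inE.
have ap : apart u1 u2.
  move=> i j; rewrite !mem_filter => /andP[/= iA _] /andP[/= + jv]; rewrite inE => jA; split.
    by apply: contraNneq jA => <-.
  by apply: hA; rewrite // inE.
have ap' : apart u2 u1.
  by move=> i j hi hj; have [] := ap j i hj hi; rewrite eq_sym mulrC.
have pu : perm_eq (u1 ++ u2) v.
  have -> : u2 = filter (predC (mem A)) v by apply: eq_filter => i; rewrite /= inE.
  by rewrite perm_filterC.
have vE : wdeg v = wdeg u1 + wdeg u2 by rewrite -wdeg_cat; apply: perm_big; rewrite perm_sym.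
have lE : letters (c ++ v) = letters (c ++ (u1 ++ u2)).
  by apply/setP => i; rewrite !inE !(mem_cat i c) (perm_mem pu).
have hcv1 := conn_perm lE hcv.
have hcv2 : conn (c ++ (u2 ++ u1)).
  by apply: conn_perm hcv1; apply/setP => i; rewrite !inE !mem_cat [(i \in u1) || _]orbC.
have h1 := conn_part hc ap hcv1; have h2 := conn_part hc ap' hcv2.
have su : (size u1 + size u2 = size v)%N by rewrite -size_cat (perm_size pu).
have s1 : (0 < size u1)%N.
  have /set0Pn[i iA] := A0; have := subsetP AS i iA; rewrite inE => iv.
  by rewrite lt0n size_eq0; apply/eqP => E1; have := in_nil i; rewrite -E1 mem_filter /= iA iv.
have s2 : (0 < size u2)%N.
  rewrite lt0n size_eq0; apply/eqP => E2; case: AE; apply/eqP; rewrite eqEsubset AS /=.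
  apply/subsetP => i; rewrite inE => iv; apply/negPn/negP => iA.
  by have := in_nil i; rewrite -E2 mem_filter /= inE iA iv.
rewrite -/u1 -/u2 in E; clearbody u1 u2.
have H1 := IHm (c ++ u1) u2; have H2 := IHm (u2 ++ c) u1.
rewrite !size_cat in H1 H2.
have {}H1 : L (X ((c ++ u1) ++ u2) - chi (wdeg (c ++ u1)) (wdeg u2) *: X (u2 ++ (c ++ u1))).
  by apply: H1; [lia | lia | | rewrite -catA].
have {}H2 : L (X ((u2 ++ c) ++ u1) - chi (wdeg (u2 ++ c)) (wdeg u1) *: X (u1 ++ (u2 ++ c))).
  apply: H2; [lia | lia | | ].
    by apply: conn_perm h2; rewrite !letters_cat setUC.
  apply: conn_perm hcv1; rewrite !letters_cat; apply/setP => i; rewrite !inE.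
  by case: (i \in u1); case: (i \in u2); case: (i \in c).
have := nlieZ k (nlieD H1 (nlieZ (chi (wdeg (c ++ u1)) (wdeg u2)) H2)).
have eqL x y : x = y -> L x -> L y by move=> ->.
move/eqL; apply; rewrite !wdeg_cat !nw_cat vE E.
have h0 := chi_neq0 hp (wdeg u1) (wdeg u2).
have /(canRL (mulKf h0)) E' := chi_apart ap.
rewrite !(chiDl hp, chiDr hp) E'; move: h0 (X c) (X u1) (X u2).
move: (chi _ _) (chi _ _) (chi _ _) => c1 c2 c3 h0 x y1 y2.
by nring F (nichols p); field; rewrite ?h0.
Qed.

End ConnectedDegrees.

Section ConnectedComponents.
Variables (F : fieldType) (n : nat) (p : 'I_n -> 'I_n -> F).
Hypothesis hp : forall i j, p i j != 0.
Hypothesis hp1 : forall i, p i i != 1.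
Local Notation B := (nichols p).
Local Notation chi := (chi p).
Local Notation X := (nw p).
Local Notation L := (@nlie F n p).
Local Notation conn := (conn p).
Implicit Types (x y : B) (i j k : 'I_n) (a b c u v w : seq 'I_n) (d e : 'rV[int]_n).

Lemma conn_edge i j : p i j * p j i != 1 -> conn [:: i; j].
Proof.
move=> pij; split=> // T TS T0 hT.
have inS k : (k \in letters [:: i; j]) = (k == i) || (k == j) by rewrite !inE.
have iT_jT : (i \in T) = (j \in T).
  apply/idP/idP => [iT|jT]; apply: contraR pij => h; apply/eqP.
    by apply: hT => //; rewrite inS eqxx orbT.
  by rewrite mulrC; apply: hT => //; rewrite inS eqxx.
have /set0Pn[k kT] := T0.
have iT : i \in T by have := subsetP TS k kT; rewrite inS => /orP[]/eqP E; rewrite E in kT; rewrite // iT_jT.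
apply/eqP; rewrite eqEsubset TS; apply/subsetP => l; rewrite inS => /orP[]/eqP -> //.
by rewrite -iT_jT.
Qed.

Lemma nlieB x y : L x -> L y -> L (x - y).
Proof. by move=> hx hy; apply: nlieD => //; rewrite -scaleN1r; apply: nlieZ. Qed.

Lemma nlie_unscale (z : F) x : z != 0 -> L (z *: x) -> L x.
Proof. by move=> z0 h; rewrite -[x](scalerK z0); apply: nlieZ. Qed.

Section OneLength.
Variable N : nat.
Hypothesis IH : forall w, (size w < N)%N -> conn w -> L (X w).

Lemma nlie_adjacent a i j b : (size (a ++ i :: j :: b) <= N)%N -> conn (a ++ i :: j :: b) ->
  p i j * p j i != 1 -> L (X (a ++ i :: j :: b)).
Proof.
elim: a b => [|k a IHa] b sN cw pij; last first.
  (* Letters in front of the pair are rotated to the end one at a time. *)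
  have := nw_rot hp IH (c := [:: k]) sN (conn1 p k) cw => h.
  rewrite -[X _](subrK (chi (wdeg [:: k]) (wdeg (a ++ [:: i, j & b])) *: X ((a ++ [:: i, j & b]) ++ [:: k]))).
  apply: nlieD h _; apply: nlieZ; rewrite -catA /=; apply: IHa => //.
    by move: sN; rewrite /= !size_cat /= cats1 size_rcons; lia.
  apply: conn_perm cw; apply/setP => l; rewrite !(inE, mem_cat) /=.
  by case: (l == k); rewrite ?orbT ?orbF //.
have R1 := nw_rot hp IH (c := [:: i; j]) sN (conn_edge pij) cw.
have R2 := nw_rot hp IH (c := [:: i]) sN (conn1 p i) cw.
have R3 : L (X ([:: j] ++ (b ++ [:: i])) - chi (wdeg [:: j]) (wdeg (b ++ [:: i])) *: X ((b ++ [:: i]) ++ [:: j])).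
  apply: (nw_rot hp IH) (conn1 p j) _.
    by move: sN; rewrite /= cats1 size_rcons.
  apply: conn_perm cw; apply/setP => l; rewrite !(inE, mem_cat) /=.
  by case: (l == i); rewrite ?orbT ?orbF //.
have E : L (X (b ++ [:: i; j])).
  have hz : chi (wdeg [:: i; j]) (wdeg b) * (p i j * p j i - 1) != 0.
    by rewrite mulf_neq0 ?chi_neq0 // subr_eq0.
  apply: (nlie_unscale hz).
  (* [R2] followed by [R3] leads to the same word as [R1]; in the difference only that word
     survives, with the nonzero coefficient of [hz]. *)
  have := nlieB R1 (nlieD R2 (nlieZ (chi (wdeg [:: i]) (wdeg (j :: b))) R3)).
  have eqL x y : x = y -> L x -> L y by move=> ->.
  apply: eqL; rewrite /= -catA /= !(wdeg_cons, wdeg_cat, wdeg_nil) !addr0.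
  rewrite !(chiDl hp, chiDr hp) !chi_ek //; move: (X _) (X _) (X _) => x y z.
  by nring F (nichols p); ring.
rewrite -[X _](subrK (chi (wdeg [:: i; j]) (wdeg b) *: X (b ++ [:: i; j]))).
by apply: nlieD R1 (nlieZ _ E).
Qed.

(** Induction on the gap b, through the letter k next to j: if k is linked to i, the gap to k is
    shorter; if k is linked to j, these are linked neighbours; otherwise k is swapped with j. *)
Lemma nlie_linked b a i j c : (size (a ++ i :: b ++ j :: c) <= N)%N ->
  conn (a ++ i :: b ++ j :: c) -> p i j * p j i != 1 -> L (X (a ++ i :: b ++ j :: c)).
Proof.
elim/last_ind: b a i j c => [|b k IHb] a i j c; first exact: nlie_adjacent.
rewrite cat_rcons => sN cw pij; case: (eqVneq (p i k * p k i) 1) => pik; last exact: IHb.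
case: (eqVneq (p k j * p j k) 1) => pkj; last first.
  have E : a ++ i :: b ++ [:: k, j & c] = (a ++ i :: b) ++ [:: k, j & c] by rewrite -catA.
  by rewrite E in sN cw *; apply: nlie_adjacent.
have kj : k != j by apply: contraNneq pij => <-; rewrite pik.
have -> : X (a ++ i :: b ++ [:: k, j & c]) = p k j *: X (a ++ i :: b ++ [:: j, k & c]).
  rewrite !(nw_cat, nw_cons) [nx p k * (nx p j * _)]mulrA (nx_apart hp kj pkj) -scalerAl.
  by rewrite -!scalerAr !mulrA.
apply: nlieZ; apply: IHb => //.
  by move: sN; rewrite !size_cat /= !size_cat.
apply: conn_perm cw; apply/setP => l; rewrite !(inE, mem_cat) /=.
by case: (l == j); case: (l == k); rewrite ?orbT.
Qed.

End OneLength.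

(** If the first letter i is linked to a later one, [nlie_linked] applies; the later letter may be i
    itself when p_ii^2 is not 1. Otherwise connectedness leaves only the letter i, and a repeated i
    forces p_ii = -1, so that x_i^2 = 0. *)
Lemma nlie_nw w : conn w -> L (X w).
Proof.
have [N] := ubnP (size w); elim: N => // N IH in w *; rewrite ltnS => sw cw.
case: w cw sw => [[] //|i w] cw sw.
case: (classic (exists2 j, j \in w & p i j * p j i != 1)) => [[j jw pij]|nex].
  by case/splitPr: jw sw cw => b c sw cw; apply: (nlie_linked (a := [::]) IH).
have wi : all (pred1 i) w.
  apply/allP => j jw; apply/eqP; case: cw => _ /(_ [set i]) cS.
  have : letters (i :: w) = [set i]; last by move/setP/(_ j); rewrite !inE jw orbT => /esym/eqP.
  symmetry; apply: cS => [||k l].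
  - by rewrite sub1set inE mem_head.
  - by apply/set0Pn; exists i; rewrite inE.
  rewrite !inE => /eqP -> /orP[->//|lw] li; apply/eqP/negPn/negP => pil.
  by apply: nex; exists l.
case: w wi nex {cw sw} => [|j w] /=; first by move=> _ _; rewrite nw_cons nw_nil mulr1; apply: nlie_gen.
case/andP => /eqP -> _ nex.
have pii : p i i * p i i = 1 by apply/eqP/negPn/negP => h; apply: nex; exists i; rewrite ?mem_head.
have x2 : nx p i ^+ 2 = 0.
  apply: xpow_eq0 => //; rewrite /qn !big_ord_recl big_ord0 expr0 expr1 addr0.
  have : (p i i - 1) * (1 + p i i) = 0 by rewrite mulrDr mulr1 mulrBl pii mul1r; ring.
  by move/eqP; rewrite mulf_eq0 subr_eq0 (negbTE (hp1 i)) => /eqP.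
rewrite !nw_cons mulrA -expr2 x2 mul0r; exact: nlie_zero.
Qed.

Lemma homog_nlie d x : d != 0 -> dconnected p (mu d) -> homogeneous d x -> L x.
Proof.
move=> d0 hd hx; elim/homog_ind: x / hx => [|z x y|w wd]; first exact: nlie_zero.
  exact: nlie_lin.
apply: nlie_nw; split; first by move=> w0; rewrite -wd w0 wdeg_nil eqxx in d0.
by rewrite -mu_wdeg wd; apply/(dconnectedP hp1).
Qed.

Lemma apart_bracket d e x y : homogeneous d x -> homogeneous e y ->
  (forall i j, i \in mu d -> j \in mu e -> i != j /\ p i j * p j i = 1) ->
  nbracket d e x y = 0.
Proof.
move=> hx hy h; elim/homog_ind: x / hx => [|z x1 x2|u ud].
- by rewrite /nbracket mulr0 mul0r scaler0 subrr.
- rewrite /nbracket => h1 h2.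
  rewrite -[RHS]addr0 -{2}h2 -[in RHS](scaler0 _ z) -h1.
  by nring F (nichols p); ring.
elim/homog_ind: y / hy => [|z y1 y2|v vd].
- by rewrite /nbracket mulr0 mul0r scaler0 subrr.
- rewrite /nbracket => h1 h2.
  rewrite -[RHS]addr0 -{2}h2 -[in RHS](scaler0 _ z) -h1.
  by nring F (nichols p); ring.
have uv : apart p v u.
  move=> i j iv ju; have [] := h j i.
  - by rewrite -ud mu_wdeg inE.
  - by rewrite -vd mu_wdeg inE.
  by rewrite eq_sym mulrC.
by rewrite /nbracket (nw_apart hp uv) -ud -vd subrr.
Qed.

Lemma nlie_connected x : L x -> forall d, hproj d x != 0 -> d != 0 /\ dconnected p (mu d).
Proof.
elim=> {x} [i|d|z x y _ IHx _ IHy|d e x y hx hy _ IHx _ IHy].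
- move=> d; have /homogP hx := homog_nx p i; rewrite -hx hprojK hx.
  case: (eqVneq d (ek i)) => [-> _|_]; last by rewrite eqxx.
  split; first by apply/eqP => /(congr1 (@tot n)); rewrite tot_ek tot0.
  by rewrite -wdeg1 mu_wdeg; apply/(dconnectedP hp1); have [] := conn1 p i.
- by rewrite linear0 eqxx.
- move=> d; case: (eqVneq (hproj d x) 0) => [x0|/IHx //].
  by rewrite linearP /= x0 scaler0 add0r => /IHy.
move=> f hf; have hb := homog_br hx hy.
have b0 : nbracket d e x y != 0 by apply: contraNneq hf => ->; rewrite linear0.
have -> : f = d + e.
  move/homogP: hb hf => <-; rewrite hprojK.
  by case: (eqVneq f (d + e)) => // _; rewrite eqxx.
have x0 : x != 0 by apply: contraNneq b0 => ->; rewrite /nbracket mulr0 mul0r scaler0 subrr.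
have y0 : y != 0 by apply: contraNneq b0 => ->; rewrite /nbracket mulr0 mul0r scaler0 subrr.
have [d0 /(dconnectedP hp1) cd] : d != 0 /\ dconnected p (mu d).
  by apply: IHx; move/homogP: hx => ->.
have [_ /(dconnectedP hp1) ce] : e != 0 /\ dconnected p (mu e).
  by apply: IHy; move/homogP: hy => ->.
have [u ud] := homog_word hx x0; have [v ve] := homog_word hy y0.
have mE : mu (d + e) = mu d :|: mu e by rewrite -ud -ve -wdeg_cat !mu_wdeg letters_cat.
split.
  apply/eqP => /(congr1 (@tot n)); rewrite -ud -ve totD !tot_wdeg tot0.
  by move: d0; rewrite -ud wdeg_eq0; case: (u) => // i w _ /=; lia.
apply/(dconnectedP hp1); rewrite mE => T TS T0 hT.
(* Each of the two supports lies on one side of the cut. If the sides differ, the supports are not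
   linked and the bracket is zero, contrary to [b0]. *)
case: (cutc_sub cd (subsetUl _ _) TS hT) => dT; case: (cutc_sub ce (subsetUr _ _) TS hT) => eT.
- by apply/eqP; rewrite eqEsubset TS subUset dT eT.
- case/eqP: b0; apply: apart_bracket => // i j id je; have iT := subsetP dT i id.
  have jT : j \notin T by rewrite (disjointFr eT je).
  split; first by apply: contraNneq jT => <-.
  by apply: hT; rewrite // inE je orbT.
- case/eqP: b0; apply: apart_bracket => // i j id je; have jT := subsetP eT j je.
  have iT : i \notin T by rewrite (disjointFr dT id).
  split; first by apply: contraNneq iT => ->.
  by rewrite mulrC; apply: hT; rewrite // inE id.
have /set0Pn[k kT] := T0; have := subsetP TS k kT.
by rewrite inE (disjointFl dT kT) (disjointFl eT kT).
Qed.

End ConnectedComponents.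

(** * Exponent functions versus exponent lists, and the basis theorem *)

Section MonomialIndices.
Variables (F : fieldType) (n : nat) (p : 'I_n -> 'I_n -> F) (I : finType) (f : I -> seq 'I_n).
Variable H : seq 'I_n -> option nat.
Implicit Types (k : {ffun I -> nat}) (e : seq I) (ks : seq nat).

Lemma pbw_map k e : pbw p (map f e) (map k e) = \prod_(i <- rev e) superletter p (f i) ^+ k i.
Proof. by elim: e => [|i e IH] /=; rewrite ?big_nil // IH rev_cons big_rcons. Qed.

Lemma pbw_deg_map k e : pbw_deg (map f e) (map k e) = \sum_(i <- e) wdeg (f i) *+ k i.
Proof. by elim: e => [|i e IH] /=; rewrite ?big_nil // IH big_cons addrC. Qed.

Lemma pbw_adm_map k e : pbw_adm H (map f e) (map k e) = all (fun i => below (H (f i)) (k i)) e.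
Proof. by elim: e => //= i e ->. Qed.

Lemma pbw_adm_size us ks : pbw_adm H us ks -> size ks = size us.
Proof. by elim: us ks => [|u us IH] [|k ks] //= /andP[_ /IH ->]. Qed.

Definition exponents e ks : {ffun I -> nat} := [ffun i => nth 0%N ks (index i e)].

Lemma map_exponents e ks : uniq e -> size ks = size e -> map (exponents e ks) e = ks.
Proof.
move=> ue se; apply: (@eq_from_nth _ 0%N) => [|j]; rewrite size_map // => je.
case: e ue se je => // i0 e ue se je.
by rewrite (nth_map i0) // ffunE index_uniq.
Qed.

Lemma exponentsK e k : (forall i, i \in e) -> exponents e (map k e) = k.
Proof.
move=> he; apply/ffunP => i; rewrite ffunE (nth_map i) ?index_mem ?he //.
by rewrite nth_index.
Qed.

End MonomialIndices.

Theorem theorem3p3 (F : closedFieldType) (hF : [pchar F] =i pred0)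
    (n : nat) (hn : (2 <= n)%N) (p : 'I_n -> 'I_n -> F)
    (hp : forall i j : 'I_n, p i j != 0)
    (hp1 : forall i : 'I_n, p i i != 1)
    (s : nat) (u : s.-tuple (seq 'I_n))
    (hD : forall w : seq 'I_n, hard p w <-> w \in u)
    (hu : forall i j : 'I_s, (i < j)%N -> wlt (tnth u j) (tnth u i)) :
  is_basis
    (fun k : {ffun 'I_s -> nat} =>
       [/\ forall i : 'I_s, below_height p (k i) (tnth u i),
           dconnected p (mu (\sum_(i < s) wdeg (tnth u i) *+ k i))
         & (0 < \sum_(i < s) k i)%N])
    (fun k : {ffun 'I_s -> nat} =>
       \prod_(i < s) superletter p (tnth u i) ^+ k i)
    (@nlie F n p).
Proof.
(* The tuple [u] is decreasing while [hard_list] asks for an increasing list. *)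
pose e := rev (enum 'I_s); pose us := map (tnth u) e.
have he i : i \in e by rewrite mem_rev mem_enum.
have ue : uniq e by rewrite rev_uniq enum_uniq.
have usE w : (w \in us) = (w \in u) by rewrite /us map_rev map_tnth_enum mem_rev.
have hard_us w : hard p w -> w \in us by rewrite usE => /hD.
have hus : hard_list p us.
  split=> [w|| v w _ /hard_us //]; first by rewrite usE => /hD.
  rewrite -(sorted_pairwise (@wlt_trans n)) /us sorted_map rev_sorted.
  apply: (sub_sorted (e := relpre val ltn)) => [i j /hu //|].
  by rewrite -sorted_map val_enum_ord iota_ltn_sorted.
have [H hH] := heights_ex p us.
have belowE (i : 'I_s) m : below_height p m (tnth u i) <-> below (H (tnth u i)) m.
  by apply: (below_heightE hF hp hus hard_us hH); rewrite usE mem_tnth.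
have admE (k : {ffun 'I_s -> nat}) :
    pbw_adm H us (map k e) <-> forall i, below_height p (k i) (tnth u i).
  rewrite /us pbw_adm_map; split=> [/allP h i|h]; first exact/belowE/h.
  by apply/allP => i _; apply/belowE.
have degE (k : {ffun 'I_s -> nat}) : pbw_deg us (map k e) = \sum_(i < s) wdeg (tnth u i) *+ k i.
  by rewrite /us pbw_deg_map (perm_big (enum 'I_s)) ?big_enum // perm_rev.
have pbwE (k : {ffun 'I_s -> nat}) :
    pbw p us (map k e) = \prod_(i < s) superletter p (tnth u i) ^+ k i.
  by rewrite /us pbw_map revK enumT [index_enum _]unlock.
(* Hard words are nonempty, so the condition that some exponent is positive says that the degree is
   nonzero. *)
have deg0 (k : {ffun 'I_s -> nat}) :
    (\sum_(i < s) wdeg (tnth u i) *+ k i != 0) = (0 < \sum_(i < s) k i)%N.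
  have totE : tot (\sum_(i < s) wdeg (tnth u i) *+ k i) = (\sum_(i < s) size (tnth u i) * k i)%N%:Z.
    rewrite (big_morph (@tot n) (@totD n) (@tot0 n)) [RHS](big_morph Posz PoszD erefl).
    by apply: eq_bigr => i _; rewrite totMn tot_wdeg -mulr_natr natz PoszM.
  rewrite lt0n; congr negb; apply/eqP/eqP => [d0|].
    move: totE; rewrite d0 tot0 => -[] /esym/eqP; rewrite sum_nat_eq0 => /forallP h.
    apply: big1 => i _; have := h i; rewrite muln_eq0 => /orP[/nilP ui|/eqP //].
    by have /hD[] := mem_tnth i u; rewrite ui.
  move/eqP; rewrite sum_nat_eq0 => /forallP h; apply: big1 => i _.
  by have /eqP -> := h i; rewrite mulr0n.
split=> [k [hk ck k0]|r c ur hr E k kr|x hx].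
- apply: (homog_nlie hp hp1 _ ck); first by rewrite deg0.
  rewrite -pbwE -degE; have hl w : w \in us -> lyndon w by rewrite usE => /hD[].
  by apply: (pbw_homog p (H := H) hl); apply/admE.
- have := pbw_indep hp hus hH (r := [seq map k e | k : {ffun 'I_s -> nat} <- r])
    (c := fun ks => c (exponents e ks)) _ _ _ (map_f _ kr).
  rewrite exponentsK //; apply=> [|ks /mapP[k' /hr[hk' _ _] ->]|].
  + rewrite map_inj_uniq // => k1 k2 E12.
    by rewrite -(exponentsK k1 he) -(exponentsK k2 he) E12.
  + exact/admE.
  by rewrite big_map -[RHS]E; apply: eq_bigr => k' _; rewrite exponentsK // pbwE.
(* Every nonzero homogeneous component of x has nonzero connected degree, and its PBW expansion uses
   only monomials of that same degree. *)
have [ds _ xE] := hdecomp x; rewrite xE; apply: fincomb_sum => d _.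
case: (eqVneq (hproj d x) 0) => [->|xd]; first exact: fincomb0.
have [d0 cd] := nlie_connected hp hp1 hx xd.
have [r [c [hr ->]]] := pbw_span hp hus hH (gsub_all hard_us (homog_hproj d x)).
rewrite big_seq; apply: fincomb_sum => ks /hr[hks dks].
have ksE : map (exponents e ks) e = ks.
  by apply: map_exponents => //; rewrite (pbw_adm_size hks) size_map.
rewrite -[_ *: _]addr0; apply: fincomb_lin (fincomb0 _ _).
rewrite -ksE pbwE; apply: fincomb_in; rewrite -deg0 -degE ksE dks; split=> //.
by apply/admE; rewrite ksE.
Qed.
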